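(* Let $\lambda\in\mathbb Z_{\ge0}^N$, $|\lambda|=n$. For $J,K\in\mathcal I_\lambda$, $$\sum_{I\in\mathcal I_\lambda}\frac{W_J\big(z_I,z,\Pi^{-1}q^{2\sum_{j=1}^n\langle\bar\epsilon_{\mu_j},h\rangle}\big)\,W_{\sigma_0(K)}\big(z_I,\sigma_0(z),\Pi\big)}{Q(z_I)R(z_I)S(z_I)^2}=\delta_{J,K},$$ where $\sum_{j=1}^n\bar\epsilon_{\mu_j}=\sum_{l=1}^N\lambda_l\bar\epsilon_l$ is the weight associated with $\lambda$, and $$Q(z_I)=\prod_{1\le k<l\le N}\prod_{a\in I_k}\prod_{b\in I_l}[u_b-u_a+1],\qquad R(z_I)=\prod_{1\le k<l\le N}\prod_{a\in I_k}\prod_{b\in I_l}[u_b-u_a],$$ $$S(z_I)=\prod_{1\le k<l\le N}\ \prod_{a,b\in I_k}[u_a-u_b+1]\ \prod_{1\le k\ne l\le N-1}\ \prod_{a\in I_k}\prod_{b\in I_l}[u_a-u_b+1].$$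
   Context: **Theta function.** $0<|q|<1$ (branch of $\log q$ fixed), $r$ a generic positive real, $p=q^{2r}$, $[u]=q^{u^2/r-u}\Theta_p(q^{2u})$, $\Theta_p(z)=(z;p)_\infty(p/z;p)_\infty(p;p)_\infty$, $(x;p)_\infty=\prod_{n\ge0}(1-xp^n)$. **Combinatorics.** $\mathcal I_\lambda$ is the set of partitions $I=(I_1,\dots,I_N)$ of $\{1,\dots,n\}$ with $|I_l|=\lambda_l$; $I=I_{\mu_1\cdots\mu_n}$ means $I_l=\{i:\mu_i=l\}$. $\lambda^{(l)}=\lambda_1+\cdots+\lambda_l$, $I^{(l)}=I_1\cup\cdots\cup I_l=\{i^{(l)}_1<\cdots<i^{(l)}_{\lambda^{(l)}}\}$. $\sigma_0$ is the longest element of the symmetric group $\mathfrak S_n$: $\sigma_0(z)=(z_n,\dots,z_1)$, and for $K=I_{\mu_1\cdots\mu_n}$, $\sigma_0(K)=I_{\mu_n\cdots\mu_1}$. **Variables.** $t=(t^{(l)}_a)_{1\le l\le N-1,\,1\le a\le\lambda^{(l)}}$, $t^{(l)}_a=q^{2v^{(l)}_a}$, $z=(z_1,\dots,z_n)$, $z_k=q^{2u_k}$; in $W_I(t,z,\Pi)$, $v^{(N)}_k$ is the additive variable of the $k$-th entry of $z$. Dynamical parameters $(P+h)_{j,k}$ with $(P+h)_{j,k}+(P+h)_{k,l}=(P+h)_{j,l}$; $\Pi_{j,k}=q^{2(P+h)_{j,k}}$. $\langle\bar\epsilon_\mu,h_{j,k}\rangle=\delta_{\mu,j}-\delta_{\mu,k}$.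 The argument $\Pi^{-1}q^{2\sum_j\langle\bar\epsilon_{\mu_j},h\rangle}$ means that $(P+h)_{j,k}$ is replaced by $-(P+h)_{j,k}+\lambda_j-\lambda_k$. $C_{\mu_s,l+1}(s)=\sum_{j=s+1}^n\langle\bar\epsilon_{\mu_j},h_{\mu_s,l+1}\rangle$. **Weight functions.** $W_I(t,z,\Pi)=\mathrm{Sym}_{t^{(1)}}\cdots\mathrm{Sym}_{t^{(N-1)}}U_I(t,z,\Pi)$, where $\mathrm{Sym}_{t^{(l)}}$ is the sum over all permutations of $t^{(l)}_1,\dots,t^{(l)}_{\lambda^{(l)}}$ and \begin{align*}U_I=\prod_{l=1}^{N-1}\prod_{a=1}^{\lambda^{(l)}}\Bigg(&\frac{[v^{(l+1)}_b-v^{(l)}_a+(P+h)_{\mu_s,l+1}-C_{\mu_s,l+1}(s)][1]}{[(P+h)_{\mu_s,l+1}-C_{\mu_s,l+1}(s)]}\Bigg|_{i^{(N)}_s=i^{(l+1)}_b=i^{(l)}_a}\\&\times\prod_{\substack{b=1\\ i^{(l+1)}_b>i^{(l)}_a}}^{\lambda^{(l+1)}}[v^{(l+1)}_b-v^{(l)}_a]\prod_{\substack{b=1\\ i^{(l+1)}_b<i^{(l)}_a}}^{\lambda^{(l+1)}}[v^{(l+1)}_b-v^{(l)}_a+1]\prod_{b=a+1}^{\lambda^{(l)}}\frac{[v^{(l)}_b-v^{(l)}_a+1]}{[v^{(l)}_b-v^{(l)}_a]}\Bigg)\end{align*} (in the first factor $b,s$ are the indices determined by $i^{(N)}_s=s=i^{(l+1)}_b=i^{(l)}_a$).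 **Specialization.** Setting $t=z_I$ means $v^{(l)}_a=u_{i^{(l)}_a}$ for $l=1,\dots,N-1$, $a=1,\dots,\lambda^{(l)}$ (in both factors, with the original numbering of $u_1,\dots,u_n$).
   Formalization: In S(z_I) the factor for each pair k≠l≤N−1 is taken with multiplicity N−max(k,l) instead of once; the printed S is the same for N≤3 but makes the relation false for N≥4, e.g. N=4, λ=(1,1,0,0). *)

(* Defs.v *)
From mathcomp Require Import all_boot all_order all_algebra all_fingroup.
From mathcomp Require Import complex.
From mathcomp Require Import all_classical all_reals all_analysis.

Set Implicit Arguments.
Unset Strict Implicit.
Unset Printing Implicit Defensive.

Import Order.TTheory GRing.Theory Num.Theory.
Import numFieldNormedType.Exports.

Local Open Scope ring_scope.
Local Open Scope complex_scope.
Local Open Scope classical_set_scope.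

Definition cexp (R : realType) (z : R[i]) : R[i] :=
  (expR (complex.Re z))%:C * (cos (complex.Im z) +i* sin (complex.Im z)).

(* q^u for the branch of log q given by logq *)
Definition qpow (R : realType) (logq u : R[i]) : R[i] := cexp (u * logq).

Definition qpoch (R : realType) (x p : R[i]) : R[i] :=
  lim ((fun m : nat => \prod_(k < m) (1 - x * p ^+ k) : R[i]^o) @ \oo).

Definition Theta (R : realType) (p z : R[i]) : R[i] :=
  qpoch z p * qpoch (p / z) p * qpoch p p.

(* [u], with p = q^(2r) *)
Definition bracket (R : realType) (logq : R[i]) (r : R) (u : R[i]) : R[i] :=
  qpow logq (u ^+ 2 / r%:C - u)
  * Theta (qpow logq (2 * r%:C)) (qpow logq (2 * u)).

(* A partition I = I_{mu_1 ... mu_n} is encoded by the word mu.  Colours and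
   positions count from 0, so the colour l + 1 of the usual convention is the
   ordinal of value l; levels l keep their usual value: I^(l) is the set of
   positions whose colour is among the first l, and I^(N) is everything. *)
Notation word n N := {ffun 'I_n -> 'I_N}.

Definition block (n N : nat) (I : word n N) (l : 'I_N) : {set 'I_n} :=
  [set i | I i == l]%SET.

Definition partitions (n N : nat) (lam : 'I_N -> nat) : {set word n N} :=
  [set I : word n N | [forall l, #|block I l| == lam l]]%SET.

Definition upto (n N : nat) (I : word n N) (l : nat) : {set 'I_n} :=
  [set i | (I i < l)%N]%SET.

(* idx I l a is i^(l)_a: enum_val lists a set of ordinals increasingly *)
Definition idx (n N : nat) (I : word n N) (l : nat) (a : 'I_#|upto I l|)
  : 'I_n := enum_val a.

Definition sigma0 (n : nat) (T : Type) (f : 'I_n -> T) : 'I_n -> T :=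
  fun i => f (rev_ord i).

Definition sigma0_word (n N : nat) (K : word n N) : word n N :=
  finfun (sigma0 K).

(* <bar epsilon_mu, h_{j,k}> *)
Definition pairing (F : fieldType) (N : nat) (mu j k : 'I_N) : F :=
  (mu == j)%:R - (mu == k)%:R.

Definition Cshift (F : fieldType) (n N : nat) (I : word n N) (s : 'I_n)
    (l : 'I_N) : F :=
  \sum_(j < n | (s < j)%N) pairing F (I j) (I s) l.

(* v l a is v^(l)_a, and P j k is (P+h)_{j,k}.  In the first factor, s = i^(l)_a
   and the product over b has a single term, the one with i^(l+1)_b = i^(l)_a;
   the colour "l + 1" is the ordinal l. *)
Definition U (F : fieldType) (br : F -> F) (n N : nat) (I : word n N)
    (v : nat -> nat -> F) (P : 'I_N -> 'I_N -> F) : F :=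
  \prod_(l < N | (0 < l)%N) \prod_(a < #|upto I l|)
    ( (\prod_(b < #|upto I l.+1| | idx b == idx a)
         (br (v l.+1 b - v l a + P (I (idx a)) l - Cshift F I (idx a) l) * br 1
          / br (P (I (idx a)) l - Cshift F I (idx a) l)))
    * (\prod_(b < #|upto I l.+1| | (idx a < idx b)%N) br (v l.+1 b - v l a))
    * (\prod_(b < #|upto I l.+1| | (idx b < idx a)%N) br (v l.+1 b - v l a + 1))
    * (\prod_(b < #|upto I l| | (a < b)%N)
         (br (v l b - v l a + 1) / br (v l b - v l a)))).

Definition act_perm (m : nat) (s : 'S_m) (a : nat) : nat :=
  if insub a is Some i then val (s i) else a.

Definition Sym (F : fieldType) (l m : nat) (f : (nat -> nat -> F) -> F)
    (v : nat -> nat -> F) : F :=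
  \sum_(s : 'S_m) f (fun k a => v k (if k == l then act_perm s a else a)).

(* a finite list of variables as a sequence; its values past the end are
   never used *)
Definition extend (F : fieldType) (m : nat) (x : 'I_m -> F) (a : nat) : F :=
  if insub a is Some i then x i else 0.

(* The variables are t l a = v^(l)_a for 0 < l < N, and the additive
   coordinates u of z, which are the v^(N)_k.  The size of the l-th group of
   variables is #|I^(l)|, which is lambda^(l) for I in partitions n lam. *)
Definition W (F : fieldType) (br : F -> F) (n N : nat) (I : word n N)
    (t : nat -> nat -> F) (u : 'I_n -> F) (P : 'I_N -> 'I_N -> F) : F :=
  foldr (fun l f => Sym l #|upto I l| f) (fun v => U br I v P) (index_iota 1 N)
    (fun l => if (l < N)%N then t l else extend u).

(* t = z_I *)
Definition spec (F : fieldType) (n N : nat) (I : word n N) (u : 'I_n -> F)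
  : nat -> nat -> F :=
  fun l => extend (fun a : 'I_#|upto I l| => u (idx a)).

(* Pi^{-1} q^{2 sum_j <bar epsilon_{mu_j}, h>} *)
Definition dual_param (F : fieldType) (N : nat) (lam : 'I_N -> nat)
    (P : 'I_N -> 'I_N -> F) : 'I_N -> 'I_N -> F :=
  fun j k => - P j k + (lam j)%:R - (lam k)%:R.

Definition Qfactor (F : fieldType) (br : F -> F) (n N : nat) (I : word n N)
    (u : 'I_n -> F) : F :=
  \prod_(k < N) \prod_(l < N | (k < l)%N)
    \prod_(a in block I k) \prod_(b in block I l) br (u b - u a + 1).

Definition Rfactor (F : fieldType) (br : F -> F) (n N : nat) (I : word n N)
    (u : 'I_n -> F) : F :=
  \prod_(k < N) \prod_(l < N | (k < l)%N)
    \prod_(a in block I k) \prod_(b in block I l) br (u b - u a).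

(* The second product runs over the triples (k, l, m), in colours counted from
   1, with k <> l and k, l <= m <= N - 1, so a pair (k, l) occurs
   N - max(k, l) times, in the same way as (k, k) occurs N - k times in the
   first one.  Taking each pair k <> l <= N - 1 once is the same for N <= 3
   (Sfactor_le3), but makes the orthogonality relation false for N >= 4: with
   N = 4 and lam = (1, 1, 0, 0) the sum would be
   ([u_1 - u_2 + 1] [u_2 - u_1 + 1])^2 times delta_{J,K}. *)
Definition Sfactor (F : fieldType) (br : F -> F) (n N : nat) (I : word n N)
    (u : 'I_n -> F) : F :=
  (\prod_(k < N) \prod_(l < N | (k < l)%N)
     \prod_(a in block I k) \prod_(b in block I k) br (u a - u b + 1))
  * (\prod_(m < N) \prod_(k < N | (k < m)%N) \prod_(l < N | (l < m)%N && (l != k))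
       \prod_(a in block I k) \prod_(b in block I l) br (u a - u b + 1)).

Lemma Sfactor_le3 (F : fieldType) (br : F -> F) (n N : nat) (I : word n N)
    (u : 'I_n -> F) : (N <= 3)%N ->
  Sfactor br I u =
  (\prod_(k < N) \prod_(l < N | (k < l)%N)
     \prod_(a in block I k) \prod_(b in block I k) br (u a - u b + 1))
  * (\prod_(k < N | (k < N.-1)%N) \prod_(l < N | (l < N.-1)%N && (l != k))
       \prod_(a in block I k) \prod_(b in block I l) br (u a - u b + 1)).
Proof.
case: N I => [|N] I hN.
  by rewrite /Sfactor !big_ord0.
congr (_ * _); rewrite big_ord_recr /= [X in X * _]big1 ?mul1r // => m _.
rewrite big1 // => k; rewrite /= => km; rewrite big1 // => l /andP[lm lk].
have m1 : (m <= 1)%N by rewrite -ltnS (leq_trans (ltn_ord m)).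
suff : l == k by rewrite (negPf lk).
apply/eqP/val_inj => /=.
have := leq_trans km m1; have := leq_trans lm m1.
by rewrite !ltnS !leqn0 => /eqP -> /eqP ->.
Qed.

(* Main.v *)
Require Import Defs.
From mathcomp Require Import all_boot all_order all_algebra all_fingroup.
From mathcomp Require Import complex.
From mathcomp Require Import all_classical all_reals all_analysis.
From mathcomp Require Import ring zify.

Set Implicit Arguments.
Unset Strict Implicit.
Unset Printing Implicit Defensive.

Import Order.TTheory GRing.Theory Num.Theory.
Local Open Scope ring_scope.

(** The proof has an algebraic half, valid for every odd function br that
    satisfies the addition law [three_term], and an analytic half, which
    establishes this law for the bracket.

    Algebra. Two square matrices that are inverse to each other in one order
    are so in the other. Hence it is enough to sum over J instead of I, and to
    show that
      G(I, I') = sum_J W_J(z_I, z, dual Pi) W_(sigma_0 J)(z_I', sigma_0 z, Pi)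
    vanishes for I <> I' and equals Q R S^2 at z_I for I = I'. In G the level
    variables z_I and z_I' may be considered as constants, and then G is a
    symmetric function of z: exchanging two adjacent entries of z acts on the
    functions W_J by 2 x 2 blocks of a dynamical R-matrix that mix J with the
    word in which the two colours are swapped ([partial_weight_exchange]), and
    the blocks of the two families are inverse transposes of each other
    ([unitarity], [paired_sum_perm]). On the other hand br 0 = 0, and this makes
    W_J(z_I, z) vanish unless, on every level l, I^(l) arises from J^(l) by
    moving positions to the left ([partial_weight_lowering]). The second family
    behaves in the opposite way, so a nonzero term of G(I, I') has
    sum I^(l) <= sum J^(l) <= sum I'^(l). Evaluating G at the reversed z, which
    does not change it, reverses these inequalities. So G(I, I') <> 0 forces
    equality on every level, and then I = J = I' ([gram_term]). For I = I' the
    same argument leaves a single arrangement of the variables in each factor,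
    and its value is read off layer by layer ([partial_weight_diagonal],
    [layer_diag]).

    The exchange relation is proved by induction on the levels. The variables of
    level l + 1 enter the layer between the levels l and l + 1 in the same way
    for all l, with z in the role of the highest level, which leads to the
    recursive form [partial_weight] of W. In one layer, the two adjacent
    positions only interact through four variables, and the inductive step is
    an identity between products of brackets of their differences
    ([exchange_diag], [exchange_off], [symmetric_pair_weight]); where the
    induction starts, at the layer of the larger of the two colours, it is a
    single instance of the addition law ([base_low], [base_high]).

    Analysis. By the triple product identity, Theta(XZ) Theta(X/Z) is a sum over
    pairs of integers (m, k). Splitting it by the parity of m + k separates X from
    Z, and X^-1 Theta(XZ) Theta(X/Z) becomes a 2 x 2 determinant in two
    theta series at X and at Z. The addition law is then the Pluecker relation
    between the minors of four vectors ([plucker_identity], [theta_plucker]),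
    since the exponents of the prefactors of the bracket add up to the same
    quadratic form in its three terms. The triple product is used in its finite
    form, a case of the q-binomial theorem ([finite_triple_product]); the
    determinants of the truncated series satisfy the Pluecker relation exactly,
    and they converge to the theta products by dominated convergence
    ([determinant_cvg]). *)

(** * The addition law and the exchange of two variables in one layer *)

(** With h = (p + q) / 2, s = (p - q) / 2 and a' = a + s, b' = b + s, c' = c + s,
    the first summand is br (h + a') br (h - a') br (b' - c') br (b' + c'), which
    is the classical form of the addition law of the sigma function. The
    weights supply the arguments p, q, a, b, c directly. *)
Definition three_term (F : numFieldType) (br : F -> F) := forall p q a b c : F,
  br (p + a) * br (q - a) * (br (b - c) * br (p - q + b + c))
  + br (p + b) * br (q - b) * (br (c - a) * br (p - q + c + a))
  + br (p + c) * br (q - c) * (br (a - b) * br (p - q + a + b)) = 0.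

Section ThetaIdentities.

Variables (F : numFieldType) (br : F -> F).
Hypothesis br_odd : {morph br : x / - x}.
Hypothesis fay : three_term br.

(** The relation between the diagonal and the off-diagonal entries of the
    exchange block that makes it unitary, cleared of denominators. *)
Lemma addition_square (P x : F) :
  br 1 ^+ 2 * br (P + x) * br (P - x)
  = br P ^+ 2 * br (x + 1) * br (1 - x) + br (P - 1) * br (P + 1) * br x ^+ 2.
Proof.
have := fay P P x 0 1.
rewrite subrr !add0r !subr0 !addr0 => h.
move: h; rewrite br_odd [1 + x]addrC => h.
by apply/eqP; rewrite -subr_eq0 -oppr_eq0 -h; apply/eqP; ring.
Qed.

Section Four.
(* These are y1 - x1, y2 - x2 and y1 - x2 in the notation of [pair_weight] below;
   then de = y2 - x1, x = x1 - x2 and y = y1 - y2. *)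
Variables (al be ga : F).
Let de := al + be - ga.
Let x := ga - al.
Let y := ga - be.

Lemma addition_sum :
  br x * br ga * br (de + 1) * br (y + 1) - br y * br (x - 1) * br de * br (ga + 1)
  = br 1 * br be * br (al + 1) * br (x + y).
Proof.
have := fay 0 (al + be + 1) ga de be.
rewrite !add0r.
have -> : al + be + 1 - ga = de + 1 by rewrite /de; ring.
have -> : al + be + 1 - de = ga + 1 by rewrite /de; ring.
have -> : al + be + 1 - be = al + 1 by ring.
have -> : de - be = - x by rewrite /de /x; ring.
have -> : - (al + be + 1) + de + be = - (y + 1) by rewrite /de /y; ring.
have -> : - (al + be + 1) + be + ga = x - 1 by rewrite /x; ring.
have -> : - (al + be + 1) + ga + de = - 1 by rewrite /de; ring.
have -> : be - ga = - y by rewrite /y; ring.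
have -> : ga - de = x + y by rewrite /x /y /de; ring.
rewrite !br_odd => h.
by apply/eqP; rewrite -subr_eq0 -h; apply/eqP; ring.
Qed.

Lemma addition_difference :
  br al * br (be + 1) * br (y + 1) * br x - br y * br be * br (al + 1) * br (x + 1)
  = br 1 * br de * br (ga + 1) * br (x - y).
Proof.
have := fay 0 (al + be + 1) al be de.
rewrite !add0r.
have -> : al + be + 1 - al = be + 1 by ring.
have -> : al + be + 1 - de = ga + 1 by rewrite /de; ring.
have -> : al + be + 1 - be = al + 1 by ring.
have -> : be - de = x by rewrite /de /x; ring.
have -> : - (al + be + 1) + be + de = - (y + 1) by rewrite /de /y; ring.
have -> : - (al + be + 1) + de + al = - (x + 1) by rewrite /x /de; ring.
have -> : - (al + be + 1) + al + be = - 1 by ring.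
have -> : de - al = - y by rewrite /y /de; ring.
have -> : al - be = - (x - y) by rewrite /x /y; ring.
rewrite !br_odd => h.
by apply/eqP; rewrite -subr_eq0 -oppr_eq0 -h; apply/eqP; ring.
Qed.

Variables (Pa Pb : F).
Let P := Pa - Pb.
Let A1 := br (al + Pa) * br (be + Pb).
Let A2 := br (de + Pa) * br (ga + Pb).
Let A3 := br (ga + Pa) * br (de + Pb).
Let A4 := br (be + Pa) * br (al + Pb).

Lemma addition_dynamical_sum :
  A1 * br (x + y) * br P = br (y + P) * br x * A2 + br y * br (P - x) * A3.
Proof.
have := fay Pa (al + be + Pb) al de ga.
have -> : al + be + Pb - al = be + Pb by ring.
have -> : al + be + Pb - de = ga + Pb by rewrite /de; ring.
have -> : al + be + Pb - ga = de + Pb by rewrite /de; ring.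
have -> : de - ga = - (x + y) by rewrite /x /y /de; ring.
have -> : Pa - (al + be + Pb) + de + ga = P by rewrite /P /de; ring.
have -> : ga - al = x by [].
have -> : Pa - (al + be + Pb) + ga + al = y + P by rewrite /P /y; ring.
have -> : al - de = y by rewrite /y /de; ring.
have -> : Pa - (al + be + Pb) + al + de = P - x by rewrite /P /x /de; ring.
rewrite !br_odd ![Pa + _]addrC => h.
by apply/eqP; rewrite -subr_eq0 -oppr_eq0 -h /A1 /A2 /A3; apply/eqP; ring.
Qed.

Lemma addition_dynamical_difference :
  br (x + P) * br y * A1 + br P * br (x - y) * A3 = br (y + P) * br x * A4.
Proof.
have := fay Pa (al + be + Pb) al be ga.
have -> : al + be + Pb - al = be + Pb by ring.
have -> : al + be + Pb - be = al + Pb by ring.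
have -> : al + be + Pb - ga = de + Pb by rewrite /de; ring.
have -> : be - ga = - y by rewrite /y; ring.
have -> : Pa - (al + be + Pb) + be + ga = x + P by rewrite /P /x; ring.
have -> : ga - al = x by [].
have -> : Pa - (al + be + Pb) + ga + al = y + P by rewrite /P /y; ring.
have -> : al - be = - (x - y) by rewrite /y /x; ring.
have -> : Pa - (al + be + Pb) + al + be = P by rewrite /P; ring.
rewrite !br_odd ![Pa + _]addrC => h.
by apply/eqP; rewrite -subr_eq0 -oppr_eq0 -h /A1 /A3 /A4; apply/eqP; ring.
Qed.

(** The parentheses on the two sides are both multiples of br (x + y), by
    [addition_sum] and [addition_dynamical_sum]; this bracket drops out. *)
Lemma exchange_off_poly :
  br P * A1 * (br x * br ga * br (de + 1) * br (y + 1)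
               - br y * br (x - 1) * br de * br (ga + 1))
  = br 1 * br be * br (al + 1)
    * (br (y + P) * br x * A2 + br y * br (P - x) * A3).
Proof. by rewrite addition_sum -addition_dynamical_sum; ring. Qed.

(** After multiplication by br x, the difference of the two sides is a
    combination of instances of the addition law. The brackets of x + y and
    x - y occur in these instances and cancel out of the combination, which
    avoids dividing by them: they may vanish. *)
Lemma exchange_diag_poly : br x != 0 ->
  A3 * br al * br (be + 1) * br (x - 1) * br P ^+ 2 * br (y + 1)
  + br 1 * br (x + P) * br P * A1 * br ga * br (de + 1) * br (y + 1)
  = br 1 * br (y + P) * br P * A4 * br de * br (ga + 1) * br (x - 1)
    + br 1 ^+ 2 * br (y + P) * br (x + P) * A2 * br be * br (al + 1)
    + br (P - 1) * br (P + 1) * br y * br x * A3 * br be * br (al + 1).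
Proof.
move=> x_neq0; apply: (mulfI x_neq0).
have h0 := addition_sum; have h0' := addition_difference; have h1 := addition_dynamical_sum; have h2 := addition_dynamical_difference.
have h3 := addition_square P x.
have xm : br (1 - x) = - br (x - 1) by rewrite -br_odd [- (x - 1)]opprB.
rewrite xm in h3; rewrite [P + x]addrC in h3.
move: h0 h0' h1 h2 h3; rewrite -/P -/x -/y -/de -/A1 -/A2 -/A3 -/A4.
set X := br x; set Y := br y; set XY := br (x + y); set XmY := br (x - y).
set p := br P; set xP := br (x + P); set yP := br (y + P); set Px := br (P - x).
set o := br 1; set Pm := br (P - 1); set Pp := br (P + 1).
set x1 := br (x + 1); set xm1 := br (x - 1); set y1 := br (y + 1).
set a := br al; set a1 := br (al + 1); set b := br be; set b1 := br (be + 1).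
set c := br ga; set c1 := br (ga + 1); set d := br de; set d1 := br (de + 1).
move=> h0 h0' h1 h2 h3; apply/eqP; rewrite -subr_eq0; apply/eqP.
transitivity (
  o * xP * p * A1 * ((X * c * d1 * y1 - Y * xm1 * d * c1) - o * b * a1 * XY)
  + o ^+ 2 * xP * b * a1 * (A1 * XY * p - (yP * X * A2 + Y * Px * A3))
  + Y * b * a1 * A3 * (o ^+ 2 * xP * Px - (p ^+ 2 * x1 * - xm1 + Pm * Pp * X ^+ 2))
  + xm1 * p ^+ 2 * A3 * (a * b1 * y1 * X - Y * b * a1 * x1 - o * d * c1 * XmY)
  + o * d * c1 * p * xm1 * (xP * Y * A1 + p * XmY * A3 - yP * X * A4)).
  by ring.
by rewrite h0 h0' h1 h2 h3 !subrr !mulr0 !addr0.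
Qed.

(** The factors br x and br (y + 1) are those with which the instances of the
    addition law combine to the difference of the two sides. *)
Lemma symmetric_poly : br x != 0 -> br (y + 1) != 0 ->
  br (al + (Pb - 1)) * br (be + Pb) * br de * br (ga + 1) * br (x - 1)
  + br (ga + (Pb - 1)) * br (de + Pb) * br be * br (al + 1) * br (x + 1)
  = br (de + (Pb - 1)) * br (ga + Pb) * br al * br (be + 1) * br (x - 1)
    + br (be + (Pb - 1)) * br (al + Pb) * br ga * br (de + 1) * br (x + 1).
Proof.
move=> x_neq0 y1_neq0; apply: (mulfI x_neq0); apply: (mulfI y1_neq0).
have e c d : c + d = al + be ->
    br (Pb - 1 + c) * br (Pb + (al + be) - c) = br (c + (Pb - 1)) * br (d + Pb).
  move=> cd; rewrite [_ + c]addrC -cd.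
  by have -> : Pb + (c + d) - c = d + Pb by ring.
have eal := e al be erefl; have ega : _ = _ := e ga de _.
have ebe : _ = _ := e be al (addrC _ _); have ede : _ = _ := e de ga _.
have h0 := addition_sum; have h0' := addition_difference.
have := fay (Pb - 1) (Pb + (al + be)) al be de.
have := fay (Pb - 1) (Pb + (al + be)) ga be de.
rewrite eal ebe ega ?ede; try by rewrite /de; ring.
have -> : be - de = x by rewrite /de /x; ring.
have -> : Pb - 1 - (Pb + (al + be)) + be + de = - (y + 1) by rewrite /y /de; ring.
have -> : Pb - 1 - (Pb + (al + be)) + de + ga = - 1 by rewrite /de; ring.
have -> : Pb - 1 - (Pb + (al + be)) + ga + be = x - 1 by rewrite /x; ring.
have -> : Pb - 1 - (Pb + (al + be)) + de + al = - (x + 1) by rewrite /x /de; ring.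
have -> : Pb - 1 - (Pb + (al + be)) + al + be = - 1 by ring.
have -> : de - ga = - (x + y) by rewrite /x /y /de; ring.
have -> : de - al = - y by rewrite /y /de; ring.
have -> : al - be = - (x - y) by rewrite /x /y; ring.
rewrite !br_odd.
move: h0 h0'; rewrite -/x -/y -/de.
set X := br x; set Y := br y; set XY := br (x + y); set XmY := br (x - y).
set o := br 1; set x1 := br (x + 1); set xm1 := br (x - 1); set y1 := br (y + 1).
set a := br al; set a1 := br (al + 1); set b := br be; set b1 := br (be + 1).
set c := br ga; set c1 := br (ga + 1); set d := br de; set d1 := br (de + 1).
set ea := br (al + (Pb - 1)) * _; set eb := br (be + (Pb - 1)) * _.
set ec := br (ga + (Pb - 1)) * _; set ed := br (de + (Pb - 1)) * _.
move=> h0 h0' h1 h2; apply/eqP; rewrite -subr_eq0; apply/eqP.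
transitivity (
  - d * c1 * xm1 * (ea * (X * - y1) + eb * (- Y * - x1) + ed * (- XmY * - o))
  - b * a1 * x1 * (ec * (X * - y1) + eb * (- XY * - o) + ed * (br (ga - be) * xm1))
  - x1 * eb * (X * c * d1 * y1 - Y * xm1 * d * c1 - o * b * a1 * XY)
  - xm1 * ed * (a * b1 * y1 * X - Y * b * a1 * x1 - o * d * c1 * XmY)).
  by rewrite -/Y; ring.
by rewrite h1 h2 h0 h0' !subrr !mulr0 !subr0.
Qed.

End Four.

Definition factor D z := br (z + D) * br 1 / br D.

(** The part of a layer that joins two adjacent positions, both coloured below
    it: x1, x2 are their variables on the lower level, y1, y2 on the upper one,
    and D1, D2 their dynamical arguments. *)
Definition pair_weight D1 D2 x1 x2 y1 y2 :=
  factor D1 (y1 - x1) * factor D2 (y2 - x2)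
  * (br (y2 - x1) * br (y1 - x2 + 1) * (br (x2 - x1 + 1) / br (x2 - x1))).

Definition Rdiag z D := br 1 * br (D - z) / (br D * br (z + 1)).
Definition Roff z := br z / br (z + 1).
(** The product of the two off-diagonal entries of the exchange block, apart from
    the squared [Roff]. Only this product is independent of the normalization of
    the functions on which the block acts. *)
Definition gauge D := br (D - 1) * br (D + 1) / br D ^+ 2.

Lemma RdiagN z P : Rdiag z (- P) = br 1 * br (z + P) / (br P * br (z + 1)).
Proof.
have -> : Rdiag z (- P) = br 1 * br (- (z + P)) / (br (- P) * br (z + 1)).
  by rewrite /Rdiag; congr (_ * br _ / _); ring.
by rewrite !br_odd mulNr mulrN invrN mulrNN.
Qed.

Lemma gaugeN P : gauge (- P) = gauge P.
Proof.
rewrite /gauge br_odd sqrrN.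
have -> : - P - 1 = - (P + 1) by ring.
have -> : - P + 1 = - (P - 1) by ring.
by rewrite !br_odd mulrNN [br (P + 1) * _]mulrC.
Qed.

(** The inductive step of the exchange relation. When the exchange relation of the
    lower level has been inserted on both sides, this compares the coefficients
    of the function of the unswapped word, and [exchange_off] those of the
    function of the swapped word. *)
Lemma exchange_diag Dp Dq x1 x2 y1 y2 :
  br (Dp - Dq) != 0 -> br (x1 - x2) != 0 -> br (x1 - x2 + 1) != 0 ->
  br (y1 - y2 + 1) != 0 ->
  pair_weight Dp Dq x1 x2 y2 y1
  + Rdiag (x1 - x2) (Dp - Dq) * pair_weight Dp Dq x2 x1 y2 y1
  = Rdiag (y1 - y2) (Dp - Dq)
    * (pair_weight Dp Dq x1 x2 y1 y2
       + Rdiag (x1 - x2) (Dp - Dq) * pair_weight Dp Dq x2 x1 y1 y2)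
    + gauge (Dp - Dq) * Roff (y1 - y2) * Roff (x1 - x2)
      * pair_weight Dq Dp x2 x1 y1 y2.
Proof.
rewrite -(opprB Dq) !RdiagN gaugeN br_odd oppr_eq0 => D0 X0 X10 Y10.
have := @exchange_diag_poly (y1 - x1) (y2 - x2) (y1 - x2) Dq Dp.
have -> : y1 - x1 + (y2 - x2) - (y1 - x2) = y2 - x1 by ring.
have -> : y1 - x2 - (y1 - x1) = x1 - x2 by ring.
have -> : y1 - x2 - (y2 - x2) = y1 - y2 by ring.
move=> /(_ X0).
rewrite /Roff /gauge /pair_weight /factor.
have -> : br (x2 - x1 + 1) = - br (x1 - x2 - 1) by rewrite -br_odd; congr br; ring.
have -> : br (x2 - x1) = - br (x1 - x2) by rewrite -br_odd; congr br; ring.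
(* The inverse brackets of Dp and Dq are common factors of all terms. *)
move: D0 X0 X10 Y10.
move: (br Dp)^-1 (br Dq)^-1 => ip iq.
move: (br (x1 - x2)) (br (y1 - y2)) (br (Dq - Dp)) (br (x1 - x2 + (Dq - Dp)))
  (br (y1 - y2 + (Dq - Dp))) (br 1) (br (_ - _ - 1)) (br (Dq - Dp + 1))
  (br (x1 - x2 + 1)) (br (_ - _ - 1)) (br (y1 - y2 + 1)).
move=> X Y p xP yP o Pm Pp x1' xm1 y1' p0 X0 X10 Y10.
move: (br (y1 - x1)) (br (y1 - x1 + 1)) (br (y2 - x2)) (br (y2 - x2 + 1))
  (br (y1 - x2)) (br (y1 - x2 + 1)) (br (y2 - x1)) (br (y2 - x1 + 1))
  (br (y1 - x1 + Dq)) (br (y2 - x2 + Dp)) (br (y2 - x1 + Dq)) (br (y1 - x2 + Dp))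
  (br (y1 - x2 + Dq)) (br (y2 - x1 + Dp)) (br (y2 - x2 + Dq)) (br (y1 - x1 + Dp)).
move=> a a1 b b1 c c1 d d1 aq bp dq cp cq dp bq ap /eqP; rewrite -subr_eq0 => /eqP h.
apply/eqP; rewrite -subr_eq0; apply/eqP.
rewrite -(mulr0 (ip * iq * o ^+ 2 / (p ^+ 2 * y1' * X))) -[in RHS]h.
field; by rewrite p0 X0 X10 Y10.
Qed.

Lemma exchange_off Dp Dq x1 x2 y1 y2 :
  br (Dp - Dq) != 0 -> br (x1 - x2) != 0 -> br (x1 - x2 + 1) != 0 ->
  br (y1 - y2 + 1) != 0 ->
  Roff (x1 - x2) * pair_weight Dp Dq x2 x1 y2 y1
  = Rdiag (y1 - y2) (Dp - Dq) * Roff (x1 - x2) * pair_weight Dp Dq x2 x1 y1 y2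
    + Roff (y1 - y2)
      * (pair_weight Dq Dp x1 x2 y1 y2
         + Rdiag (x1 - x2) (Dq - Dp) * pair_weight Dq Dp x2 x1 y1 y2).
Proof.
rewrite -(opprB Dq) !RdiagN /Rdiag br_odd oppr_eq0 => D0 X0 X10 Y10.
have := @exchange_off_poly (y1 - x1) (y2 - x2) (y1 - x2) Dq Dp.
have -> : y1 - x1 + (y2 - x2) - (y1 - x2) = y2 - x1 by ring.
have -> : y1 - x2 - (y1 - x1) = x1 - x2 by ring.
have -> : y1 - x2 - (y2 - x2) = y1 - y2 by ring.
rewrite /Roff /pair_weight /factor.
have -> : br (x2 - x1 + 1) = - br (x1 - x2 - 1) by rewrite -br_odd; congr br; ring.
have -> : br (x2 - x1) = - br (x1 - x2) by rewrite -br_odd; congr br; ring.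
move: D0 X0 X10 Y10.
move: (br Dp)^-1 (br Dq)^-1 => ip iq.
move: (br (x1 - x2)) (br (y1 - y2)) (br (Dq - Dp)) (br (Dq - Dp - _))
  (br (y1 - y2 + (Dq - Dp))) (br 1)
  (br (x1 - x2 + 1)) (br (_ - _ - 1)) (br (y1 - y2 + 1)).
move=> X Y p Px yP o x1' xm1 y1' p0 X0 X10 Y10.
move: (br (y1 - x1)) (br (y1 - x1 + 1)) (br (y2 - x2)) (br (y2 - x2 + 1))
  (br (y1 - x2)) (br (y1 - x2 + 1)) (br (y2 - x1)) (br (y2 - x1 + 1))
  (br (y1 - x1 + Dq)) (br (y2 - x2 + Dp)) (br (y2 - x1 + Dq)) (br (y1 - x2 + Dp))
  (br (y1 - x2 + Dq)) (br (y2 - x1 + Dp)).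
move=> a a1 b b1 c c1 d d1 aq bp dq cp cq dp /eqP; rewrite -subr_eq0 => /eqP h.
apply/eqP; rewrite -subr_eq0; apply/eqP.
rewrite -(mulr0 (ip * iq * o ^+ 2 / (p * y1' * X))) -[in RHS]h.
field; by rewrite p0 X0 X10 Y10.
Qed.

(** For two adjacent positions of equal colour, the symmetrization over the
    lower variables makes the layer symmetric in the upper ones. The dynamical
    arguments differ by 1 since the right position is counted in the shift of
    the left one. *)
Lemma symmetric_pair_weight D x1 x2 y1 y2 :
  br (x1 - x2) != 0 -> br (y1 - y2 + 1) != 0 ->
  pair_weight (D - 1) D x1 x2 y2 y1 + pair_weight (D - 1) D x2 x1 y2 y1
  = pair_weight (D - 1) D x1 x2 y1 y2 + pair_weight (D - 1) D x2 x1 y1 y2.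
Proof.
move=> X0 Y10.
have := @symmetric_poly (y1 - x1) (y2 - x2) (y1 - x2) D.
have -> : y1 - x1 + (y2 - x2) - (y1 - x2) = y2 - x1 by ring.
have -> : y1 - x2 - (y1 - x1) = x1 - x2 by ring.
have -> : y1 - x2 - (y2 - x2) = y1 - y2 by ring.
move=> /(_ X0 Y10).
rewrite /pair_weight /factor.
have -> : br (x2 - x1 + 1) = - br (x1 - x2 - 1) by rewrite -br_odd; congr br; ring.
have -> : br (x2 - x1) = - br (x1 - x2) by rewrite -br_odd; congr br; ring.
move: X0; move: (br D)^-1 (br (D - 1))^-1 => ip iq.
move: (br (x1 - x2)) (br 1) (br (x1 - x2 + 1)) (br (_ - _ - 1)).
move=> X o x1' xm1 X0.
move: (br (y1 - x1)) (br (y1 - x1 + 1)) (br (y2 - x2)) (br (y2 - x2 + 1))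
  (br (y1 - x2)) (br (y1 - x2 + 1)) (br (y2 - x1)) (br (y2 - x1 + 1)).
move=> a a1 b b1 c c1 d d1 /eqP; rewrite -subr_eq0 => /eqP h.
apply/eqP; rewrite -subr_eq0; apply/eqP.
rewrite -(mulr0 (- ip * iq * o ^+ 2 / X)) -[in RHS]h.
by field.
Qed.

(** The exchange relation at the layer of the larger of the two colours, where
    only the position of smaller colour has a variable x on the lower level:
    the left position here, the right one in [base_high]. *)
Lemma base_low P x y1 y2 :
  br P != 0 -> br (P + 1) != 0 -> br (y1 - y2 + 1) != 0 ->
  factor (P + 1) (y2 - x) * br (y1 - x)
  = Rdiag (y1 - y2) P * (factor (P + 1) (y1 - x) * br (y2 - x))
    + Roff (y1 - y2) * (factor P (y2 - x) * br (y1 - x + 1)).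
Proof.
move=> P0 P10 Y10.
have := fay (P + 1) (y1 - x + (y2 - x)) (y2 - x) (y1 - x) (y2 - x - 1).
rewrite /Rdiag /Roff /factor.
have -> : y1 - x + (y2 - x) - (y2 - x) = y1 - x by ring.
have -> : y1 - x + (y2 - x) - (y1 - x) = y2 - x by ring.
have -> : y1 - x + (y2 - x) - (y2 - x - 1) = y1 - x + 1 by ring.
have -> : P + 1 + (y2 - x - 1) = y2 - x + P by ring.
have -> : y1 - x - (y2 - x - 1) = y1 - y2 + 1 by ring.
have -> : P + 1 - (y1 - x + (y2 - x)) + (y1 - x) + (y2 - x - 1) = P by ring.
have -> : P + 1 - (y1 - x + (y2 - x)) + (y2 - x - 1) + (y2 - x) = P - (y1 - y2) by ring.
have -> : P + 1 - (y1 - x + (y2 - x)) + (y2 - x) + (y1 - x) = P + 1 by ring.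
have -> : y2 - x - 1 - (y2 - x) = - 1 by ring.
have -> : y2 - x - (y1 - x) = - (y1 - y2) by ring.
rewrite !br_odd ![P + 1 + _]addrC => h.
apply/eqP; rewrite -subr_eq0; apply/eqP.
rewrite -(mulr0 (br 1 / (br P * br (P + 1) * br (y1 - y2 + 1)))) -[in RHS]h.
by field; rewrite P0 P10 Y10.
Qed.

Lemma base_high P x y1 y2 :
  br P != 0 -> br (P + 1) != 0 -> br (y1 - y2 + 1) != 0 ->
  factor P (y1 - x) * br (y2 - x + 1)
  = Rdiag (y1 - y2) (- P) * (factor P (y2 - x) * br (y1 - x + 1))
    + gauge P * Roff (y1 - y2) * (factor (P + 1) (y1 - x) * br (y2 - x)).
Proof.
move=> P0 P10 Y10; rewrite RdiagN.
have := fay P (y1 - x + (y2 - x) + 1) (y1 - x) (y2 - x) (y1 - x + 1).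
rewrite /Roff /factor /gauge.
have -> : y1 - x + (y2 - x) + 1 - (y1 - x) = y2 - x + 1 by ring.
have -> : y1 - x + (y2 - x) + 1 - (y2 - x) = y1 - x + 1 by ring.
have -> : y1 - x + (y2 - x) + 1 - (y1 - x + 1) = y2 - x by ring.
have -> : y2 - x - (y1 - x + 1) = - (y1 - y2 + 1) by ring.
have -> : P - (y1 - x + (y2 - x) + 1) + (y2 - x) + (y1 - x + 1) = P by ring.
have -> : y1 - x + 1 - (y1 - x) = 1 by ring.
have -> : P - (y1 - x + (y2 - x) + 1) + (y1 - x + 1) + (y1 - x) = y1 - y2 + P by ring.
have -> : y1 - x - (y2 - x) = y1 - y2 by ring.
have -> : P - (y1 - x + (y2 - x) + 1) + (y1 - x) + (y2 - x) = P - 1 by ring.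
have -> : P + (y1 - x + 1) = y1 - x + (P + 1) by ring.
rewrite !br_odd ![P + _]addrC => h.
apply/eqP; rewrite -subr_eq0; apply/eqP.
rewrite -(mulr0 (- br 1 / (br P ^+ 2 * br (y1 - y2 + 1)))) -[in RHS]h.
by rewrite ![1 + P]addrC; field; rewrite ?P0 ?P10 ?Y10 // addrC P10.
Qed.

(** Exchange blocks at opposite z and transposed off-diagonal factors preserve
    the bilinear form X * Y + X' * Y'. Only the product of g and g' enters. *)
Lemma unitarity z D g g' X X' Y Y' :
  br D != 0 -> br (z + 1) != 0 -> br (- z + 1) != 0 -> g * g' = gauge D ->
  (Rdiag z D * X + g * Roff z * X') * (Rdiag (- z) D * Y + g' * Roff (- z) * Y')
  + (Rdiag z (- D) * X' + g' * Roff z * X)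
    * (Rdiag (- z) (- D) * Y' + g * Roff (- z) * Y)
  = X * Y + X' * Y'.
Proof.
move=> D0 z0 mz0; rewrite !RdiagN /Rdiag /Roff /gauge opprK !br_odd => gg.
have := addition_square D z; rewrite ![1 - z]addrC ![- z + D]addrC ![z + D]addrC => h.
have {}h : br D ^+ 2 = (br 1 ^+ 2 * br (D + z) * br (D - z)
   - br (D - 1) * br (D + 1) * br z ^+ 2) / (br (z + 1) * br (- z + 1)).
  by rewrite h; field; rewrite z0 mz0.
have gD : br (D - 1) * br (D + 1) = g * g' * br D ^+ 2 by rewrite gg; field.
rewrite gD in h.
have h0 := subrr (br D ^+ 2); rewrite [X in _ - X]h in h0.
apply/eqP; rewrite -subr_eq0; apply/eqP.
rewrite -(mulr0 (- (X * Y + X' * Y') / br D ^+ 2)) -[in RHS]h0.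
by field; rewrite D0 z0 mz0.
Qed.

End ThetaIdentities.

(** * Weight functions layer by layer and their exchange relation *)

Section WeightRecursion.

Variables (F : numFieldType) (br : F -> F) (n : nat).
Variables (m : nat -> nat) (t : nat -> nat -> F) (pot : nat -> F).

Implicit Types (c : 'I_n -> nat) (x y : 'I_n -> F).

Definition level c k : {set 'I_n} := [set a | (c a < k)%N].
Definition rank c k a := index a (enum (level c k)).

(** The argument (P+h)_(c,l) - C_(c,l)(a) of the weight functions is the
    difference of two values of [shifted] at a, for P+h the difference of two
    values of the potential. *)
Definition shifted c (a : 'I_n) l :=
  pot l - #|[set b : 'I_n | (a < b)%N & c b == l]|%:R.

Definition link k c x y a :=
  if (c a < k)%N then factor br (shifted c a (c a) - shifted c a k) (y a - x a)
  else 1.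

Definition bond k c x y a b :=
  (if (c a < k)%N && (c b <= k)%N then br (y b - x a) else 1)
  * (if (c b < k)%N && (c a <= k)%N then br (y a - x b + 1) else 1)
  * (if (c a < k)%N && (c b < k)%N then br (x b - x a + 1) / br (x b - x a) else 1).

(** The factors of U_I that join the levels k and k + 1, regrouped by positions
    and pairs of positions. All variables are indexed by positions; those of
    level k are only used at the positions of colour less than k. *)
Definition layer k c x y :=
  \prod_a link k c x y a * \prod_(a : 'I_n) \prod_(b : 'I_n | (a < b)%N) bond k c x y a b.

Definition arrange c k (s : 'S_(m k)) (a : 'I_n) : F := t k (act_perm s (rank c k a)).

(** The weight function made of the k lowest layers, as a function of the
    variables y of level k. Since the layers above do not appear, the
    symmetrizations can be peeled off one level at a time. *)
Fixpoint partial_weight k c y :=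
  if k is l.+1 then
    \sum_(s : 'S_(m l)) layer l c (arrange c s) y * partial_weight l c (arrange c s)
  else 1.

Section Adjacent.
Variables (i j : 'I_n).
Hypothesis ij : j = i.+1 :> nat.
Let s := tperm i j.

Let ineqj : i != j.
Proof. by rewrite -val_eqE /= ij neq_ltn ltnSn. Qed.
Let out a := (a != i) && (a != j).

Lemma out_tperm a : out a -> s a = a.
Proof. by case/andP=> ai aj; rewrite tpermD // eq_sym. Qed.

Lemma lt_out a : out a -> (a < j)%N = (a < i)%N.
Proof. by case/andP=> /negPf ai _; rewrite ij ltnS leq_eqVlt val_eqE ai. Qed.

Lemma gt_out a : out a -> (i < a)%N = (j < a)%N.
Proof.
by case/andP=> _ /negPf aj; rewrite leq_eqVlt -ij val_eqE eq_sym aj.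
Qed.

Lemma prod_out (f : 'I_n -> F) : \prod_a f a = f i * f j * \prod_(a | out a) f a.
Proof. by rewrite (bigD1 i) //= (bigD1 j) /= 1?eq_sym // mulrA. Qed.

Lemma prod_pairs_out (g : 'I_n -> 'I_n -> F) :
  \prod_(a : 'I_n) \prod_(b : 'I_n | (a < b)%N) g a b =
  g i j * ((\prod_(a | out a) if (a < i)%N then g a i * g a j else g i a * g j a)
    * \prod_(a | out a) \prod_(b : 'I_n | out b && (a < b)%N) g a b).
Proof.
have split (a : 'I_n) : \prod_(b : 'I_n | (a < b)%N) g a b =
    (if (a < i)%N then g a i else 1) * (if (a < j)%N then g a j else 1)
    * \prod_(b : 'I_n | out b && (a < b)%N) g a b.
  by rewrite big_mkcond prod_out /= -big_mkcondr.
rewrite prod_out (eq_bigr _ (fun a _ => split a)) !split big_split /=.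
rewrite ltnn ij ltnSn mul1r ltnn ltnNge leqnSn /= !mul1r -ij.
rewrite -!mulrA; congr (_ * _); rewrite !mulrA; congr (_ * _).
rewrite [X in X * _ * _](eq_bigl (fun b => out b && ~~ (b < i)%N)); last first.
  move=> b; have [ob|//] := boolP (out b).
  by case/andP: ob => bi _; rewrite /= ij -leqNgt [(i <= b)%N]leq_eqVlt val_eqE [i == b]eq_sym (negPf bi).
rewrite [X in _ * X * _](eq_bigl (fun b => out b && ~~ (b < i)%N)); last first.
  move=> b; have [ob|//] := boolP (out b).
  rewrite /= -gt_out // -leqNgt [(i <= b)%N]leq_eqVlt val_eqE.
  by case/andP: ob => bi _; rewrite [i == b]eq_sym (negPf bi).
rewrite [X in X * _ * _]big_mkcondr [X in _ * X * _]big_mkcondr -!big_split /=.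
by apply: eq_bigr => a oa; rewrite (lt_out oa); case: (a < i)%N; rewrite /= ?mul1r ?mulr1.
Qed.

Definition rest k c x y :=
  (\prod_(a | out a) link k c x y a)
  * ((\prod_(a | out a)
        if (a < i)%N then bond k c x y a i * bond k c x y a j
        else bond k c x y i a * bond k c x y j a)
     * \prod_(a | out a) \prod_(b : 'I_n | out b && (a < b)%N) bond k c x y a b).

Definition core k c x y := link k c x y i * link k c x y j * bond k c x y i j.

Lemma layer_split k c x y : layer k c x y = core k c x y * rest k c x y.
Proof. by rewrite /layer prod_out prod_pairs_out /core /rest; ring. Qed.

Definition slot k c x (phi : F -> F) :=
  (if (c i < k)%N then phi (x i) else 1) * (if (c j < k)%N then phi (x j) else 1).

(** Every other position lies on the same side of i as of i + 1, so outside
    of [core] the variables of these two positions only enter through the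
    symmetric products [slot]. *)
Lemma rest_slots k c1 c2 x1 x2 y1 y2 :
  (forall a, out a -> c1 a = c2 a) -> (forall a, out a -> x1 a = x2 a) ->
  (forall a, out a -> y1 a = y2 a) ->
  (forall a l, out a -> shifted c1 a l = shifted c2 a l) ->
  slot k c1 x1 =1 slot k c2 x2 -> slot k.+1 c1 y1 =1 slot k.+1 c2 y2 ->
  rest k c1 x1 y1 = rest k c2 x2 y2.
Proof.
move=> ec ex ey esh slx sly.
have below c x y a : bond k c x y a i * bond k c x y a j =
    slot k.+1 c y (fun z => if (c a < k)%N then br (z - x a) else 1)
    * slot k c x (fun z => (if (c a <= k)%N then br (y a - z + 1) else 1)
        * if (c a < k)%N then br (z - x a + 1) / br (z - x a) else 1).
  rewrite /bond /slot !ltnS.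
  by case: (c a < k)%N; case: (c i < k)%N; case: (c j < k)%N;
    case: (c a <= k)%N; case: (c i <= k)%N; case: (c j <= k)%N => /=; ring.
have above c x y a : bond k c x y i a * bond k c x y j a =
    slot k.+1 c y (fun z => if (c a < k)%N then br (z - x a + 1) else 1)
    * slot k c x (fun z => (if (c a <= k)%N then br (y a - z) else 1)
        * if (c a < k)%N then br (x a - z + 1) / br (x a - z) else 1).
  rewrite /bond /slot !ltnS.
  by case: (c a < k)%N; case: (c i < k)%N; case: (c j < k)%N;
    case: (c a <= k)%N; case: (c i <= k)%N; case: (c j <= k)%N => /=; ring.
rewrite /rest; congr (_ * (_ * _)).
- by apply: eq_bigr => a oa; rewrite /link ec // ex // ey // !esh.
- apply: eq_bigr => a oa; rewrite !below !above.
  by case: ifP => _; rewrite slx sly ec // ex // ey.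
- apply: eq_bigr => a oa; apply: eq_bigr => b /andP[ob _].
  by rewrite /bond !ec // !ex // !ey.
Qed.

Lemma shifted_tperm c a l : out a -> shifted (c \o s) a l = shifted c a l.
Proof.
move=> oa; rewrite /shifted; congr (_ - _%:R).
rewrite -(card_preimset _ (@perm_inj _ s)); apply: eq_card => b.
rewrite !inE /= tpermK; congr (_ && _); rewrite /s.
by case: tpermP => [->|->|//]; rewrite lt_out.
Qed.

Lemma shifted_left c l :
  shifted c i l = shifted c j l - (c j == l)%:R.
Proof.
rewrite /shifted -addrA -opprD -natrD; congr (_ - _%:R).
rewrite (cardD1 j) inE ij ltnSn /= addnC; congr (_ + _)%N.
apply: eq_card => b; rewrite !inE -val_eqE /= ij [in RHS]ltn_neqAle eq_sym.
by rewrite andbA.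
Qed.

Lemma shifted_tperm_right c l : shifted (c \o s) j l = shifted c j l.
Proof.
rewrite /shifted; congr (_ - _%:R); apply: eq_card => b; rewrite !inE /=.
have [jb|//] := ltnP j b; rewrite tpermD // -val_eqE /= ?ij neq_ltn ?ij.
  by rewrite (leq_trans _ jb) // ij ltnW.
by rewrite -ij jb.
Qed.

Lemma level_tperm c k : (c i < k)%N = (c j < k)%N -> level (c \o s) k = level c k.
Proof.
move=> e; apply/setP => a; rewrite !inE /= /s.
by case: tpermP => [->|->|//].
Qed.

Lemma card_level_tperm c k : #|level (c \o s) k| = #|level c k|.
Proof.
rewrite -(card_preimset _ (@perm_inj _ s)); apply: eq_card => a.
by rewrite !inE /= tpermK.
Qed.

Lemma enum_sorted (A : {set 'I_n}) : sorted (fun a b : 'I_n => (a < b)%N) (enum A).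
Proof.
rewrite {1}/enum_mem -enumT; apply: sorted_filter => [a b d|]; first exact: ltn_trans.
have -> : sorted (fun a b : 'I_n => (a < b)%N) (enum 'I_n) = sorted ltn (map val (enum 'I_n)).
  by rewrite sorted_map.
by rewrite val_enum_ord iota_ltn_sorted.
Qed.

(** The swap is increasing on a set that does not contain both i and i + 1. *)
Lemma rank_tperm c k a : ~~ ((c i < k)%N && (c j < k)%N) ->
  rank (c \o s) k a = rank c k (s a).
Proof.
move=> nb; rewrite /rank -[RHS](index_map (@perm_inj _ s)) tpermK; congr (index _ _).
apply: (irr_sorted_eq (leT := fun a b : 'I_n => (a < b)%N)).
- by move=> ? ? ?; exact: ltn_trans.
- by move=> ?; rewrite ltnn.
- exact: enum_sorted.
- rewrite sorted_map; have := enum_sorted (level c k).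
  apply: (@sub_in_sorted _ (mem (level c k))) => [b d /=|]; last first.
    by apply/allP => b; rewrite mem_enum.
  rewrite !inE => bk dk.
  rewrite /= /s; case: tpermP => [eb|eb|/eqP bi /eqP bj];
    case: tpermP => [ed|ed|/eqP di /eqP dj] bd.
  + by rewrite eb ed ltnn in bd.
  + by move: nb; rewrite -eb -ed bk dk.
  + by rewrite -gt_out -?eb // /out di dj.
  + by rewrite eb ed ij ltnNge leqnSn in bd.
  + by rewrite eb ed ltnn in bd.
  + by rewrite gt_out -?eb // /out di dj.
  + by rewrite lt_out -?ed // /out bi bj.
  + by rewrite -lt_out -?ed // /out bi bj.
  + by [].
- move=> b; rewrite mem_enum inE /=; apply/idP/mapP.
    by move=> h; exists (s b); rewrite ?tpermK // mem_enum inE.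
  by case=> d; rewrite mem_enum inE => dk ->; rewrite tpermK.
Qed.

Lemma arrange_tperm c k (r : 'S_(m k)) : ~~ ((c i < k)%N && (c j < k)%N) ->
  arrange (c \o s) r = arrange c r \o s.
Proof. by move=> nb; apply/funext => a; rewrite /arrange /= rank_tperm. Qed.

Lemma slot_tperm k c x : slot k (c \o s) (x \o s) =1 slot k c x.
Proof. by move=> phi; rewrite /slot /= /s tpermL tpermR mulrC. Qed.

Lemma slot_tperm_l k c x : (c i < k)%N = (c j < k)%N ->
  slot k (c \o s) x =1 slot k c x.
Proof. by move=> e phi; rewrite /slot /= /s tpermL tpermR e. Qed.

Lemma slot_tperm_r k c x : (c i < k)%N = (c j < k)%N ->
  slot k c (x \o s) =1 slot k c x.
Proof. by move=> e phi; rewrite /slot /= /s tpermL tpermR e mulrC. Qed.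

Lemma rest_tperm k c x y : rest k (c \o s) (x \o s) (y \o s) = rest k c x y.
Proof.
apply: rest_slots => [a oa|a oa|a oa|a l oa||]; rewrite /= ?out_tperm //.
- exact: shifted_tperm.
- exact: slot_tperm.
- exact: slot_tperm.
Qed.

Lemma rest_tperm_top k c x y : (c i < k.+1)%N = (c j < k.+1)%N ->
  rest k c x (y \o s) = rest k c x y.
Proof.
move=> e; apply: rest_slots => [a oa|a oa|a oa|a l oa||] //=.
  by rewrite out_tperm.
exact: slot_tperm_r.
Qed.

Lemma rest_tperm_bottom k c x y : (c i < k)%N = (c j < k)%N ->
  rest k c (x \o s) y = rest k c x y.
Proof.
move=> e; apply: rest_slots => [a oa|a oa|a oa|a l oa||] //=.
  by rewrite out_tperm.
exact: slot_tperm_r.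
Qed.

(** When at most one of the two positions is coloured below k, no bond joins
    them, so swapping colours and variables together changes nothing. *)
Lemma partial_weight_tperm k c y : ~~ ((c i < k)%N && (c j < k)%N) ->
  partial_weight k (c \o s) (y \o s) = partial_weight k c y.
Proof.
elim: k c y => [//|k IH] c y nb /=.
have nbk : ~~ ((c i < k)%N && (c j < k)%N).
  by apply: contra nb => /andP[ci cj]; rewrite !ltnS (ltnW ci) (ltnW cj).
apply: eq_bigr => r _; rewrite (arrange_tperm r nbk).
move: (arrange c r) => x; rewrite (IH c x nbk); congr (_ * _).
rewrite !layer_split rest_tperm; congr (_ * _).
have gk a l : (c a < l)%N = ~~ (l <= c a)%N by rewrite ltnNge.
rewrite /core /link /bond /= /s tpermL tpermR !shifted_left /= !shifted_tperm_right
  /= tpermR.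
rewrite -/s.
move: nb; rewrite !ltnS.
have [cik|kci] := ltnP (c i) k; have [cjk|kcj] := ltnP (c j) k;
  rewrite ?(ltnW cik) ?(ltnW cjk) //= => nb; rewrite ?andbF ?andbT /=.
- have kcj' : (k < c j)%N by rewrite ltnNge.
  have -> : (c j == c i) = false by apply/eqP => e; rewrite e ltnNge ltnW in kcj'.
  have -> : (c j == k) = false by rewrite gtn_eqF.
  by rewrite (negPf nb) /= !subr0 !mulr1 mul1r.
- have kci' : (k < c i)%N by rewrite ltnNge; rewrite andbT in nb.
  rewrite (leqNgt _ k) kci' /=.
  have -> : (c i == c j) = false by apply/eqP => e; rewrite e ltnNge ltnW in kci'.
  have -> : (c i == k) = false by rewrite gtn_eqF.
  by rewrite !subr0 !mulr1 mul1r.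
Qed.

Section BothPresent.
Hypothesis br_odd : {morph br : z / - z}.
Hypothesis fay : three_term br.
Hypothesis t_generic : forall l a b, (a < m l)%N -> (b < m l)%N -> a != b ->
  br (t l a - t l b) != 0 /\ br (t l a - t l b + 1) != 0.

Lemma rank_lt c k a : m k = #|level c k| -> (c a < k)%N -> (rank c k a < m k)%N.
Proof. by move=> -> ak; rewrite /rank cardE index_mem mem_enum inE. Qed.

Lemma rank_inj c k a b : (c a < k)%N -> rank c k a = rank c k b -> a = b.
Proof.
move=> ak e; have ain : a \in enum (level c k) by rewrite mem_enum inE.
have bin : b \in enum (level c k) by rewrite -index_mem -[index _ _]e index_mem.
by rewrite -(nth_index a ain) -(nth_index a bin) -/(rank c k a) e.
Qed.

(** Exchanging the variables of two positions that both occur on a level is a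
    translation of the symmetrization sum. *)
Lemma arrange_swap c k : m k = #|level c k| -> (c i < k)%N -> (c j < k)%N ->
  exists tau : 'S_(m k), forall r, arrange c (tau * r)%g = arrange c r \o s.
Proof.
move=> mk ik jk.
exists (tperm (Ordinal (rank_lt mk ik)) (Ordinal (rank_lt mk jk))) => r.
apply/funext => a; rewrite /arrange /=; congr t.
rewrite /act_perm; case: insubP => [u ua eu|na].
  have ra : (rank c k (s a) < m k)%N.
    rewrite /s; case: tpermP => [_|_|_ _] //; exact: rank_lt.
  rewrite (insubT (fun e => (e < m k)%N) ra) permM /=; congr (val (r _)).
  apply: val_inj => /=; move: eu; rewrite /s.
  case: (tpermP i j a) => [-> eu|-> eu|/eqP ai /eqP aj eu].
  - by rewrite (_ : u = Ordinal (rank_lt mk ik)) ?tpermL //; apply: val_inj.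
  - by rewrite (_ : u = Ordinal (rank_lt mk jk)) ?tpermR //; apply: val_inj.
  rewrite tpermD // -val_eqE /=; apply/eqP => e.
  - by move: ai; rewrite (rank_inj ik (etrans e eu)) eqxx.
  - by move: aj; rewrite (rank_inj jk (etrans e eu)) eqxx.
have -> : s a = a.
  rewrite /s; case: tpermP => // e; rewrite e rank_lt // in na.
by rewrite insubF //; apply: negPf.
Qed.

Lemma arrange_generic c k (r : 'S_(m k)) :
  m k = #|level c k| -> (c i < k)%N -> (c j < k)%N ->
  br (arrange c r i - arrange c r j) != 0
  /\ br (arrange c r i - arrange c r j + 1) != 0.
Proof.
move=> mk ik jk; rewrite /arrange /act_perm.
rewrite (insubT (fun e => (e < m k)%N) (rank_lt mk ik)).
rewrite (insubT (fun e => (e < m k)%N) (rank_lt mk jk)) /=.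
apply: t_generic; rewrite ?ltn_ord // val_eqE (inj_eq perm_inj) -val_eqE /=.
by apply/eqP => /(rank_inj ik) e; move: ineqj; rewrite e eqxx.
Qed.

(** The two sides of the exchange relation agree only after adding up the two
    arrangements exchanged by [tau], which is enough since 2 is invertible. *)
Lemma eq_sum_pairs k (f g : 'S_(m k) -> F) (tau : 'S_(m k)) :
  (forall r, f r + f (tau * r)%g = g r + g (tau * r)%g) -> \sum_r f r = \sum_r g r.
Proof.
move=> fg; apply: (mulIf (x := 2%:R)); first by rewrite pnatr_eq0.
have dbl (h : 'S_(m k) -> F) : (\sum_r h r) * 2%:R = \sum_r (h r + h (tau * r)%g).
  rewrite big_split /= mulr_natr mulr2n; congr (_ + _).
  by rewrite (reindex_inj (mulgI tau)).
by rewrite !dbl; apply: eq_bigr => r _.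
Qed.

(** Weight functions put the whole factor [gauge] on the off-diagonal entry
    with p > q. *)
Definition word_gauge (p q : nat) D := if (p < q)%N then 1 else gauge br D.

Lemma word_gauge_mul p q D : p != q ->
  word_gauge p q D * word_gauge q p (- D) = gauge br D.
Proof.
by rewrite /word_gauge gaugeN //; case: ltngtP => // _ _; rewrite ?mulr1 ?mul1r.
Qed.

(** The dynamical argument of the exchange block at the positions i and i + 1. *)
Definition colour_gap c := shifted c j (c i) - shifted c j (c j).

Definition gap_generic c :=
  [/\ br (colour_gap c) != 0, ((c i < c j)%N -> br (colour_gap c + 1) != 0)
    & ((c j < c i)%N -> br (colour_gap c - 1) != 0)].

Definition exchanged c (z p p' : F) :=
  if c i == c j then p else
  Rdiag br z (colour_gap c) * p + word_gauge (c i) (c j) (colour_gap c) * Roff br z * p'.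

Lemma colour_gap_tperm c : colour_gap (c \o s) = - colour_gap c.
Proof.
rewrite /colour_gap !shifted_tperm_right /= /s tpermL tpermR.
exact: esym (opprB _ _).
Qed.

Lemma core_both k c x y : (c i < k)%N -> (c j < k)%N ->
  core k c x y =
  pair_weight br (shifted c j (c i) - (c j == c i)%:R - shifted c j k)
    (shifted c j (c j) - shifted c j k) (x i) (x j) (y i) (y j).
Proof.
move=> ik jk; rewrite /core /link /bond ik jk !(ltnW ik, ltnW jk) /=.
rewrite !shifted_left (ltn_eqF jk) subr0 /pair_weight; ring.
Qed.

(** By induction on k. If both positions have a variable below the top layer, the
    relation of the lower level is inserted, and arrangements that differ by
    exchanging these two variables are taken together. If the larger colour is
    the one that the top layer adds, the levels below see at most one of the two
    positions, and the relation holds term by term, as an identity in the top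
    layer. If both positions have this colour, the top layer is already symmetric
    in their variables. *)
Theorem partial_weight_exchange k c y :
  (forall l, (l < k)%N -> m l = #|level c l|) ->
  (c i < k)%N -> (c j < k)%N -> br (y i - y j + 1) != 0 ->
  (c i != c j -> gap_generic c) ->
  partial_weight k c (y \o s) = exchanged c (y i - y j) (partial_weight k c y) (partial_weight k (c \o s) y).
Proof.
elim: k c y => [//|k IH] c y mc; rewrite !ltnS => ik jk y1 gen.
have mk : m k = #|level c k| by exact: mc.
have {}mc l : (l < k)%N -> m l = #|level c l| by move=> lk; apply: mc; exact: ltnW.
have etop : (c i < k.+1)%N = (c j < k.+1)%N by rewrite !ltnS ik jk.
have [both|nboth] := boolP ((c i < k)%N && (c j < k)%N).
  have [ik' jk'] := andP both.
  have eik : (c i < k)%N = (c j < k)%N by rewrite ik' jk'.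
  have [tau tauE] := arrange_swap mk ik' jk'.
  have x_gen r := arrange_generic r mk ik' jk'.
  rewrite /exchanged /=; have [eqc|neqc] := eqVneq (c i) (c j).
    apply: (eq_sum_pairs (tau := tau)) => r.
    have [x0 x1] := x_gen r; rewrite tauE; move: (arrange c r) x0 x1 => x x0 x1.
    rewrite (IH c x mc ik' jk' x1 gen) /exchanged eqc eqxx -!mulrDl; congr (_ * _).
    rewrite !layer_split !rest_tperm_bottom // !rest_tperm_top // -!mulrDl.
    congr (_ * _); rewrite !core_both // /= /s !tpermL !tpermR eqc eqxx.
    by rewrite addrAC; exact: symmetric_pair_weight.
  have gc := gen neqc.
  have arrE (r : 'S_(m k)) : arrange (c \o s) r = arrange c r.
    by apply/funext => a; rewrite /arrange /rank (level_tperm eik).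
  rewrite /= !mulr_sumr -big_split /=.
  apply: (eq_sum_pairs (tau := tau)) => r; rewrite !arrE.
  have [x0 x1] := x_gen r; rewrite tauE; move: (arrange c r) x0 x1 => x x0 x1.
  have [D0 _ _] := gc.
  have mcs l : (l < k)%N -> m l = #|level (c \o s) l|.
    by move=> lk; rewrite mc // card_level_tperm.
  have neqs : (c \o s) i != (c \o s) j by rewrite /= /s tpermL tpermR eq_sym.
  have gcs : gap_generic (c \o s).
    case: gc => g0 gp gm; split; rewrite colour_gap_tperm /= ?tpermL ?tpermR.
    - by rewrite br_odd oppr_eq0.
    - by move=> /gm; rewrite -opprB br_odd oppr_eq0 addrC.
    - by move=> /gp; rewrite -opprD br_odd oppr_eq0.
  rewrite (IH c x mc ik' jk' x1 gen) (IH (c \o s) x mcs) //; last first.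
  - by rewrite /= /s tpermR.
  - by rewrite /= /s tpermL.
  have css : (c \o s) \o s = c by apply/funext => a; rewrite /= tpermK.
  rewrite /exchanged (negPf neqc) (negPf neqs) colour_gap_tperm css.
  rewrite !layer_split !rest_tperm_bottom ?rest_tperm_top //; last first.
    by rewrite /= /s tpermL tpermR.
  have restc : rest k (c \o s) x y = rest k c x y.
    apply: rest_slots => [a oa|a oa|a oa|a l oa||] //=.
    - by rewrite /= out_tperm.
    - exact: shifted_tperm.
    - exact: slot_tperm_l.
    - exact: slot_tperm_l.
  rewrite restc !core_both //=; try by rewrite /s ?tpermL ?tpermR.
  rewrite !shifted_tperm_right /s !tpermL !tpermR (eq_sym (c j)) (negPf neqc) !subr0.
  rewrite /colour_gap in D0 *.
  have gg := word_gauge_mul (shifted c j (c i) - shifted c j (c j)) neqc.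
  move: D0 gg; move: (shifted c j (c i)) (shifted c j (c j)) (shifted c j k) => d1 d2 d3.
  have -> : - (d1 - d2) = (d2 - d3) - (d1 - d3) by ring.
  have -> : d1 - d2 = (d1 - d3) - (d2 - d3) by ring.
  move: (d1 - d3) (d2 - d3) => Dp Dq D0 gg.
  have := exchange_off br_odd fay D0 x0 x1 y1.
  have := exchange_diag br_odd fay D0 x0 x1 y1; rewrite -gg.
  move: (word_gauge (c i) _ _) (word_gauge (c j) _ _) (Rdiag br (x i - x j) (Dp - Dq))
    (Rdiag br (x i - x j) (Dq - Dp)) (Rdiag br (y i - y j) _)
    (Roff br (x i - x j)) (Roff br (y i - y j))
    (partial_weight k c x) (partial_weight k (c \o tperm i j) x) (rest k c x y) => g g' dx dx' dy ox oy p p' R.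
  move: (pair_weight br Dp Dq (x i) (x j) (y j) (y i))
    (pair_weight br Dp Dq (x j) (x i) (y j) (y i))
    (pair_weight br Dp Dq (x i) (x j) (y i) (y j))
    (pair_weight br Dp Dq (x j) (x i) (y i) (y j))
    (pair_weight br Dq Dp (x i) (x j) (y i) (y j))
    (pair_weight br Dq Dp (x j) (x i) (y i) (y j)).
  move=> w1 w2 w3 w4 w5 w6 /eqP; rewrite -subr_eq0 => /eqP hd /eqP.
  rewrite -subr_eq0 => /eqP ho.
  apply/eqP; rewrite -subr_eq0; apply/eqP.
  (* The difference of the two sides is R * p times the first identity plus
     R * g * p' times the second one. *)
  rewrite -[RHS](addr0 0) -[X in _ = X + _](mulr0 (R * p)) -{1}hd.
  rewrite -[X in _ = _ + X](mulr0 (R * g * p')) -{1}ho.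
  ring.
rewrite /exchanged /=.
have [eqc|neqc] := eqVneq (c i) (c j).
  have ei : c i = k.
    apply/eqP; rewrite eqn_leq ik leqNgt; apply: contra nboth => cik.
    by rewrite cik -eqc.
  apply: eq_bigr => r _; congr (_ * _).
  rewrite !layer_split rest_tperm_top //; congr (_ * _).
  by rewrite /core /link /bond -eqc ei ltnn /=.
have {gen} [D0 Dp Dm] := gen neqc.
rewrite !mulr_sumr -big_split; apply: eq_bigr => r _ /=.
rewrite (arrange_tperm r nboth); move: (arrange c r) => x.
rewrite partial_weight_tperm // !layer_split -(@rest_tperm_top k (c \o s) (x \o s) y); last first.
  by rewrite /= /s tpermL tpermR.
rewrite rest_tperm rest_tperm_top //.
transitivity ((Rdiag br (y i - y j) (colour_gap c) * core k c x y
   + word_gauge (c i) (c j) (colour_gap c) * Roff br (y i - y j)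
     * core k (c \o s) (x \o s) y) * (rest k c x y * partial_weight k c x)); last by ring.
rewrite -[LHS]mulrA; congr (_ * _).
rewrite /core /link /bond /= !shifted_left /= !shifted_tperm_right /s /= !tpermL !tpermR.
rewrite /word_gauge /colour_gap.
have [lt_ij|lt_ji|e] := ltngtP (c i) (c j); last by rewrite e eqxx in neqc.
  have ej : c j = k.
    apply/eqP; rewrite eqn_leq jk leqNgt; apply: contra nboth => cjk.
    by rewrite cjk (ltn_trans lt_ij).
  rewrite ej in lt_ij D0 Dp *; rewrite eqxx lt_ij ltnn (ltnW lt_ij) leqnn /=.
  rewrite !subr0 !mulr1 !mul1r.
  have -> : shifted c j (c i) - (shifted c j k - 1) = shifted c j (c i) - shifted c j k + 1.
    by rewrite opprB addrA addrAC.
  apply: base_low => //; last by move: (Dp lt_ij); rewrite /colour_gap ej.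
  by move: D0; rewrite /colour_gap ej.
have ei : c i = k.
  apply/eqP; rewrite eqn_leq ik leqNgt; apply: contra nboth => cik.
  by rewrite cik (ltn_trans lt_ji).
rewrite ei in lt_ji D0 Dm *; rewrite eqxx lt_ji ltnn (ltnW lt_ji) leqnn /=.
rewrite !subr0 !mulr1 !mul1r.
have -> : shifted c j (c j) - (shifted c j k - 1) = shifted c j (c j) - shifted c j k + 1.
  by rewrite opprB addrA addrAC.
move: D0 (Dm lt_ji); rewrite /colour_gap ei.
have -> : shifted c j k - shifted c j (c j) = - (shifted c j (c j) - shifted c j k).
  exact: esym (opprB _ _).
rewrite -opprD !br_odd !oppr_eq0 gaugeN // => D0 D1.
by rewrite base_high.
Qed.

End BothPresent.

End Adjacent.
End WeightRecursion.

(** * Symmetry of the pairing of the two families *)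

Section AdjacentGeneration.
Variables (n : nat) (A : 'S_n -> Prop).
Hypothesis A_mul : forall g h, A g -> A h -> A (g * h)%g.
Hypothesis A_one : A 1%g.
Hypothesis A_adj : forall i j : 'I_n, j = i.+1 :> nat -> A (tperm i j).

Lemma adjacent_generate g : A g.
Proof.
have tp d (i j : 'I_n) : (j = i + d.+1 :> nat)%N -> A (tperm i j).
  elim: d i j => [|d IH] i j e; first by apply: A_adj; rewrite e addn1.
  have lt_k : (i + d.+1 < n)%N by rewrite (leq_trans _ (ltn_ord j)) // ltnS e leq_add2l.
  pose k := Ordinal lt_k.
  have kj : j = k.+1 :> nat by rewrite e /= !addnS.
  have ik : i != k by rewrite -val_eqE /= -[X in X == _]addn0 eqn_add2l.
  have ij : i != j by rewrite -val_eqE /= e -[X in X == _]addn0 eqn_add2l.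
  have -> : tperm i j = (tperm k j * (tperm i k * tperm k j))%g.
    have := @tpermJ_tperm _ k j i; rewrite /conjg tpermV mulgA => h.
    rewrite mulgA [tperm i k]tpermC h; first exact: tpermC.
      by rewrite eq_sym.
    by rewrite eq_sym.
  apply: A_mul; [exact: A_adj|apply: A_mul; [exact: IH|exact: A_adj]].
have tpa (i j : 'I_n) : A (tperm i j).
  have [lt_ij|lt_ji|/val_inj ->] := ltngtP i j; last by rewrite tperm1.
    by apply: (tp (j - i).-1); lia.
  by rewrite tpermC; apply: (tp (i - j).-1); lia.
have [ts -> _] := prod_tpermP g.
by apply: (big_ind A) => // tt _; exact: tpa.
Qed.
End AdjacentGeneration.

Definition colours n N (J : word n N) (a : 'I_n) : nat := J a.

Section Pairing.
Variables (F : numFieldType) (br : F -> F) (n N : nat) (lam : 'I_N -> nat).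
Variables (m : nat -> nat) (t t' : nat -> nat -> F) (pot dual_pot : nat -> F).

Hypothesis br_odd : {morph br : z / - z}.
Hypothesis fay : three_term br.
Hypothesis t_generic : forall l a b, (a < m l)%N -> (b < m l)%N -> a != b ->
  br (t l a - t l b) != 0 /\ br (t l a - t l b + 1) != 0.
Hypothesis t'_generic : forall l a b, (a < m l)%N -> (b < m l)%N -> a != b ->
  br (t' l a - t' l b) != 0 /\ br (t' l a - t' l b + 1) != 0.
Hypothesis pot_generic : forall (p q : 'I_N) (z : int), p != q -> (`|z|%N <= n)%N ->
  br (pot p - pot q + z%:~R) != 0.
Hypothesis dual_potE : forall l : 'I_N, dual_pot l = (lam l)%:R - pot l.
Hypothesis mE : forall (J : word n N) l, J \in partitions n lam -> (l < N)%N ->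
  m l = #|level (colours J) l|.

Definition direct (J : word n N) (y : 'I_n -> F) := partial_weight br m t dual_pot N (colours J) y.
Definition reversed (J : word n N) (y : 'I_n -> F) :=
  partial_weight br m t' pot N (colours J \o @rev_ord n) (y \o @rev_ord n).
(** The level variables t and t' of the two families are independent here; the
    sum is symmetric in y for all generic values of them. *)
Definition paired_sum (y : 'I_n -> F) := \sum_(J in partitions n lam) direct J y * reversed J y.

Section Swap.
Variables i j : 'I_n.
Hypothesis ij : j = i.+1 :> nat.
Let s := tperm i j.

Definition swap_word (J : word n N) : word n N := [ffun a => J (s a)].

Lemma colours_swap J : colours (swap_word J) = colours J \o s.
Proof. by apply/funext => a; rewrite /colours /= ffunE. Qed.

Lemma swap_wordK : involutive swap_word.
Proof. by move=> J; apply/ffunP => a; rewrite !ffunE tpermK. Qed.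

Lemma swap_word_partitions J : (swap_word J \in partitions n lam) = (J \in partitions n lam).
Proof.
rewrite !inE; apply: eq_forallb => l; congr (_ == _).
rewrite -(card_preimset _ (@perm_inj _ s)); apply: eq_card => a.
by rewrite !inE ffunE tpermK.
Qed.

Let ij' : rev_ord i = (rev_ord j).+1 :> nat.
Proof. by rewrite /= ij subnSK // -ij. Qed.

Lemma rev_tperm a : s (rev_ord a) = rev_ord (tperm (rev_ord j) (rev_ord i) a).
Proof.
rewrite /s.
by rewrite -[a in RHS]rev_ordK -(inj_tperm _ _ _ rev_ord_inj) rev_ordK tpermC.
Qed.

Lemma count_split (c : 'I_n -> nat) l :
  #|[set b | c b == l]| = (#|[set b : 'I_n | (b < i)%N & c b == l]|
    + ((c i == l) + (c j == l) + #|[set b : 'I_n | (j < b)%N & c b == l]|))%N.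
Proof.
rewrite -(cardsID [set b : 'I_n | (b < i)%N]); congr (_ + _)%N.
  by apply: eq_card => b; rewrite !inE andbC.
have ji : (j == i) = false by rewrite -val_eqE /= ij gtn_eqF.
rewrite (cardsD1 i) (cardsD1 j) !inE ji ltnn -leqNgt ij leqnSn /= addnA; congr (_ + _)%N.
apply: eq_card => b; rewrite !inE -!val_eqE /= ij -leqNgt.
case: (ltngtP i.+1 b) => h; case: (ltngtP i b) => //= h'; try lia.
Qed.

Section Gap.
Variable J : word n N.

Definition count_below l := #|[set b : 'I_n | (b < i)%N & colours J b == l]|.

(** The common dynamical argument of the exchange blocks of both families: the
    positions to the right of j in the reversed word are those to the left of i,
    and the potential lam - pot of the first family turns a count on the right
    of j into one on the left of i. *)
Definition word_gap :=
  pot (J j) - pot (J i) + ((count_below (J i))%:R - (count_below (J j))%:R).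

End Gap.

Lemma word_gap_swap J : word_gap (swap_word J) = - word_gap J.
Proof.
have below_swap l : count_below (swap_word J) l = count_below J l.
  apply: eq_card => b; rewrite !inE colours_swap /=.
  have [bi|//] := ltnP b i; rewrite tpermD // -val_eqE /= ?ij gtn_eqF //.
  exact: ltnW.
by rewrite /word_gap !below_swap !ffunE tpermL tpermR; ring.
Qed.

Variable J : word n N.
Hypothesis hJ : J \in partitions n lam.
Local Notation below := (count_below J).
Local Notation common_gap := (word_gap J).

Lemma lam_count (l : 'I_N) : lam l = #|[set b | colours J b == l]|.
Proof.
move: hJ; rewrite inE => /forallP /(_ l) /eqP <-; apply: eq_card => b.
by rewrite !inE.
Qed.

Lemma direct_gap : J i != J j -> colour_gap dual_pot i j (colours J) = common_gap.
Proof.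
move=> neq; rewrite /colour_gap /shifted !dual_potE !lam_count.
rewrite !(count_split (colours J)) /word_gap /count_below /colours !eqxx !val_eqE.
have -> : (J j == J i) = false by rewrite eq_sym (negPf neq).
rewrite (negPf neq) /=; ring.
Qed.

Lemma reversed_gap :
  colour_gap pot (rev_ord j) (rev_ord i) (colours J \o @rev_ord n) = common_gap.
Proof.
have cnt l : #|[set b : 'I_n | (rev_ord i < b)%N & (colours J \o @rev_ord n) b == l]|
    = below l.
  rewrite /count_below -(card_preimset _ (@rev_ord_inj n)); apply: eq_card => b.
  rewrite !inE /= rev_ordK; congr (_ && _).
  by have := ltn_ord i; have := ltn_ord b => /=; lia.
rewrite /colour_gap /shifted !cnt /= !rev_ordK /word_gap /colours; ring.
Qed.

(** At most n - 2 positions lie on the left of i, which leaves room for e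
    within the range in which the potential is generic. *)
Lemma common_gap_generic e : J i != J j -> (`|e| <= 1)%N ->
  br (common_gap + e%:~R) != 0.
Proof.
move=> neq e1.
have -> : common_gap + e%:~R =
    pot (J j) - pot (J i) + ((below (J i))%:Z - (below (J j))%:Z + e)%:~R.
  by rewrite /word_gap; ring.
apply: pot_generic; first by rewrite eq_sym.
have : (below (J i) + below (J j) + 2 <= n)%N.
  have disj (p q : 'I_N) : p != q -> (below p + below q <= i)%N.
    move=> pq; rewrite /count_below -cardsUI [X in (_ + X)%N](_ : _ = 0%N).
      rewrite addn0 -[X in (_ <= X)%N](card_ord i).
      have lt_b (k : 'I_i) : (k < n)%N by exact: ltn_trans (ltn_ord i).
      rewrite -cardsT -(card_imset [set: 'I_i] (f := fun k => Ordinal (lt_b k))); last first.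
        by move=> k k' [] /val_inj.
      apply: subset_leq_card; apply/fintype.subsetP => b; rewrite !inE => hb.
      have bi : (b < i)%N by case/orP: hb => /andP[].
      by apply/imsetP; exists (Ordinal bi) => //; apply: val_inj.
    apply/eqP; rewrite cards_eq0; apply/eqP/setP => b; rewrite !inE.
    apply/negP => /andP[/andP[_ /eqP ep] /andP[_ /eqP eq]].
    by move: pq; rewrite -val_eqE /= -ep -eq eqxx.
  by have := disj _ _ neq; have := ltn_ord j; rewrite ij; lia.
by lia.
Qed.

Variable y : 'I_n -> F.
Hypothesis y_generic : br (y i - y j + 1) != 0.
Hypothesis y_generic' : br (y j - y i + 1) != 0.

Let gap_ok (c : 'I_n -> nat) (p : nat -> F) (i1 j1 : 'I_n) : J i != J j ->
  colour_gap p i1 j1 c = common_gap -> gap_generic br p i1 j1 c.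
Proof.
move=> neq e; split; rewrite e; first by have := common_gap_generic (e := 0) neq isT; rewrite addr0.
  by move=> _; have := common_gap_generic (e := 1) neq isT.
by move=> _; have := common_gap_generic (e := -1) neq isT.
Qed.

Lemma direct_swap : direct J (y \o s) =
  if J i == J j then direct J y else
  Rdiag br (y i - y j) common_gap * direct J y
  + word_gauge br (J i) (J j) common_gap * Roff br (y i - y j)
    * direct (swap_word J) y.
Proof.
rewrite /direct partial_weight_exchange ?ltn_ord //; last first.
- by move=> neq; apply: gap_ok => //; apply: direct_gap.
- by move=> l lN; exact: mE.
rewrite /exchanged val_eqE; case: eqVneq => // neq.
by rewrite direct_gap // -colours_swap.
Qed.

Lemma reversed_swap : reversed J (y \o s) =
  if J i == J j then reversed J y else
  Rdiag br (y j - y i) common_gap * reversed J y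
  + word_gauge br (J j) (J i) common_gap * Roff br (y j - y i)
    * reversed (swap_word J) y.
Proof.
rewrite /reversed.
have -> : (y \o s) \o @rev_ord n = (y \o @rev_ord n) \o tperm (rev_ord j) (rev_ord i).
  by apply/funext => a; rewrite /= rev_tperm.
rewrite partial_weight_exchange ?ltn_ord //= ?rev_ordK //; last first.
- by move=> neq; apply: gap_ok; rewrite ?reversed_gap // eq_sym.
- move=> l lN; rewrite (mE hJ lN) -(card_preimset _ (@rev_ord_inj n)).
  by apply: eq_card => a; rewrite !inE /= ?rev_ordK.
rewrite /exchanged /= !rev_ordK reversed_gap [_ == _]eq_sym val_eqE.
case: eqVneq => // neq.
have -> : colours (swap_word J) \o @rev_ord n
    = (colours J \o @rev_ord n) \o tperm (rev_ord j) (rev_ord i).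
  by apply/funext => a; rewrite colours_swap /= rev_tperm.
by [].
Qed.

End Swap.

(** The words J and J with two colours swapped span the block on which
    [unitarity] applies; adding J and its swap counts every word twice. *)
Lemma paired_sum_swap (i j : 'I_n) (y : 'I_n -> F) : j = i.+1 :> nat ->
  br (y i - y j + 1) != 0 -> br (y j - y i + 1) != 0 ->
  paired_sum (y \o tperm i j) = paired_sum y.
Proof.
move=> ij y1 y1'; apply: (mulIf (x := 2%:R)); first by rewrite pnatr_eq0.
have dbl (h : word n N -> F) : (\sum_(J in partitions n lam) h J) * 2%:R
    = \sum_(J in partitions n lam) (h J + h (swap_word i j J)).
  rewrite big_split /= mulr_natr mulr2n; congr (_ + _).
  rewrite (reindex_inj (inv_inj (swap_wordK i j))) /=.
  by apply: eq_bigl => J; rewrite swap_word_partitions.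
rewrite /paired_sum !dbl; apply: eq_bigr => J hJ.
have hJs : swap_word i j J \in partitions n lam by rewrite swap_word_partitions.
rewrite !direct_swap // !reversed_swap // !ffunE tpermL tpermR swap_wordK.
rewrite [J j == J i]eq_sym; case: eqVneq => // neq.
rewrite word_gap_swap //; set D := word_gap _ _ _.
have D0 : br D != 0 by have := common_gap_generic ij (e := 0) hJ neq isT; rewrite addr0.
have gN p q : word_gauge br p q (- D) = word_gauge br p q D.
  by rewrite /word_gauge gaugeN.
have gg := word_gauge_mul br_odd D neq; rewrite gN in gg.
rewrite !gN; have -> : y j - y i = - (y i - y j) by rewrite opprB.
by apply: unitarity => //; rewrite opprB.
Qed.

Theorem paired_sum_perm (u : 'I_n -> F) (g : 'S_n) :
  (forall a b, br (u a - u b + 1) != 0) -> paired_sum (u \o g) = paired_sum u.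
Proof.
move=> u1.
suff : forall h : 'S_n, paired_sum (u \o (g * h)%g) = paired_sum (u \o h).
  by move=> /(_ 1%g); rewrite mulg1 => ->; congr paired_sum; apply/funext => a /=; rewrite perm1.
apply: (adjacent_generate
  (A := fun g => forall h : 'S_n, paired_sum (u \o (g * h)%g) = paired_sum (u \o h))).
- by move=> g1 g2 e1 e2 h; rewrite -mulgA e1 e2.
- by move=> h; rewrite mul1g.
- move=> i j ij h; rewrite -[RHS](paired_sum_swap ij) /=; [|exact: u1..].
  by congr paired_sum; apply/funext => a; rewrite /= permM.
Qed.

End Pairing.

(** * Triangularity at specialized level variables *)

(** The map h is a bijection from A onto B, so the two sums are compared term by
    term. *)
Lemma sum_lowering n (A B : {set 'I_n}) (h : 'I_n -> 'I_n) :
  {in A &, injective h} -> (forall a, a \in A -> h a \in B) -> #|A| = #|B| ->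
  (forall a, a \in A -> h a <= a)%N ->
  (\sum_(a in B) a <= \sum_(a in A) a)%N
  /\ ((\sum_(a in A) a <= \sum_(a in B) a)%N -> {in A, h =1 id} /\ A = B).
Proof.
move=> hinj hB cAB hle.
have imB : h @: A = B.
  apply/eqP; rewrite eqEcard (card_in_imset hinj) cAB leqnn andbT.
  by apply/fintype.subsetP => _ /imsetP[a aA ->]; exact: hB.
have sumB : (\sum_(a in B) a = \sum_(a in A) h a)%N by rewrite -imB big_imset.
have := @leqif_sum _ (mem A) (fun a => h a == a) (fun a => h a) (fun a => a)
  (fun a aA => leqif_eq (hle a aA)).
rewrite -sumB => -[le_BA eq_BA]; split=> // le_AB.
have hid : {in A, h =1 id}.
  move=> a aA; apply/eqP; move: eq_BA; rewrite eqn_leq le_BA le_AB.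
  by move=> /esym /forallP /(_ a) /implyP /(_ aA).
split=> //; rewrite -imB -[LHS]imset_id.
by apply: eq_in_imset => a aA; rewrite hid.
Qed.

Section Support.
Variables (F : numFieldType) (br : F -> F) (n : nat).
Variables (m : nat -> nat) (t : nat -> nat -> F) (pot : nat -> F).
Variables (N : nat) (u : 'I_n -> F) (e : forall l, 'I_(m l) -> 'I_n).
Variable c : 'I_n -> nat.
Arguments e : clear implicits.

Hypothesis br0 : br 0 = 0.
Hypothesis tE : forall l (a : 'I_(m l)), (l < N)%N -> t l a = u (e l a).
Hypothesis e_inj : forall l, (l < N)%N -> injective (e l).
Hypothesis e_nest : forall l (a : 'I_(m l)), (l.+1 < N)%N ->
  exists b : 'I_(m l.+1), e l.+1 b = e l a.
Hypothesis mE : forall l, (l < N)%N -> m l = #|level c l|.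

Lemma rank_surj l (p : 'I_(m l)) : (l < N)%N ->
  exists2 a, (c a < l)%N & rank c l a = p.
Proof.
move=> lN; have lt_p : (p < #|level c l|)%N by rewrite -mE.
exists (enum_val (Ordinal lt_p)).
  by have := enum_valP (Ordinal lt_p); rewrite inE.
by rewrite /rank (enum_val_nth (enum_val (Ordinal lt_p))) index_uniq ?enum_uniq -?cardE.
Qed.

Lemma layer_congr k x x' y y' :
  (forall a, (c a < k)%N -> x a = x' a) -> (forall a, (c a <= k)%N -> y a = y' a) ->
  layer br pot k c x y = layer br pot k c x' y'.
Proof.
move=> ex ey; rewrite /layer; congr (_ * _).
  apply: eq_bigr => a _; rewrite /link; case: ifP => // ak.
  by rewrite ex // ey // ltnW.
apply: eq_bigr => a _; apply: eq_bigr => b _; rewrite /bond.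
congr (_ * _ * _); case: ifP => // /andP[ha hb]; rewrite ?ex ?ey //.
Qed.

Lemma partial_weight_congr k y y' : (forall a, (c a < k)%N -> y a = y' a) ->
  partial_weight br m t pot k c y = partial_weight br m t pot k c y'.
Proof.
case: k => [//|k] ey /=; apply: eq_bigr => r _; congr (_ * _).
by apply: layer_congr => // a ak; apply: ey.
Qed.

(** With the level variables specialized to points of u, an arrangement of level l
    is a placement of indices of u at the positions of colour less than l. *)
Definition label l (r : 'S_(m l)) (a : 'I_n) : 'I_n :=
  if insub (rank c l a) is Some p then e l (r p) else a.

Lemma arrange_label l (r : 'S_(m l)) a : (l < N)%N -> (c a < l)%N ->
  arrange t c r a = u (label r a).
Proof.
move=> lN al; rewrite /arrange /act_perm /label.
by rewrite (insubT (fun p => (p < m l)%N) (rank_lt (mE lN) al)) /= tE.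
Qed.

Lemma label_inj l (r : 'S_(m l)) : (l < N)%N ->
  {in [pred a | (c a < l)%N] &, injective (label r)}.
Proof.
move=> lN a b al bl; rewrite /label.
rewrite (insubT (fun p => (p < m l)%N) (rank_lt (mE lN) al)).
rewrite (insubT (fun p => (p < m l)%N) (rank_lt (mE lN) bl)) /=.
by move=> /(e_inj lN) /perm_inj [] /(rank_inj al).
Qed.

Lemma label_codom l (r : 'S_(m l)) a : (l < N)%N -> (c a < l)%N ->
  exists p, label r a = e l p.
Proof.
move=> lN al; rewrite /label.
rewrite (insubT (fun p => (p < m l)%N) (rank_lt (mE lN) al)).
by eexists.
Qed.

Lemma label_surj l (r : 'S_(m l)) p : (l < N)%N ->
  exists2 a, (c a < l)%N & label r a = e l p.
Proof.
move=> lN; have [a al ra] := rank_surj ((r^-1)%g p) lN; exists a => //.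
rewrite /label ra (insubT (fun p => (p < m l)%N) (ltn_ord _)) /=.
congr (e l _); rewrite -[RHS](permKV r); congr (r _).
exact: val_inj.
Qed.

(** For a < b the layer has the factor br (y b - x a), which vanishes. *)
Lemma layer_neq0_le k x y a b : layer br pot k c x y != 0 ->
  (c a < k)%N -> (c b <= k)%N -> y b = x a -> (b <= a)%N.
Proof.
move=> h ak bk yx; rewrite leqNgt; apply/negP => ab; move: h.
have b0 : bond br k c x y a b = 0 by rewrite /bond ak bk yx subrr br0 !mul0r.
rewrite /layer [X in _ * X](bigD1 a) //= [X in _ * (X * _)](bigD1 b) //=.
by rewrite b0 !(mul0r, mulr0) eqxx.
Qed.

Definition dominates (g : 'I_n -> 'I_n) l (h : 'I_n -> 'I_n) :=
  [/\ forall a, (c a < l)%N -> (h a <= a)%N,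
      forall a, (c a < l)%N -> exists p, g (h a) = e l p
    & {in [pred a | (c a < l)%N] &, injective (g \o h)}].

(** The points of level l also occur on level l + 1, and by [layer_neq0_le] they
    sit there at the same position or further to the left. Composing these moves
    from level l up to level k gives h. *)
Lemma partial_weight_support k (g : 'I_n -> 'I_n) y : (k <= N)%N ->
  (forall a, (c a < k)%N -> y a = u (g a)) ->
  (forall l (p : 'I_(m l)), l.+1 = k -> exists2 a, (c a < k)%N & g a = e l p) ->
  partial_weight br m t pot k c y != 0 ->
  forall l, (l < k)%N ->
  exists2 h, (forall a, (c a < l)%N -> (c (h a) < k)%N) & dominates g l h.
Proof.
elim: k g y => [//|k IH] g y kN ey gsurj /= nz l.
have [r /andP[lay0 psi0]] : exists r : 'S_(m k),
    (layer br pot k c (arrange t c r) y != 0)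
    && (partial_weight br m t pot k c (arrange t c r) != 0).
  apply/existsP; apply: contraNT nz; rewrite negb_exists => /forallP h.
  rewrite big1 // => r _; apply/eqP; have := h r.
  by rewrite negb_and !negbK -mulf_eq0.
pose step a := odflt a [pick b | (c b <= k)%N && (g b == label r a)].
have stepP a : (c a < k)%N -> (c (step a) <= k)%N /\ g (step a) = label r a.
  move=> ak; rewrite /step; case: pickP => [b /andP[bk /eqP gb]|none] //=.
  have [p lp] := label_codom r kN ak.
  have [b bk gb] := gsurj k p erefl.
  by have := none b; rewrite -ltnS bk gb lp eqxx.
have step_le a : (c a < k)%N -> (step a <= a)%N.
  move=> ak; have [sk gs] := stepP a ak.
  apply: (layer_neq0_le lay0 ak sk).
  by rewrite ey // gs arrange_label.
rewrite ltnS leq_eqVlt => /orP[/eqP ->{l}|lk].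
  exists step; first by move=> a ak; rewrite ltnS; have [] := stepP a ak.
  split=> //.
    by move=> a ak; have [_ ->] := stepP a ak; exact: label_codom.
  move=> a b ak bk /=; have [_ ->] := stepP a ak; have [_ ->] := stepP b bk.
  exact: label_inj.
have lab_surj l' (p : 'I_(m l')) : l'.+1 = k -> exists2 a, (c a < k)%N & label r a = e l' p.
  move=> e'; have lN : (l'.+1 < N)%N by rewrite e'.
  move: (r) => r'; have [q <-] := e_nest p lN.
  move: q; rewrite e' => q; exact: label_surj.
have [h hk [hle hB hinj]] := IH (label r) _ (ltnW kN)
  (fun a ak => arrange_label r kN ak) lab_surj psi0 l lk.
exists (step \o h); first by move=> a al /=; rewrite ltnS; have [] := stepP _ (hk _ al).
split.
- by move=> a al /=; apply: leq_trans (hle _ al); apply: step_le; exact: hk.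
- by move=> a al /=; have [_ ->] := stepP _ (hk _ al); exact: hB.
- move=> a b al bl /=; have [_ ->] := stepP _ (hk _ al).
  by have [_ ->] := stepP _ (hk _ bl) => /= eab; apply: hinj.
Qed.

Section Top.
Variable g : 'S_n.
Hypothesis c_lt : forall a, (c a < N)%N.

Definition occupied l : {set 'I_n} := [set a | [exists p, g a == e l p]].

Lemma card_occupied l : (l < N)%N -> #|level c l| = #|occupied l|.
Proof.
move=> lN; rewrite -mE // -[LHS]card_ord.
have -> : occupied l = [set (g^-1)%g (e l p) | p : 'I_(m l)].
  apply/setP => a; rewrite inE; apply/existsP/imsetP => [[p /eqP ga]|[p _ ->]].
    by exists p; rewrite // -ga permK.
  by exists p; rewrite permKV.
by rewrite card_imset // => p q /perm_inj /(e_inj lN).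
Qed.

Lemma partial_weight_lowering : partial_weight br m t pot N c (u \o g) != 0 ->
  forall l, (l < N)%N ->
  (\sum_(a in occupied l) a <= \sum_(a in level c l) a)%N
  /\ ((\sum_(a in level c l) a <= \sum_(a in occupied l) a)%N ->
      level c l = occupied l).
Proof.
move=> nz l lN.
have surj l' (p : 'I_(m l')) : l'.+1 = N -> exists2 a, (c a < N)%N & g a = e l' p.
  by move=> _; exists (g^-1 (e l' p))%g; rewrite ?permKV.
have [h _ [hle hB hinj]] := partial_weight_support (leqnn N) (fun a _ => erefl) surj nz lN.
have [||||le_sum eq_sum] := @sum_lowering _ (level c l) (occupied l) h.
- by move=> a b; rewrite !inE => al bl hab; apply: hinj => //=; rewrite hab.
- move=> a; rewrite !inE => al; have [p gp] := hB a al.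
  by apply/existsP; exists p; rewrite gp.
- exact: card_occupied.
- by move=> a; rewrite inE; exact: hle.
by split=> // /eq_sum[].
Qed.

Hypothesis level_occupied : forall l, (l < N)%N -> level c l = occupied l.

Lemma standard_arrangement l : (l < N)%N ->
  exists r : 'S_(m l), forall a, (c a < l)%N -> label r a = g a.
Proof.
move=> lN.
have /boolp.choice[f fP] : forall p : 'I_(m l), exists q : 'I_(m l),
    exists2 a, (c a < l)%N & (rank c l a = p /\ g a = e l q).
  move=> p; have [a al ra] := rank_surj p lN.
  have : a \in occupied l by rewrite -level_occupied // inE.
  by rewrite inE => /existsP[q /eqP gq]; exists q, a.
have f_inj : injective f.
  move=> p p' ff; have [a _ [ra ga]] := fP p; have [a' _ [ra' ga']] := fP p'.
  apply: val_inj; rewrite /= -ra -ra'; congr rank.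
  by apply: (@perm_inj _ g); rewrite ga ga' ff.
exists (perm f_inj) => a al; rewrite /label.
rewrite (insubT (fun p => (p < m l)%N) (rank_lt (mE lN) al)) permE /=.
have [a' a'l [ra' <-]] := fP (Ordinal (rank_lt (mE lN) al)).
by congr (g _); apply: (rank_inj a'l).
Qed.

Lemma label_unique l (r r0 : 'S_(m l)) : (l < N)%N ->
  (forall a, (c a < l)%N -> label r a = label r0 a) -> r = r0.
Proof.
move=> lN h; apply/permP => p; have [a al ra] := rank_surj p lN.
have := h a al; rewrite /label ra -[nat_of_ord p]/(val p) valK.
exact: e_inj.
Qed.

(** An arrangement of level k compatible with a nonzero layer lowers the
    positions of level k among themselves, hence it fixes them. *)
Lemma partial_weight_diagonal k : (k <= N)%N ->
  partial_weight br m t pot k c (u \o g) = \prod_(l < k) layer br pot l c (u \o g) (u \o g).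
Proof.
elim: k => [|k IH] kN; first by rewrite big_ord0.
have [r0 r0P] := standard_arrangement kN.
have x0E a : (c a < k)%N -> arrange t c r0 a = (u \o g) a.
  by move=> ak; rewrite arrange_label // r0P.
rewrite big_ord_recr /= (bigD1 r0) //= [X in _ + X]big1 ?addr0.
  rewrite (partial_weight_congr x0E) IH 1?ltnW // mulrC; congr (_ * _).
  exact: layer_congr.
move=> r rr0; apply/eqP; rewrite mulf_eq0; apply/orP; left.
apply: contraNT rr0 => nz; apply/eqP; apply: label_unique => // a ak.
rewrite r0P //.
pose h a := (g^-1 (label r a))%g.
have gh b : g (h b) = label r b by rewrite /h permKV.
have hlev b : (c b < k)%N -> h b \in level c k.
  move=> bk; rewrite level_occupied // inE gh.
  by have [p ->] := label_codom r kN bk; apply/existsP; exists p.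
have [||||_ hid] := @sum_lowering _ (level c k) (level c k) h.
- move=> b b'; rewrite !inE => bk bk' hbb; apply: (@label_inj k r kN b b' bk bk').
  by rewrite -!gh hbb.
- by move=> b; rewrite inE; exact: hlev.
- by [].
- move=> b; rewrite inE => bk; have := hlev b bk; rewrite inE => hbk.
  apply: (layer_neq0_le nz bk (ltnW hbk)).
  by rewrite /= gh arrange_label.
have [hid' _] := hid (leqnn _).
by rewrite -gh hid' // inE.
Qed.

End Top.
End Support.

(** * Weight functions in recursive form *)

Section Conversion.
Variables (F : numFieldType) (br : F -> F) (n N : nat).
Variables (I : word n N) (P : 'I_N -> 'I_N -> F) (pot : nat -> F).
Hypothesis potE : forall j k : 'I_N, P j k = pot j - pot k.
Let c := colours I.

Definition placed (v : nat -> nat -> F) l (a : 'I_n) : F := v l (rank c l a).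

Lemma rank_enum_val l (a : 'I_#|upto I l|) : rank c l (enum_val a) = a.
Proof. by rewrite /rank (enum_val_nth (enum_val a)) index_uniq ?enum_uniq -?cardE. Qed.

Lemma ltn_enum_val (A : {set 'I_n}) (a b : 'I_#|A|) :
  (enum_val a < enum_val b)%N = (a < b)%N.
Proof.
have mono (a' b' : 'I_#|A|) : (a' < b')%N -> (enum_val a' < enum_val b')%N.
  move=> ab; have x0 := enum_val a'.
  rewrite (enum_val_nth x0 a') (enum_val_nth x0 b').
  apply: (@sorted_ltn_nth _ (fun x y : 'I_n => (x < y)%N)) ab; rewrite ?inE -?cardE //.
  - by move=> ? ? ?; exact: ltn_trans.
  - exact: enum_sorted.
have [ab|ba|/val_inj ->] := ltngtP a b; last by rewrite ltnn.
  exact: mono.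
by apply/negbTE; rewrite -leqNgt ltnW // mono.
Qed.

(** The two sums in C count the positions on the right of a that have the
    colour of a and the colour l. *)
Lemma shifted_Cshift a (l : 'I_N) :
  P (I a) l - Cshift F I a l = shifted pot c a (c a) - shifted pot c a l.
Proof.
rewrite potE /Cshift /pairing /shifted sumrB -!natr_sum.
have cnt (k : 'I_N) : (\sum_(j < n | (a < j)%N) (I j == k))%N
    = #|[set b : 'I_n | (a < b)%N & c b == k]|.
  by rewrite -sum1dep_card big_mkcondr.
by rewrite !cnt; ring.
Qed.

Lemma U_layers v : U br I v P =
  \prod_(l < N | (0 < l)%N) layer br pot l c (placed v l) (placed v l.+1).
Proof.
apply: eq_bigr => l _.
set x := placed v l; set y := placed v l.+1.
pose T i := ((if (c i <= l)%N then factor br (shifted pot c i (c i) - shifted pot c i l) (y i - x i) else 1)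
  * (\prod_(j in upto I l.+1 | (i < j)%N) br (y j - x i))
  * (\prod_(j in upto I l.+1 | (j < i)%N) br (y j - x i + 1))
  * (\prod_(j in upto I l | (i < j)%N) (br (x j - x i + 1) / br (x j - x i)))).
transitivity (\prod_(i in upto I l) T i).
  rewrite [RHS]big_enum_val; apply: eq_bigr => a _.
  have xa : v l a = x (enum_val a) by rewrite /x /placed rank_enum_val.
  have yb (b : 'I_#|upto I l.+1|) : v l.+1 b = y (enum_val b) by rewrite /y /placed rank_enum_val.
  have xb (b : 'I_#|upto I l|) : v l b = x (enum_val b) by rewrite /x /placed rank_enum_val.
  have al : (c (enum_val a) < l)%N by have := enum_valP a; rewrite inE.
  rewrite /T (ltnW al); congr (_ * _ * _ * _).
  - have aS : enum_val a \in upto I l.+1 by rewrite inE ltnW.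
    rewrite (big_pred1 (enum_rank_in aS (enum_val a))) => [|b]; last first.
      rewrite /idx /= -(inj_eq enum_val_inj) enum_rankK_in //.
    rewrite yb enum_rankK_in // xa /factor -shifted_Cshift /idx.
    by rewrite addrA.
  - rewrite [RHS]big_mkcondr /= [RHS]big_enum_val -[RHS]big_mkcond /=.
    by apply: eq_big => // b _; rewrite yb xa.
  - rewrite [RHS]big_mkcondr /= [RHS]big_enum_val -[RHS]big_mkcond /=.
    by apply: eq_big => // b _; rewrite yb xa.
  - rewrite [RHS]big_mkcondr /= [RHS]big_enum_val -[RHS]big_mkcond /=.
    by apply: eq_big => [b|b _]; rewrite ?ltn_enum_val // xb xa.
have cond (B : 'I_n -> 'I_n -> bool) (f : 'I_n -> 'I_n -> F) (d e : nat) (i : 'I_n) :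
    \prod_(j : 'I_n | B i j) (if (c i < d)%N && (c j < e)%N then f i j else 1)
    = if (c i < d)%N then \prod_(j in upto I e | B i j) f i j else 1.
  case: ifP => _ /=; last by rewrite big1.
  by rewrite -big_mkcondr; apply: eq_bigl => j; rewrite inE andbC.
rewrite /layer [X in _ = _ * X](_ : _ =
    (\prod_(i in upto I l) \prod_(j in upto I l.+1 | (i < j)%N) br (y j - x i))
  * (\prod_(i in upto I l) \prod_(j in upto I l.+1 | (j < i)%N) br (y j - x i + 1))
  * (\prod_(i in upto I l) \prod_(j in upto I l | (i < j)%N)
       (br (x j - x i + 1) / br (x j - x i)))).
  rewrite /T !big_split /= !mulrA; congr (_ * _ * _ * _).
  rewrite big_mkcond; apply: eq_bigr => i _; rewrite inE /link -[(I i < l)%N]/(c i < l)%N.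
  by case: ifP => // il; rewrite ltnW.
rewrite /bond; under [LHS]eq_bigr do rewrite !big_split /=.
rewrite !big_split /=; congr (_ * _ * _).
- rewrite [RHS]big_mkcond; apply: eq_bigr => i _.
  rewrite (cond (fun i j => (i < j)%N) (fun i j => br (y j - x i)) l l.+1).
  by rewrite inE.
- rewrite (exchange_big_dep xpredT) //= [RHS]big_mkcond; apply: eq_bigr => i _.
  rewrite (cond (fun i j => (j < i)%N) (fun i j => br (y j - x i + 1)) l l.+1).
  by rewrite inE.
- rewrite [RHS]big_mkcond; apply: eq_bigr => i _.
  rewrite (cond (fun i j => (i < j)%N) (fun i j => br (x j - x i + 1) / br (x j - x i)) l l).
  by rewrite inE.
Qed.

Section Recursion.
Variable m : nat -> nat.
Hypothesis mE : forall l, m l = #|upto I l|.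

Lemma partial_weight_ext t t' k y : (forall l, (l < k)%N -> t l = t' l) ->
  partial_weight br m t pot k c y = partial_weight br m t' pot k c y.
Proof.
elim: k y => [//|k IH] y tt /=; apply: eq_bigr => r _.
have -> : arrange t c r = arrange t' c r by apply/funext => a; rewrite /arrange tt.
by rewrite IH // => l lk; apply: tt; exact: ltnW.
Qed.

Lemma partial_weight_upto t k y : partial_weight br m t pot k.+1 c y =
  \sum_(s : 'S_(#|upto I k|))
    let x a := t k (act_perm s (rank c k a)) in
    layer br pot k c x y * partial_weight br m t pot k c x.
Proof. by rewrite /= /arrange; case: _ / (mE k). Qed.

Definition symm (ls : seq nat) (f : (nat -> nat -> F) -> F) :=
  foldr (fun l f => Defs.Sym l #|upto I l| f) f ls.
Definition permuted k (s : 'S_(#|upto I k|)) (v : nat -> nat -> F) : nat -> nat -> F :=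
  fun l a => v l (if l == k then act_perm s a else a).

Lemma symm_cons l ls f v :
  symm (l :: ls) f v = \sum_s symm ls f (@permuted l s v).
Proof. by []. Qed.

Lemma symm_rcons ls k f v : k \notin ls ->
  symm (rcons ls k) f v = \sum_s symm ls f (@permuted k s v).
Proof.
elim: ls v => [//|l ls IH] v; rewrite inE negb_or => /andP[kl kls].
rewrite rcons_cons symm_cons; under eq_bigr => s _ do rewrite IH //.
rewrite exchange_big; apply: eq_bigr => s _; rewrite symm_cons; apply: eq_bigr => s' _.
congr (symm ls f _); apply/funext => l'; apply/funext => a; rewrite /permuted.
have [->|nl] := eqVneq l' l; last by [].
by rewrite eq_sym (negPf kl).
Qed.

Lemma symm_ext ls f f' v : (forall v, f v = f' v) -> symm ls f v = symm ls f' v.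
Proof. by move=> e; rewrite (_ : f = f') //; apply/funext. Qed.

Lemma symm_const ls (A : (nat -> nat -> F) -> F) f v :
  (forall l v v', l \in ls -> (forall k, k != l -> v k = v' k) -> A v = A v') ->
  symm ls (fun v => A v * f v) v = A v * symm ls f v.
Proof.
elim: ls v => [//|l ls IH] v hA; rewrite !symm_cons mulr_sumr.
apply: eq_bigr => s _; rewrite IH; last first.
  by move=> l' v1 v2 l'ls; apply: hA; rewrite inE l'ls orbT.
congr (_ * _); apply: (hA l); first by rewrite inE eqxx.
by move=> k kl; apply/funext => a; rewrite /permuted (negPf kl).
Qed.

(** In W the sum over the lowest level is the outermost one. The sums commute, and
    the highest layer does not depend on the lower levels, so the sum over the
    highest level can be taken outside with this layer factored out of the
    others, as in the recursion of [partial_weight]. *)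
Lemma symm_layers k v : (0 < k)%N ->
  symm (index_iota 1 k)
    (fun v => \prod_(l < k | (0 < l)%N) layer br pot l c (placed v l) (placed v l.+1)) v
  = partial_weight br m v pot k c (placed v k).
Proof.
case: k => // k _; elim: k v => [|k IH] v.
  rewrite /index_iota /= big_mkcond big_ord1 /=.
  have m0 : m 0 = 0%N by rewrite mE; apply: eq_card0 => a; rewrite inE.
  rewrite (eq_bigr (fun=> 1)) => [|s _]; last first.
    rewrite mulr1 /layer big1 => [|a _]; last by rewrite /link ltn0.
    by rewrite mul1r big1 // => a _; rewrite big1 // => b _; rewrite /bond ltn0 /= !mulr1.
  by rewrite sumr_const card_Sn m0.
have -> : index_iota 1 k.+2 = rcons (index_iota 1 k.+1) k.+1.
  by rewrite /index_iota !subSS !subn0 -[in LHS](addn1 k) iotaD add1n cats1.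
rewrite symm_rcons; last by rewrite mem_index_iota ltnn andbF.
rewrite partial_weight_upto; apply: eq_bigr => s _; lazy zeta.
pose A v := layer br pot k.+1 c (placed v k.+1) (placed v k.+2).
rewrite (@symm_ext _ _ (fun v => A v * \prod_(l < k.+1 | (0 < l)%N)
    layer br pot l c (placed v l) (placed v l.+1))); last first.
  by move=> w; rewrite big_mkcond big_ord_recr /= -big_mkcond mulrC.
rewrite symm_const; last first.
  move=> l w w'; rewrite mem_index_iota => /andP[_ lk] ww.
  by rewrite /A /placed !ww // gtn_eqF // ltnW.
rewrite IH // /A /placed /permuted eqxx eqn_leq ltnn; congr (_ * _).
by apply: partial_weight_ext => l lk; apply/funext => a; rewrite ltn_eqF.
Qed.

Theorem W_partial_weight t u : W br I t u P = partial_weight br m t pot N c u.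
Proof.
have [N0|N_gt0] := posnP N.
  have -> : partial_weight br m t pot N c u = 1 by case: {1}N / (esym N0).
  rewrite /W [in index_iota _ _]N0 /= U_layers.
  have -> : forall A : 'I_N -> F, \prod_(l < N | (0 < l)%N) A l = 1.
    by move=> A; rewrite big1 // => l; have := leq_trans (ltn_ord l) (eq_leq N0); rewrite ltn0.
  by [].
rewrite /W -/(symm (index_iota 1 N) _) (@symm_ext _ _ _ _ U_layers) symm_layers //.
rewrite (@partial_weight_ext _ t) => [|l lN]; last by apply/funext => a; rewrite lN.
apply: partial_weight_congr => a _; rewrite /placed ltnn.
have -> : rank c N a = a.
  have lv : level c N = [set: 'I_n]%SET by apply/setP => b; rewrite !inE ltn_ord.
  by rewrite /rank lv enum_setT -enumT index_enum_ord.
by rewrite /extend valK.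
Qed.

End Recursion.

End Conversion.

(** * Diagonal values *)

Section DiagonalLayer.
Variables (F : numFieldType) (br : F -> F) (n : nat) (pot : nat -> F).
Variables (c : 'I_n -> nat) (y : 'I_n -> F) (l : nat).
Hypothesis gap_neq0 : forall a, (c a < l)%N ->
  br (shifted pot c a (c a) - shifted pot c a l) != 0.
Hypothesis y_neq0 : forall a b, a != b -> br (y b - y a) != 0.

(** With equal variables on both levels, the link of a is br 1, which is the term
    b = a of the first product, and in the bond of two positions of colour less
    than l the denominator cancels. *)
Lemma layer_diag : layer br pot l c y y =
  \prod_(a | (c a < l)%N) (\prod_(b | (c b < l)%N) br (y b - y a + 1)
    * \prod_(b : 'I_n | c b == l) if (a < b)%N then br (y b - y a) else br (y b - y a + 1)).
Proof.
pose H (a b : 'I_n) := if (c a < l)%N then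
    (if (c b < l)%N then br (y b - y a + 1) else 1)
    * (if c b == l then if (a < b)%N then br (y b - y a) else br (y b - y a + 1) else 1)
  else 1.
transitivity (\prod_a \prod_b H a b); last first.
  rewrite [RHS]big_mkcond; apply: eq_bigr => a _; rewrite /H; case: ifP => _.
    by rewrite big_split /= -!big_mkcond.
  by rewrite big1.
have -> : \prod_a \prod_b H a b = \prod_a H a a
    * \prod_(a : 'I_n) \prod_(b : 'I_n | (a < b)%N) (H a b * H b a).
  have -> : \prod_(a : 'I_n) \prod_(b : 'I_n | (a < b)%N) (H a b * H b a)
      = (\prod_(a : 'I_n) \prod_(b : 'I_n | (a < b)%N) H a b)
        * (\prod_(a : 'I_n) \prod_(b : 'I_n | (a < b)%N) H b a).
    by rewrite -big_split; apply: eq_bigr => a _; rewrite big_split.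
  rewrite [X in _ * (_ * X)](exchange_big_dep xpredT) //= -!big_split /=.
  apply: eq_bigr => a _; rewrite (bigD1 a) //=; congr (_ * _).
  rewrite (bigID (fun b : 'I_n => (a < b)%N)) /=; congr (_ * _); apply: eq_bigl => b.
    by rewrite -val_eqE /=; case: ltngtP.
  by rewrite -val_eqE /=; case: ltngtP.
rewrite /layer; congr (_ * _).
  apply: eq_bigr => a _; rewrite /link /H; case: ifP => // al.
  by rewrite subrr ltn_eqF // mulr1 /factor !add0r mulrAC divff ?gap_neq0 ?mul1r.
apply: eq_bigr => a _; apply: eq_bigr => b ab; rewrite /bond /H ab.
have nab : br (y b - y a) != 0 by apply: y_neq0; rewrite -val_eqE /= ltn_eqF.
rewrite [(b < a)%N]ltnNge (ltnW ab) /=.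
by case: (ltngtP (c a) l) => al; case: (ltngtP (c b) l) => bl;
  rewrite /= ?(mul1r, mulr1) //; field.
Qed.

End DiagonalLayer.

Section Normalisation.
Variables (F : numFieldType) (br : F -> F) (n N : nat) (J : word n N) (u : 'I_n -> F).
Let c := colours J.

Lemma prod_upto (l : nat) (f : 'I_n -> F) :
  \prod_(a | (c a < l)%N) f a = \prod_(k < N | (k < l)%N) \prod_(a in block J k) f a.
Proof.
rewrite (partition_big (fun a => J a) (fun k : 'I_N => (k < l)%N)) //=.
apply: eq_bigr => k kl; apply: eq_bigl => a; rewrite inE.
by case: eqP => [e|]; rewrite ?andbF // andbT /c /colours e.
Qed.

Lemma prod_levels (f : 'I_n -> 'I_n -> F) :
  \prod_(k < N) \prod_(l < N | (k < l)%N) \prod_(a in block J k) \prod_(b in block J l) f a b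
  = \prod_(l < N) \prod_(a | (c a < l)%N) \prod_(b | c b == l) f a b.
Proof.
rewrite (exchange_big_dep xpredT) //=; apply: eq_bigr => l _.
rewrite prod_upto; apply: eq_bigr => k _; apply: eq_bigr => a _.
by apply: eq_bigl => b; rewrite inE -val_eqE.
Qed.

Lemma Sfactor_levels : Sfactor br J u =
  \prod_(l < N) \prod_(a | (c a < l)%N) \prod_(b | (c b < l)%N) br (u b - u a + 1).
Proof.
rewrite /Sfactor [X in X * _](exchange_big_dep xpredT) //= -big_split /=.
apply: eq_bigr => l _; rewrite [RHS]exchange_big /= -big_split /=.
rewrite prod_upto; apply: eq_bigr => k kl.
under [RHS]eq_bigr do rewrite prod_upto.
rewrite [RHS]exchange_big /= [RHS](bigD1 k) //=; congr (_ * _).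
Qed.

(** The left factor comes from the words J and the right one from the reversed
    words. They differ in the order of positions, so for each pair (a, b) of
    colours below l and equal to l, one of them contributes br (u b - u a) and the
    other one br (u b - u a + 1). *)
Lemma layer_pair_product (l : nat) :
  \prod_(a | (c a < l)%N) (\prod_(b | (c b < l)%N) br (u b - u a + 1)
    * \prod_(b : 'I_n | c b == l) if (a < b)%N then br (u b - u a) else br (u b - u a + 1))
  * (\prod_(a | (c a < l)%N) (\prod_(b | (c b < l)%N) br (u b - u a + 1)
    * \prod_(b : 'I_n | c b == l) if (b < a)%N then br (u b - u a) else br (u b - u a + 1)))
  = \prod_(a | (c a < l)%N) \prod_(b | c b == l) br (u b - u a + 1)
    * \prod_(a | (c a < l)%N) \prod_(b | c b == l) br (u b - u a)
    * (\prod_(a | (c a < l)%N) \prod_(b | (c b < l)%N) br (u b - u a + 1)) ^+ 2.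
Proof.
rewrite expr2 -!big_split /=; apply: eq_bigr => a al.
have -> : forall p q r : F, p * q * (p * r) = q * r * (p * p) by move=> *; ring.
congr (_ * _); rewrite -!big_split /=; apply: eq_bigr => b /eqP bl.
have nab : a <> b :> nat by move=> /val_inj e; move: al; rewrite -bl -e ltnn.
by case: (ltngtP a b) => //= _; rewrite // mulrC.
Qed.

End Normalisation.

(** * Orthogonality from oddness and the addition law *)

Section Orthogonality.
Variables (F : numFieldType) (br : F -> F) (n N : nat) (lam : 'I_N -> nat).
Variables (u : 'I_n -> F) (P : 'I_N -> 'I_N -> F).

Hypothesis br_odd : {morph br : z / - z}.
Hypothesis fay : three_term br.
Hypothesis P_add : forall j k l, P j k + P k l = P j l.
Hypothesis u_generic : forall i j, i != j -> br (u i - u j) != 0.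
Hypothesis u_generic1 : forall i j, br (u i - u j + 1) != 0.
Hypothesis P_generic : forall (j k : 'I_N) (z : int), j != k -> (`|z|%N <= n)%N ->
  br (P j k + z%:~R) != 0.

Lemma additive_potential : exists pot : nat -> F, forall j k : 'I_N, P j k = pot j - pot k.
Proof.
have [N0|N0] := posnP N.
  by exists (fun=> 0) => j; have := leq_trans (ltn_ord j) (eq_leq N0); rewrite ltn0.
pose o := Ordinal N0.
exists (fun l => if insub l is Some j then P j o else 0) => j k.
rewrite (valK j) (valK k); apply/eqP; rewrite eq_sym subr_eq; apply/eqP.
exact: esym (P_add j k o).
Qed.

Definition cumulative l := (\sum_(k < N | (k < l)%N) lam k)%N.

Lemma cumulativeE (J : word n N) l : J \in partitions n lam -> cumulative l = #|upto J l|.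
Proof.
rewrite inE => /forallP hJ; rewrite /cumulative -sum1dep_card.
rewrite (partition_big (fun a => J a) (fun k : 'I_N => (k < l)%N)) //=.
apply: eq_bigr => k kl; rewrite -(eqP (hJ k)) -sum1dep_card; apply: eq_bigl => a.
by case: eqP => [->|]; rewrite ?andbF // kl.
Qed.

Lemma word_eq (I J : word n N) :
  (forall l, (l < N)%N -> upto I l = upto J l) -> I = J.
Proof.
have le (I1 J1 : word n N) : (forall l, (l < N)%N -> upto I1 l = upto J1 l) ->
    forall a, (I1 a <= J1 a)%N.
  move=> h a; rewrite leqNgt; apply/negP => lt; have := h _ (ltn_ord (I1 a)).
  by move/setP/(_ a); rewrite !inE lt ltnn.
move=> h; apply/ffunP => a; apply/val_inj/eqP; rewrite eqn_leq !le //.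
by move=> l lN; rewrite h.
Qed.

Definition position_sum (A : {set 'I_n}) := (\sum_(a in A) a)%N.
Definition mirror (A : {set 'I_n}) := [set a | rev_ord a \in A]%SET.

Lemma position_sum_mirror A : (position_sum A + position_sum (mirror A) = #|A| * n.-1)%N.
Proof.
have -> : position_sum (mirror A) = (\sum_(a in A) rev_ord a)%N.
  rewrite /position_sum (reindex_inj rev_ord_inj); apply: eq_bigl => a.
  by rewrite inE rev_ordK.
rewrite -big_split -sum_nat_const; apply: eq_bigr => a _ /=.
by have := ltn_ord a; lia.
Qed.

Lemma mirrorK : involutive mirror.
Proof. by move=> A; apply/setP => a; rewrite !inE rev_ordK. Qed.

Section Labels.
Variable I : word n N.
Hypothesis hI : I \in partitions n lam.

Definition labels l (a : 'I_(cumulative l)) : 'I_n :=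
  enum_val (cast_ord (cumulativeE l hI) a).

Lemma spec_labels l (a : 'I_(cumulative l)) : spec I u l a = u (labels a).
Proof.
rewrite /spec /extend -[nat_of_ord a]/(val (cast_ord (cumulativeE l hI) a)).
by rewrite valK.
Qed.

Lemma labels_inj l : injective (@labels l).
Proof. by move=> a b /enum_val_inj /cast_ord_inj. Qed.

Lemma labels_codom l i : i \in upto I l -> exists a, @labels l a = i.
Proof.
move=> il; exists (cast_ord (esym (cumulativeE l hI)) (enum_rank_in il i)).
by rewrite /labels cast_ordKV enum_rankK_in.
Qed.

Lemma labels_mem l a : @labels l a \in upto I l.
Proof. exact: enum_valP. Qed.

Lemma labels_nest l (a : 'I_(cumulative l)) : exists b, @labels l.+1 b = labels a.
Proof.
apply: labels_codom; have := labels_mem a; rewrite !inE => h; exact: ltnW.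
Qed.

Lemma occupied_labels (g : 'S_n) l :
  occupied labels g l = [set a | g a \in upto I l]%SET.
Proof.
apply/setP => a; rewrite !inE; apply/existsP/idP => [[p /eqP ->]|].
  by have := labels_mem p; rewrite inE.
by move=> h; have [|p <-] := @labels_codom l (g a); [rewrite inE|exists p].
Qed.

Lemma spec_generic l a b : (a < cumulative l)%N -> (b < cumulative l)%N -> a != b ->
  br (spec I u l a - spec I u l b) != 0 /\ br (spec I u l a - spec I u l b + 1) != 0.
Proof.
move=> al bl ab; rewrite (spec_labels (Ordinal al)) (spec_labels (Ordinal bl)).
split; last exact: u_generic1.
by apply: u_generic; rewrite (inj_eq (@labels_inj l)) -val_eqE.
Qed.

End Labels.

Let br0 : br 0 = 0.
Proof.
have /eqP := br_odd 0; rewrite oppr0 -subr_eq0 opprK -mulr2n mulrn_eq0 /=.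
by move/eqP.
Qed.

Variable pot : nat -> F.
Hypothesis potE : forall j k : 'I_N, P j k = pot j - pot k.

Definition dual_pot l := (if insub l is Some k then lam k else 0%N)%:R - pot l.

Lemma dual_potE (l : 'I_N) : dual_pot l = (lam l)%:R - pot l.
Proof. by rewrite /dual_pot valK. Qed.

Let Wd (I J : word n N) := W br J (spec I u) u (dual_param lam P).
Let Wr (I J : word n N) := W br (sigma0_word J) (spec I u) (sigma0 u) P.

Lemma sigma0_word_partitions J : J \in partitions n lam ->
  sigma0_word J \in partitions n lam.
Proof.
rewrite !inE => /forallP hJ; apply/forallP => l; rewrite -(eqP (hJ l)); apply/eqP.
rewrite -(card_preimset _ (@rev_ord_inj n)); apply: eq_card => a.
by rewrite !inE ffunE /sigma0 rev_ordK.
Qed.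

Lemma Wd_direct I J : J \in partitions n lam ->
  Wd I J = direct br cumulative (spec I u) dual_pot J u.
Proof.
move=> hJ; rewrite /Wd (@W_partial_weight _ _ _ _ _ _ dual_pot _ cumulative) // => [j k|l].
  by rewrite /dual_param potE !dual_potE; ring.
exact: cumulativeE.
Qed.

Lemma Wr_reversed I J : J \in partitions n lam ->
  Wr I J = reversed br cumulative (spec I u) pot J u.
Proof.
move=> hJ; rewrite /Wr (@W_partial_weight _ _ _ _ _ _ pot _ cumulative) // => [|l].
  rewrite /reversed; congr partial_weight; apply/funext => a.
  by rewrite /colours /= ffunE.
exact/cumulativeE/sigma0_word_partitions.
Qed.

Lemma pot_generic (p q : 'I_N) (z : int) : p != q -> (`|z|%N <= n)%N ->
  br (pot p - pot q + z%:~R) != 0.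
Proof. by rewrite -potE; exact: P_generic. Qed.

Let mlE (J : word n N) (l : nat) : J \in partitions n lam -> (l < N)%N ->
  cumulative l = #|level (colours J) l|.
Proof. by move=> hJ _; exact: cumulativeE. Qed.

Let mlE' (J : word n N) (l : nat) : J \in partitions n lam -> (l < N)%N ->
  cumulative l = #|level (colours J \o @rev_ord n) l|.
Proof.
move=> hJ lN; rewrite (mlE hJ lN) -(card_preimset _ (@rev_ord_inj n)).
by apply: eq_card => a; rewrite !inE.
Qed.

Let rho : 'S_n := perm (@rev_ord_inj n).

Section Lowering.
Variables (I I' J : word n N) (g : 'S_n).
Hypotheses (hI : I \in partitions n lam) (hI' : I' \in partitions n lam)
  (hJ : J \in partitions n lam).

Lemma direct_lowering : direct br cumulative (spec I u) dual_pot J (u \o g) != 0 ->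
  forall l, (l < N)%N ->
  (position_sum [set a | g a \in upto I l]%SET <= position_sum (upto J l))%N
  /\ ((position_sum (upto J l) <= position_sum [set a | g a \in upto I l]%SET)%N ->
      upto J l = [set a | g a \in upto I l]%SET).
Proof.
move=> nz l lN; have := @partial_weight_lowering _ _ _ cumulative _ _ N u (@labels I hI) (colours J) br0
  (fun l a _ => spec_labels hI a) (fun l _ => @labels_inj I hI l)
  (fun l a _ => labels_nest hI a) (fun l => mlE hJ (l := l)) g
  (fun a => ltn_ord (J a)) nz l lN.
by rewrite occupied_labels.
Qed.

Lemma reversed_lowering : reversed br cumulative (spec I' u) pot J (u \o g) != 0 ->
  forall l, (l < N)%N ->
  (position_sum (mirror [set a | g a \in upto I' l]%SET) <= position_sum (mirror (upto J l)))%N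
  /\ ((position_sum (mirror (upto J l)) <= position_sum (mirror [set a | g a \in upto I' l]%SET))%N ->
      upto J l = [set a | g a \in upto I' l]%SET).
Proof.
move=> nz l lN.
have nz' : partial_weight br cumulative (spec I' u) pot N (colours J \o @rev_ord n)
    (u \o (rho * g)%g) != 0.
  move: nz; rewrite /reversed (_ : (u \o g) \o @rev_ord n = u \o (rho * g)%g) //.
  by apply/funext => a; rewrite /= permM permE.
have := @partial_weight_lowering _ _ _ cumulative _ _ N u (@labels I' hI')
  (colours J \o @rev_ord n) br0
  (fun l a _ => spec_labels hI' a) (fun l _ => @labels_inj I' hI' l)
  (fun l a _ => labels_nest hI' a) (fun l => mlE' hJ (l := l)) (rho * g)%g
  (fun a => ltn_ord (J _)) nz' l lN.
have -> : level (colours J \o @rev_ord n) l = mirror (upto J l).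
  by apply/setP => a; rewrite !inE.
have -> : occupied (labels hI') (rho * g)%g l = mirror [set a | g a \in upto I' l]%SET.
  by rewrite occupied_labels; apply/setP => a; rewrite !inE permM permE.
by case=> h1 h2; split=> // /h2 /(can_inj mirrorK).
Qed.

End Lowering.

Lemma set_perm1 (A : {set 'I_n}) : [set a | (1%g : 'S_n) a \in A]%SET = A.
Proof. by apply/setP => a; rewrite inE perm1. Qed.

Let gram (I I' : word n N) (y : 'I_n -> F) := \sum_(J in partitions n lam)
  direct br cumulative (spec I u) dual_pot J y * reversed br cumulative (spec I' u) pot J y.

(** The permutation acts on u as the top level variables, while the lower ones
    stay specialized at I and I'. *)
Lemma gram_perm I I' (g : 'S_n) : I \in partitions n lam -> I' \in partitions n lam ->
  gram I I' (u \o g) = gram I I' u.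
Proof.
move=> hI hI'; apply: (@paired_sum_perm _ br _ _ lam cumulative) => //.
- exact: spec_generic.
- exact: spec_generic.
- exact: pot_generic.
- exact: dual_potE.
Qed.

Lemma gram_neq0 I I' (g : 'S_n) : I \in partitions n lam -> I' \in partitions n lam ->
  gram I I' (u \o g) != 0 -> exists2 J, J \in partitions n lam &
    direct br cumulative (spec I u) dual_pot J (u \o g) != 0
    /\ reversed br cumulative (spec I' u) pot J (u \o g) != 0.
Proof.
move=> hI hI' nz.
have [J /andP[hJ] nzJ|none] := pickP (fun J => (J \in partitions n lam) &&
  (direct br cumulative (spec I u) dual_pot J (u \o g)
   * reversed br cumulative (spec I' u) pot J (u \o g) != 0)).
  by exists J => //; move: nzJ; rewrite mulf_eq0 negb_or => /andP[].
case/eqP: nz; rewrite /gram big1 // => J hJ; apply/eqP.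
by have := none J; rewrite hJ => /negbT; rewrite negbK.
Qed.

Let u_id : u \o (1%g : 'S_n) = u.
Proof. by apply/funext => a; rewrite /= perm1. Qed.

(** The first factor makes I^(l) smaller than J^(l), and the second one, whose
    positions are mirrored, makes I'^(l) larger. When the sums agree, both moves
    are trivial. *)
Lemma nonzero_term_sums I I' J : I \in partitions n lam -> I' \in partitions n lam ->
  J \in partitions n lam ->
  direct br cumulative (spec I u) dual_pot J u != 0 ->
  reversed br cumulative (spec I' u) pot J u != 0 ->
  (forall l, (l < N)%N -> position_sum (upto I l) <= position_sum (upto I' l))%N
  /\ ((forall l, (l < N)%N -> position_sum (upto I' l) <= position_sum (upto I l))%N ->
      I = J /\ I' = J).
Proof.
move=> hI hI' hJ nd nr.
have low l : (l < N)%N -> (position_sum (upto I l) <= position_sum (upto J l))%N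
    /\ ((position_sum (upto J l) <= position_sum (upto I l))%N -> upto J l = upto I l).
  move=> lN; have := @direct_lowering I J 1%g hI hJ; rewrite u_id => /(_ nd l lN).
  by rewrite set_perm1.
have high l : (l < N)%N -> (position_sum (upto J l) <= position_sum (upto I' l))%N
    /\ ((position_sum (upto I' l) <= position_sum (upto J l))%N -> upto J l = upto I' l).
  move=> lN; have := @reversed_lowering I' J 1%g hI' hJ; rewrite u_id => /(_ nr l lN).
  rewrite set_perm1; have := position_sum_mirror (upto J l); have := position_sum_mirror (upto I' l).
  rewrite -!cumulativeE // => wI wJ [h1 h2]; split; first by lia.
  by move=> h; apply: h2; lia.
split=> [l lN|h]; first by have [h1 _] := low l lN; have [h2 _] := high l lN; lia.
split; apply: word_eq => l lN; have [h1 h1'] := low l lN; have [h2 h2'] := high l lN;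
  have := h l lN => h3; apply/esym; [apply: h1'|apply: h2']; lia.
Qed.

(** At the reversed u, [direct_lowering] and [reversed_lowering] compare the mirror
    images of the sets, so that the inequalities are opposite to those of
    [nonzero_term_sums]; the value of [gram] is the same. *)
Lemma gram_neq0_sums I I' : I \in partitions n lam -> I' \in partitions n lam ->
  gram I I' u != 0 ->
  (forall l, (l < N)%N -> position_sum (upto I' l) <= position_sum (upto I l))%N.
Proof.
move=> hI hI' nz l lN; rewrite -(gram_perm rho hI hI') in nz.
have [J hJ [nd nr]] := gram_neq0 hI hI' nz.
have [h1 _] := direct_lowering hI hJ nd lN.
have [h2 _] := reversed_lowering hI' hJ nr lN.
have mir K : [set a | rho a \in upto K l]%SET = mirror (upto K l).
  by apply/setP => a; rewrite !inE permE.
rewrite !mir in h1 h2; rewrite mirrorK in h2.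
have := position_sum_mirror (upto J l); have := position_sum_mirror (upto I l).
by rewrite -!cumulativeE //; lia.
Qed.

Lemma gram_term I I' J : I \in partitions n lam -> I' \in partitions n lam ->
  J \in partitions n lam -> gram I I' u != 0 ->
  direct br cumulative (spec I u) dual_pot J u * reversed br cumulative (spec I' u) pot J u != 0 ->
  I = J /\ I' = J.
Proof.
move=> hI hI' hJ nz; rewrite mulf_eq0 negb_or => /andP[nd nr].
have [_] := nonzero_term_sums hI hI' hJ nd nr; apply.
exact: gram_neq0_sums.
Qed.

Lemma gram_offdiagonal I I' : I \in partitions n lam -> I' \in partitions n lam ->
  I != I' -> gram I I' u = 0.
Proof.
move=> hI hI' neq; apply/eqP; apply: contraNT neq => nz.
have := nz; rewrite -u_id => /(gram_neq0 hI hI')[J hJ]; rewrite u_id => -[nd nr].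
by have [-> ->] := gram_term hI hI' hJ nz (mulf_neq0 nd nr).
Qed.

(** The number of positions of any colour is at most n, and the potential
    lam - pot of the first family leaves the count of the positions that are not
    on the right of a. *)
Lemma shifted_generic (J : word n N) a (l : 'I_N) : J \in partitions n lam -> J a != l ->
  br (shifted dual_pot (colours J) a (J a) - shifted dual_pot (colours J) a l) != 0
  /\ br (shifted pot (colours J \o @rev_ord n) (rev_ord a) (J a)
         - shifted pot (colours J \o @rev_ord n) (rev_ord a) l) != 0.
Proof.
move=> hJ neq.
have le_n (A : {set 'I_n}) : (#|A| <= n)%N by rewrite -[X in (_ <= X)%N](card_ord n) max_card.
split; last first.
  rewrite /shifted; set x := #|_|; set z := #|_|.
  have -> : pot (J a) - x%:R - (pot l - z%:R) = pot (J a) - pot l + (z%:Z - x%:Z)%:~R.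
    by ring.
  apply: pot_generic => //; have := le_n [set b : 'I_n | (rev_ord a < b)%N & (colours J \o @rev_ord n) b == J a]%SET.
  have := le_n [set b : 'I_n | (rev_ord a < b)%N & (colours J \o @rev_ord n) b == l]%SET.
  by rewrite -/x -/z; lia.
rewrite /shifted !dual_potE.
have cnt (k : 'I_N) : exists2 x, (x <= n)%N &
    lam k = (x + #|[set b : 'I_n | (a < b)%N & colours J b == k]|)%N.
  exists #|[set b : 'I_n | (b <= a)%N & colours J b == k]%SET|; first exact: le_n.
  rewrite (lam_count hJ) -(cardsID [set b : 'I_n | (b <= a)%N]%SET); congr (_ + _)%N.
    by apply: eq_card => b; rewrite !inE andbC.
  by apply: eq_card => b; rewrite !inE -ltnNge.
have [x xn ->] := cnt (J a); have [z zn ->] := cnt l.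
set A := #|_|; set B := #|_|.
have -> : (x + A)%:R - pot (J a) - A%:R - ((z + B)%:R - pot l - B%:R)
    = pot l - pot (J a) + (x%:Z - z%:Z)%:~R :> F by ring.
by apply: pot_generic; [rewrite eq_sym|lia].
Qed.

Lemma diagonal_term J : J \in partitions n lam ->
  direct br cumulative (spec J u) dual_pot J u * reversed br cumulative (spec J u) pot J u
  = Qfactor br J u * Rfactor br J u * Sfactor br J u ^+ 2.
Proof.
move=> hJ.
have lvl l : (l < N)%N -> level (colours J) l = occupied (labels hJ) (1%g : 'S_n) l.
  by move=> _; rewrite occupied_labels set_perm1.
have lvl' l : (l < N)%N -> level (colours J \o @rev_ord n) l = occupied (labels hJ) rho l.
  by move=> _; rewrite occupied_labels; apply/setP => a; rewrite !inE permE.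
have := @partial_weight_diagonal _ br _ cumulative _ dual_pot N u (@labels J hJ) (colours J) br0
  (fun l a _ => spec_labels hJ a) (fun l _ => @labels_inj J hJ l)
  (fun l => mlE hJ (l := l)) 1%g lvl N (leqnn N).
have := @partial_weight_diagonal _ br _ cumulative _ pot N u (@labels J hJ) (colours J \o @rev_ord n) br0
  (fun l a _ => spec_labels hJ a) (fun l _ => @labels_inj J hJ l)
  (fun l => mlE' hJ (l := l)) rho lvl' N (leqnn N).
have urho : u \o rho = u \o @rev_ord n by apply/funext => a; rewrite /= permE.
rewrite u_id urho /direct /reversed => -> ->.
rewrite /Qfactor /Rfactor Sfactor_levels !prod_levels expr2 -!big_split /=.
apply: eq_bigr => l _; rewrite -expr2 -layer_pair_product; congr (_ * _).
  apply: layer_diag => [a al|a b ab]; last by apply: u_generic; rewrite eq_sym.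
  have [|h _] := @shifted_generic J a l hJ; last exact: h.
  by rewrite -val_eqE /= ltn_eqF.
rewrite layer_diag => [|a al|a b ab]; last first.
- by apply: u_generic; rewrite (inj_eq rev_ord_inj) eq_sym.
- have [|_ h] := @shifted_generic J (rev_ord a) l hJ; last by rewrite rev_ordK in h; exact: h.
  by rewrite -val_eqE /= ltn_eqF.
rewrite (reindex_inj rev_ord_inj) /=; apply: eq_big => a; rewrite /= rev_ordK // => al.
congr (_ * _); rewrite (reindex_inj rev_ord_inj) /=.
  by apply: eq_big => b; rewrite /= rev_ordK.
apply: eq_big => b; rewrite /= ?rev_ordK // => _.
have -> : (n - a.+1 < n - b.+1)%N = (b < a)%N.
  by have := ltn_ord a; have := ltn_ord b; lia.
by [].
Qed.

Lemma Wd_Wr_gram I I' : I \in partitions n lam -> I' \in partitions n lam ->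
  \sum_(J in partitions n lam) Wd I J * Wr I' J =
  (I == I')%:R * (Qfactor br I u * Rfactor br I u * Sfactor br I u ^+ 2).
Proof.
move=> hI hI'.
have -> : \sum_(J in partitions n lam) Wd I J * Wr I' J = gram I I' u.
  by apply: eq_bigr => J hJ; rewrite Wd_direct // Wr_reversed.
have [<-|neq] := eqVneq I I'; last by rewrite mul0r gram_offdiagonal.
rewrite mul1r -diagonal_term //.
rewrite /gram (bigD1 I) //= big1 ?addr0 // => J /andP[hJ JI].
apply/eqP; apply: contraNT JI; rewrite mulf_eq0 negb_or => /andP[nd nr].
by have [_ /(_ (fun l _ => leqnn _)) [<-]] := nonzero_term_sums hI hI hJ nd nr.
Qed.

Lemma norm_neq0 (I : word n N) : Qfactor br I u * Rfactor br I u * Sfactor br I u ^+ 2 != 0.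
Proof.
have pn (T : finType) (A : pred T) (f : T -> F) : (forall a, A a -> f a != 0) ->
    \prod_(a | A a) f a != 0.
  by move=> h; apply/prodf_neq0.
rewrite Sfactor_levels; apply: mulf_neq0; [apply: mulf_neq0|apply: expf_neq0].
- by do 2![apply: (pn _ _) => ? ?]; do 2![apply: (pn _ _) => ? ?]; exact: u_generic1.
- apply: (pn _ _) => k _; apply: (pn _ _) => l kl.
  apply: (pn _ _) => a; rewrite inE => /eqP ak; apply: (pn _ _) => b; rewrite inE => /eqP bl.
  apply: u_generic; apply/eqP => ba; move: kl.
  by rewrite -ak -bl ba ltnn.
- by do 3![apply: (pn _ _) => ? ?]; exact: u_generic1.
Qed.

(** [Wd_Wr_gram] says that A and B below satisfy A *m B = 1, and the sum over I is
    an entry of B *m A. *)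
Lemma orthogonality J K : J \in partitions n lam -> K \in partitions n lam ->
  \sum_(I in partitions n lam)
     W br J (spec I u) u (dual_param lam P) * W br (sigma0_word K) (spec I u) (sigma0 u) P
     / (Qfactor br I u * Rfactor br I u * Sfactor br I u ^+ 2)
  = (J == K)%:R.
Proof.
move=> hJ hK.
pose E (i : 'I_#|partitions n lam|) : word n N := enum_val i.
have EP i : E i \in partitions n lam by exact: enum_valP.
pose norm (I : word n N) := Qfactor br I u * Rfactor br I u * Sfactor br I u ^+ 2.
pose A := \matrix_(i, j) Wd (E i) (E j).
pose B := \matrix_(j, i) (Wr (E i) (E j) / norm (E i)).
have AB : A *m B = 1%:M.
  apply/matrixP => i i'; rewrite !mxE.
  under eq_bigr do rewrite !mxE mulrA.
  rewrite -mulr_suml -(big_enum_val (fun J => Wd (E i) J * Wr (E i') J)) /=.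
  rewrite Wd_Wr_gram // (inj_eq enum_val_inj).
  by have [->|_] := eqVneq i i'; rewrite ?mul0r // mul1r divff // norm_neq0.
have := congr1 (fun M : 'M[F]_#|partitions n lam| =>
  M (enum_rank_in hK K) (enum_rank_in hJ J)) (mulmx1C AB).
rewrite !mxE -(inj_eq enum_val_inj) !enum_rankK_in // eq_sym => <-.
rewrite big_enum_val; apply: eq_bigr => i _; rewrite !mxE /E !enum_rankK_in //.
by rewrite /norm /Wd /Wr; ring.
Qed.

End Orthogonality.

(** * The finite triple product and the splitting by parity *)

(** k (k - 1) / 2, for negative k too. *)
Definition tri (k : int) : nat :=
  match k with Posz m => 'C(m, 2) | Negz m => 'C(m.+2, 2) end.

Lemma tri2 k : 2 * (tri k)%:Z = k * (k - 1).
Proof.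
have bin2 m : (2 * 'C(m.+1, 2) = m.+1 * m)%N by rewrite -mul_bin_diag bin1.
case: k => m /=; last first.
  by rewrite NegzE -PoszM bin2; lia.
case: m => [|m]; first by rewrite mul0r.
by rewrite -PoszM bin2; lia.
Qed.

Arguments tri : simpl never.

Definition symrange M : seq int := [seq (Posz j) - (Posz M) | j <- iota 0 (M + M).+1].

(** The pairs of integers with even sum, in rotated coordinates; [odd_index] gives
    those with odd sum. The shifts by 1 make the same two series, [even_sum] and
    [odd_sum], appear in both classes. *)
Definition even_index (t : int * int) : int * int := (t.1 + 1 + t.2, t.1 + 1 - t.2).
Definition odd_index (t : int * int) : int * int := (t.1 + t.2 + 1, t.1 - t.2).

Definition square M : seq (int * int) := [seq (m, k) | m <- symrange M, k <- symrange M].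
Definition rotated_square M := map even_index (square M) ++ map odd_index (square M).

Lemma mem_symrange M k : (k \in symrange M) = (`|k| <= Posz M).
Proof.
apply/mapP/idP => [[j]|h]; first by rewrite mem_iota => /andP[_ h] ->; lia.
by exists (absz (k + Posz M)%R); [rewrite mem_iota|]; lia.
Qed.

Lemma symrange_uniq M : uniq (symrange M).
Proof. by rewrite map_inj_uniq ?iota_uniq // => a b; lia. Qed.

Lemma mem_square M (t : int * int) :
  (t \in square M) = (`|t.1| <= Posz M) && (`|t.2| <= Posz M).
Proof.
rewrite -!mem_symrange; apply/allpairsP/andP => [[[m k] /= [hm hk ->]]|[hm hk]] //.
by exists t; split=> //; case: t {hm hk}.
Qed.

Lemma square_uniq M : uniq (square M).
Proof. by apply: allpairs_uniq; rewrite ?symrange_uniq // => -[? ?] []. Qed.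

Lemma rotated_square_uniq M : uniq (rotated_square M).
Proof.
rewrite /rotated_square cat_uniq !map_inj_uniq ?square_uniq ?andbT ?andTb.
- apply/hasPn => _ /mapP[[a b] _ ->]; apply/negP => /mapP[[c d] _ []]; lia.
- by move=> [a b] [c d] [] /= h1 h2; congr (_, _); lia.
- by move=> [a b] [c d] [] /= h1 h2; congr (_, _); lia.
Qed.

(** With [rotated_square_sup], this makes squares and rotated squares two cofinal
    exhaustions of the plane, over which an absolutely convergent series has the
    same sum. *)
Lemma rotated_square_sub M t : t \in rotated_square M -> t \in square (M + M).+1.
Proof.
rewrite mem_cat !mem_square => /orP[] /mapP[[a b]]; rewrite mem_square /= => /andP[] ? ? -> /=; lia.
Qed.

Lemma rotated_square_sup M t : t \in square M -> t \in rotated_square M.+1.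
Proof.
case: t => m k; rewrite mem_square => /andP.
rewrite -[(m, k).1]/m -[(m, k).2]/k => -[hm hk]; rewrite mem_cat.
have := divz_eq (m + k) 2; have := @modz_ge0 (m + k) 2 isT; have := @ltz_pmod (m + k) 2 isT.
move: ((m + k) %/ 2)%Z ((m + k) %% 2)%Z => q r r2 r0 e; apply/orP.
have [r_eq|r_eq] : r = 0 \/ r = 1 by lia.
- left; apply/mapP; exists (q - 1, m - q); first by rewrite mem_square /=; lia.
  by rewrite /even_index /=; congr (_, _); lia.
- right; apply/mapP; exists (q, m - q - 1); first by rewrite mem_square /=; lia.
  by rewrite /odd_index /=; congr (_, _); lia.
Qed.

Section TripleProduct.
Variables (K : fieldType) (p : K).
Hypothesis p_neq0 : p != 0.
Hypothesis p_root : forall k, p ^+ k.+1 != 1.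

Definition poch m x := \prod_(k < m) (1 - x * p ^+ k).

Lemma pochS m x : poch m.+1 x = poch m x * (1 - x * p ^+ m).
Proof. by rewrite /poch big_ord_recr. Qed.

Lemma poch_neq0 m : poch m p != 0.
Proof. by apply/prodf_neq0 => k _; rewrite -exprS subr_eq0 eq_sym. Qed.

Definition qbinom m j := poch m p / (poch j p * poch (m - j) p).

Lemma qbinom0 m : qbinom m 0 = 1.
Proof. by rewrite /qbinom subn0 /poch big_ord0 mul1r divff // -/(poch m p) poch_neq0. Qed.

Lemma qbinomn m : qbinom m m = 1.
Proof. by rewrite /qbinom subnn {3}/poch big_ord0 mulr1 divff ?poch_neq0. Qed.

Lemma qbinomS m j : (j < m)%N ->
  qbinom m.+1 j.+1 = qbinom m j.+1 + p ^+ (m - j) * qbinom m j.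
Proof.
move=> jm; rewrite /qbinom subSS.
have -> : (m - j = (m - j.+1).+1)%N by lia.
rewrite !pochS -!exprS.
have -> : p ^+ m.+1 = p ^+ (m - j.+1).+1 * p ^+ j.+1 by rewrite -exprD; congr (_ ^+ _); lia.
have nz k : 1 - p ^+ k.+1 != 0 by rewrite subr_eq0 eq_sym.
have := nz j; have := nz (m - j.+1)%N.
have := poch_neq0 j; have := poch_neq0 (m - j.+1).
move: (poch j p) (poch (m - j.+1) p) (poch m p) (p ^+ j.+1) (p ^+ (m - j.+1).+1).
by move=> A B C x y A0 B0 x0 y0; field; rewrite A0 B0 x0 y0.
Qed.

Lemma qbinomial m x :
  \prod_(k < m) (1 + x * p ^+ k) = \sum_(j < m.+1) p ^+ 'C(j, 2) * qbinom m j * x ^+ j.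
Proof.
elim: m => [|m IH].
  by rewrite big_ord0 big_ord1 qbinom0 !mulr1.
rewrite big_ord_recr IH /= mulrDr mulr1 big_distrl /=.
rewrite [X in X + _]big_ord_recl [X in _ + X]big_ord_recr /=.
rewrite [RHS]big_ord_recl [X in _ = _ + X]big_ord_recr /= !qbinom0 !qbinomn.
rewrite -!addrA; congr (_ + _); rewrite addrA -big_split /=; congr (_ + _).
  apply: eq_bigr => j _; rewrite /bump /= !add1n qbinomS // binS bin1.
  have -> : p ^+ m = p ^+ (m - j) * p ^+ j by rewrite -exprD subnK // ltnW.
  rewrite exprD !exprSr; ring.
by rewrite /bump /= !add1n binS bin1 exprD exprSr; ring.
Qed.

(** The q-binomial coefficient of 2M over M + k, centred at k = 0. *)
Definition central_qbinom (M : nat) (k : int) : K := poch (M + M) p / (poch (absz (Posz M + k)%R) p * poch (absz (Posz M - k)%R) p).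

(** The q-binomial theorem with 2M factors, for the argument - z p^(-M): the last M
    factors form the product at z and the first M factors, up to a monomial, the
    one at p / z. *)
Lemma finite_triple_product M z : z != 0 ->
  poch M z * poch M (p / z) = \sum_(k <- symrange M) p ^+ tri k * (- z) ^ k * central_qbinom M k.
Proof.
move=> z0; have mz0 : - z != 0 by rewrite oppr_eq0.
rewrite big_map -[X in iota 0 X]subn0 -/(index_iota 0 _) big_mkord.
have pz k : p ^ k != 0 by exact: expfz_neq0.
have := qbinomial (M + M) (- z * p ^ (- Posz M)).
rewrite big_split_ord /= (reindex_inj rev_ord_inj) /=.
set C := (- z) ^ Posz M * p ^ (- (tri (Posz M + 1))%:Z).
have C0 : C != 0 by rewrite mulf_neq0 ?expfz_neq0.
have -> : \prod_(k < M) (1 + - z * p ^ (- Posz M) * p ^+ (M - k.+1)) = C * poch M (p / z).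
  transitivity (\prod_(k < M) ((- z * p ^ (- (k.+1)%:Z)) * (1 - p / z * p ^+ k))).
    apply: eq_bigr => k _.
    have -> : - z * p ^ (- Posz M) * p ^+ (M - k.+1) = - z * p ^ (- (k.+1)%:Z).
      by rewrite -mulrA exprnP -expfzDr //; congr (_ * p ^ _); have := ltn_ord k; lia.
    have -> : 1 - p / z * p ^+ k = 1 - p ^ (k.+1)%:Z / z.
      by rewrite -exprnP exprS mulrAC.
    rewrite -exprnN -exprnP; have := expf_neq0 k.+1 p_neq0.
    by move: (p ^+ k.+1) => b b0; field; rewrite b0 z0.
  rewrite big_split /=; congr (_ * _); rewrite /C; elim: {+}M => [|m IH].
    by rewrite big_ord0 (_ : tri (Posz 0 + 1) = 0%N) // oppr0 !expr0z mulr1.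
  rewrite big_ord_recr /= IH.
  have -> : Posz m.+1 = Posz m + 1 by lia.
  rewrite !expfzDr // expr1z mulrACA; congr (_ * _); rewrite -expfzDr //; congr (p ^ _).
  by have := tri2 (Posz m + 1); have := tri2 (Posz m + 1 + 1); lia.
have -> : \prod_(k < M) (1 + - z * p ^ (- Posz M) * p ^+ (M + k)) = poch M z.
  apply: eq_bigr => k _; rewrite -mulrA exprnP -expfzDr // PoszD addKr.
  by rewrite mulNr.
move=> h; apply: (mulfI C0); rewrite [poch M z * _]mulrC mulrA h mulr_sumr.
apply: eq_bigr => j _; have jM := ltn_ord j.
rewrite /central_qbinom.
have -> : absz (Posz M + (Posz j - Posz M))%R = j by lia.
have -> : absz (Posz M - (Posz j - Posz M))%R = (M + M - j)%N by lia.
rewrite -/(qbinom _ _) [RHS]mulrA mulrAC; congr (_ * _).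
rewrite /C exprMn !exprnP exprz_exp -!mulrA.
rewrite [RHS]mulrCA [p ^ (Posz (tri _)) * _]mulrC [p ^ (- _) * _]mulrC -!mulrA -expfzDr //.
rewrite [LHS]mulrCA -expfzDr // [RHS]mulrA -expfzDr //.
congr ((- z) ^ _ * p ^ _); first by lia.
have := tri2 (Posz M + 1); have := tri2 (Posz j - Posz M); have := tri2 (Posz j).
by rewrite [tri (Posz j)]/tri; lia.
Qed.

Definition theta_term z (k : int) := p ^+ tri k * (- z) ^ k.

Definition even_sum (M : nat) X := \sum_(k <- symrange M) p ^+ absz (k * k)%R * X ^ (2 * k).
Definition odd_sum (M : nat) X :=
  \sum_(k <- symrange M) p ^+ absz (k * (k + 1))%R * X ^ (2 * k + 1).

Definition plane_term X Z (t : int * int) := theta_term (X * Z) t.1 * theta_term (X / Z) t.2.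

Lemma plane_termE X Z m k : X != 0 -> Z != 0 ->
  plane_term X Z (m, k) = p ^+ (tri m + tri k) * (- X) ^ (m + k) * Z ^ (m - k).
Proof.
move=> X0 Z0; have mX0 : - X != 0 by rewrite oppr_eq0.
rewrite /plane_term /theta_term /= -!mulNr !expfzMl exprz_inv exprD !expfzDr //.
ring.
Qed.

Lemma expfz_even (X : K) (d : int) : (- X) ^ (2 * d) = X ^ (2 * d).
Proof. by rewrite -!exprz_exp -!exprnP sqrrN. Qed.

Lemma plane_even X Z t : X != 0 -> Z != 0 -> plane_term X Z (even_index t) =
  X * ((p ^+ absz (t.1 * (t.1 + 1))%R * X ^ (2 * t.1 + 1))
     * (p ^+ absz (t.2 * t.2)%R * Z ^ (2 * t.2))).
Proof.
case: t => d e X0 Z0; rewrite plane_termE //=.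
have -> : (tri (d + 1 + e) + tri (d + 1 - e) = absz (d * (d + 1))%R + absz (e * e)%R)%N.
  by have := tri2 (d + 1 + e); have := tri2 (d + 1 - e); nia.
have -> : d + 1 + e + (d + 1 - e) = 2 * (d + 1) by ring.
have -> : d + 1 + e - (d + 1 - e) = 2 * e by ring.
rewrite expfz_even exprD.
have -> : 2 * (d + 1) = 1 + (2 * d + 1) by ring.
by rewrite [X ^ (1 + _)]expfzDr // expr1z; ring.
Qed.

Lemma plane_odd X Z t : X != 0 -> Z != 0 -> plane_term X Z (odd_index t) =
  - (X * ((p ^+ absz (t.1 * t.1)%R * X ^ (2 * t.1))
     * (p ^+ absz (t.2 * (t.2 + 1))%R * Z ^ (2 * t.2 + 1)))).
Proof.
case: t => d e X0 Z0; rewrite plane_termE //=.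
have mX0 : - X != 0 by rewrite oppr_eq0.
have -> : (tri (d + e + 1) + tri (d - e) = absz (d * d)%R + absz (e * (e + 1))%R)%N.
  by have := tri2 (d + e + 1); have := tri2 (d - e); nia.
have -> : d + e + 1 + (d - e) = 1 + 2 * d by ring.
have -> : d + e + 1 - (d - e) = 2 * e + 1 by ring.
by rewrite [(- X) ^ _]expfzDr // expr1z expfz_even exprD; ring.
Qed.

(** On each parity class the exponents of p, X and Z split as sums over the two
    rotated coordinates, so that each class gives a product of two sums. *)
Lemma rotated_square_sum M X Z : X != 0 -> Z != 0 ->
  \sum_(t <- rotated_square M) plane_term X Z t
  = X * (odd_sum M X * even_sum M Z - even_sum M X * odd_sum M Z).
Proof.
move=> X0 Z0; rewrite big_cat !big_map /=.
rewrite mulrBr; congr (_ + _).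
  rewrite (eq_bigr _ (fun t _ => plane_even t X0 Z0)) -mulr_sumr; congr (_ * _).
  by rewrite /odd_sum /even_sum big_distrlr /= big_allpairs.
rewrite (eq_bigr _ (fun t _ => plane_odd t X0 Z0)) sumrN -mulr_sumr; congr (- (_ * _)).
by rewrite /odd_sum /even_sum big_distrlr /= big_allpairs.
Qed.

End TripleProduct.

(** * Limits of infinite products and of double series *)

Import numFieldNormedType.Exports.
Local Open Scope complex_scope.
Local Open Scope classical_set_scope.

Section ComplexLimits.
Variable R : realType.
Implicit Types (u v : nat -> R[i]^o) (z l : R[i]).

Lemma complex_cvgP u l : u @ \oo --> (l : R[i]^o) <->
  forall e, 0 < e -> exists M0, forall M, (M0 <= M)%N -> `|u M - l| <= e.
Proof.
split=> [/cvgrPdist_le h e e0|h].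
  have [M0 _ hM] := h e e0; exists M0 => M le; rewrite distrC; exact: hM.
apply/cvgrPdist_le => e e0; have [M0 hM] := h e e0.
by exists M0 => // M le; rewrite /= distrC; exact: hM.
Qed.

Lemma pos_complex (e : R[i]) : 0 < e -> exists2 d : R, 0 < d & e = d%:C.
Proof.
rewrite ltcE => /andP[/eqP im re]; exists (complex.Re e) => //.
by case: e im re => a b /= -> _.
Qed.

Lemma normc_le_ReIm z : `|z| <= (`|complex.Re z| + `|complex.Im z|)%:C.
Proof.
case: z => a b /=; have -> : a +i* b = (a +i* 0) + (0 +i* b) by rewrite /= /GRing.add /= addr0 add0r.
apply: le_trans (ler_normD _ _) _.
by rewrite rmorphD /= !normc_def /= !expr0n /= addr0 add0r !sqrtr_sqr.
Qed.

(** The real and the imaginary part are series dominated by a geometric one. *)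
Lemma complex_geometric_cvg u (E r : R) : 0 <= r -> r < 1 ->
  (forall m, `|u m.+1 - u m| <= (E * r ^+ m)%:C) -> exists l, u @ \oo --> (l : R[i]^o).
Proof.
move=> r0 r1 hu.
have real_cvg (v : nat -> R) : (forall m, `|v m.+1 - v m| <= E * r ^+ m) -> cvgn v.
  move=> hv.
  have -> : v = (fun n => v 0%N + series (telescope v) n) by apply/funext => n; exact: eq_sum_telescope.
  apply: is_cvgD; first exact: is_cvg_cst.
  apply: (@normed_cvg R R^o).
  apply: (@series_le_cvg R _ (geometric E r)) => [n|n|n|] //=.
  - exact: le_trans (hv n).
  - exact: hv.
  - by apply: is_cvg_geometric_series; rewrite ger0_norm.
have reb m : `|complex.Re (u m.+1) - complex.Re (u m)| <= E * r ^+ m.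
  have := le_trans (normc_ge_Re _) (hu m); rewrite lecE /= => /andP[_].
  by case: (u m.+1) (u m) => [a b] [c d].
have imb m : `|complex.Im (u m.+1) - complex.Im (u m)| <= E * r ^+ m.
  have h : `|complex.Im (u m.+1 - u m)|%:C <= `|u m.+1 - u m|.
    have := normc_ge_Re (- 'i%C * (u m.+1 - u m)).
    rewrite normrM normrN normc_def /= expr0n expr1n add0r sqrtr1 mul1r.
    by case: (u m.+1 - u m) => a b /=; rewrite oppr0 mul0r sub0r mulN1r opprK.
  have := le_trans h (hu m); rewrite lecE /= => /andP[_].
  by case: (u m.+1) (u m) => [a b] [c d].
have /cvg_ex[a /cvgrPdist_le ha] := real_cvg _ reb.
have /cvg_ex[b /cvgrPdist_le hb] := real_cvg _ imb.
exists (a +i* b); apply/complex_cvgP => e /pos_complex[d d0 ->].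
have d20 : 0 < d / 2 by rewrite divr_gt0.
have [Ma _ hMa] := ha _ d20; have [Mb _ hMb] := hb _ d20.
exists (maxn Ma Mb) => M; rewrite geq_max => /andP[leA leB].
apply: le_trans (normc_le_ReIm _) _; rewrite lecR [d]splitr.
have := hMa M leA; have := hMb M leB; rewrite /= => h1 h2.
rewrite -(normrN (complex.Re _)) -(normrN (complex.Im _)).
by apply: lerD; [move: h2|move: h1]; case: (u M) => x y /=; rewrite opprB.
Qed.

Lemma complex_cauchy_sum (beta : nat -> R[i]) (C : R[i]) :
  (forall k, 0 <= beta k) -> (forall k l : nat, (k <= l)%N -> beta k <= beta l) ->
  (forall k, beta k <= C) ->
  forall e, 0 < e -> exists k : nat, forall l : nat, (k <= l)%N -> beta l <= beta k + e.
Proof.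
move=> b0 bm bC e /pos_complex[d d0 ->].
have real k : beta k = (complex.Re (beta k))%:C.
  by have := b0 k; rewrite lecE /= => /andP[/eqP]; case: (beta k) => x y /= -> _.
pose S := range (fun k => complex.Re (beta k)).
have Sub : has_sup S.
  split; first by exists (complex.Re (beta 0%N)); exists 0%N.
  exists (complex.Re C) => _ [k _ <-]; have := bC k.
  by rewrite lecE => /andP[_].
have [_ [k _ <-] hk] := sup_adherent d0 Sub.
exists k => l kl; rewrite (real l) (real k) -rmorphD /= lecR.
have : complex.Re (beta l) <= sup S by apply: sup_ubound; [case: Sub|exists l].
by move=> h; apply: le_trans h _; rewrite -lerBlDr ltW.
Qed.

Lemma cvg_subsequence u l (kappa : nat -> nat) :
  u @ \oo --> (l : R[i]^o) ->
  (forall M0, exists M1, forall M, (M1 <= M)%N -> (M0 <= kappa M)%N) ->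
  (u \o kappa : nat -> R[i]^o) @ \oo --> (l : R[i]^o).
Proof.
move=> /complex_cvgP h hk; apply/complex_cvgP => e e0.
have [M0 hM0] := h e e0; have [M1 hM1] := hk M0.
by exists M1 => M le; apply: hM0; exact: hM1.
Qed.

Lemma sum_subset (T : eqType) (s1 s2 : seq T) (f : T -> R[i]) :
  uniq s1 -> uniq s2 -> {subset s1 <= s2} ->
  \sum_(t <- s2) f t = \sum_(t <- s1) f t + \sum_(t <- s2 | t \notin s1) f t.
Proof.
move=> u1 u2 sub; rewrite (bigID (mem s1)) /=; congr (_ + _).
rewrite -big_filter; apply: perm_big; apply: uniq_perm => //.
  exact: filter_uniq.
by move=> t; rewrite mem_filter; case: (boolP (t \in s1)) => //= /sub ->.
Qed.

Lemma square_mono k k' : (k <= k')%N -> {subset square k <= square k'}.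
Proof. by move=> kk t; rewrite !mem_square; lia. Qed.

Lemma small_on_square (phi : nat -> int * int -> R[i]) (e : R[i]) (s : seq (int * int)) :
  0 < e -> (forall t, (phi ^~ t : nat -> R[i]^o) @ \oo --> (0 : R[i]^o)) ->
  exists M0, forall M, (M0 <= M)%N -> forall t, t \in s -> `|phi M t| <= e.
Proof.
move=> e0 h; elim: s => [|t s [M0 IH]]; first by exists 0%N.
have /complex_cvgP/(_ e e0)[M1 hM1] := h t.
exists (maxn M0 M1) => M; rewrite geq_max => /andP[le0 le1] t'.
by rewrite inE => /orP[/eqP ->|]; [have := hM1 M le1; rewrite subr0|exact: IH].
Qed.

(** The partial sums of b over squares are Cauchy in absolute value, so the terms
    outside a fixed square are negligible uniformly in M; inside it there are
    finitely many. *)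
Lemma dominated_square_sum (b : int * int -> R[i]) (phi : nat -> int * int -> R[i])
    (kappa : nat -> nat) (C D : R[i]) :
  (forall k, \sum_(t <- square k) `|b t| <= C) -> 0 < D ->
  (forall M t, `|phi M t| <= D) ->
  (forall t, (phi ^~ t : nat -> R[i]^o) @ \oo --> (0 : R[i]^o)) ->
  ((fun M => \sum_(t <- square (kappa M)) phi M t * b t) : nat -> R[i]^o) @ \oo
    --> (0 : R[i]^o).
Proof.
move=> bC D0 phiD phi0; apply/complex_cvgP => e e0.
pose beta k := \sum_(t <- square k) `|b t|.
have beta0 k : 0 <= beta k by exact: sumr_ge0.
have beta_mono (k k' : nat) : (k <= k')%N -> beta k <= beta k'.
  move=> kk; rewrite /beta (sum_subset _ (square_uniq k) (square_uniq k') (square_mono kk)).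
  by rewrite lerDl sumr_ge0.
have C0 : 0 <= C by exact: le_trans (beta0 0%N) (bC 0%N).
have e1 : 0 < e / 2 / D by rewrite !divr_gt0.
have [k hk] := complex_cauchy_sum beta0 beta_mono bC e1.
have e2 : 0 < e / 2 / (C + 1) by rewrite !divr_gt0 // ltr_wpDl.
have [M0 hM0] := small_on_square (square k) e2 phi0.
exists M0 => M le; rewrite subr0.
apply: le_trans (ler_norm_sum _ _ _) _.
pose k' := maxn k (kappa M).
apply: le_trans (_ : \sum_(t <- square k') `|phi M t * b t| <= _).
  rewrite [leRHS](sum_subset _ (square_uniq (kappa M)) (square_uniq k')).
    by rewrite lerDl sumr_ge0.
  by apply: square_mono; exact: leq_maxr.
rewrite (sum_subset _ (square_uniq k) (square_uniq k') (square_mono (leq_maxl _ _))).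
rewrite [e]splitr; apply: lerD.
  apply: le_trans (_ : e / 2 / (C + 1) * beta k <= _).
    rewrite /beta mulr_sumr big_seq [leRHS]big_seq; apply: ler_sum => t tk.
    by rewrite normrM ler_wpM2r // hM0.
  rewrite -mulrA ger_pMr ?divr_gt0 // mulrC ler_pdivrMr ?ltr_wpDl // mul1r.
  by apply: le_trans (bC k) _; rewrite lerDl.
apply: le_trans (_ : D * \sum_(t <- square k' | t \notin square k) `|b t| <= _).
  by rewrite mulr_sumr; apply: ler_sum => t _; rewrite normrM ler_wpM2r.
rewrite mulrC -ler_pdivlMr //.
have := hk k' (leq_maxl _ _).
by rewrite {1}/beta (sum_subset _ (square_uniq k) (square_uniq k') (square_mono (leq_maxl _ _))) lerD2l.
Qed.

End ComplexLimits.

Section ThetaLimits.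
Variables (R : realType) (p : R[i]).
Hypotheses (p_neq0 : p != 0) (p_lt1 : `|p| < 1).

(** 1 + t <= exp t reduces the product to a geometric series. *)
Lemma geometric_prod_le (x r : R) m : 0 <= x -> 0 <= r -> r < 1 ->
  \prod_(k < m) (1 + x * r ^+ k) <= expR (x / (1 - r)).
Proof.
move=> x0 r0 r1.
have sum_le : \sum_(k < m) r ^+ k <= (1 - r)^-1.
  rewrite -[X in _ <= X]mul1r ler_pdivlMr ?subr_gt0 //.
  have -> : (\sum_(k < m) r ^+ k) * (1 - r) = 1 - r ^+ m.
    by rewrite -[RHS]opprB subrX1 -mulNr opprB mulrC.
  by rewrite gerBl exprn_ge0.
apply: le_trans (_ : \prod_(k < m) expR (x * r ^+ k) <= _).
  apply: ler_prod => k _; rewrite expR_ge1Dx andbT.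
  by rewrite addr_ge0 // mulr_ge0 // exprn_ge0.
by rewrite -expR_sum ler_expR -mulr_sumr ler_wpM2l.
Qed.

Lemma prod_bound (x : R[i]) : exists2 E : R[i], 0 < E &
  forall m, \prod_(k < m) (1 + `|x| * `|p| ^+ k) <= E.
Proof.
pose a := complex.Re `|x|; pose r := complex.Re `|p|.
have ea : `|x| = a%:C by rewrite /a normc_def.
have er : `|p| = r%:C by rewrite /r normc_def.
exists (expR (a / (1 - r)))%:C; first by rewrite ltcR expR_gt0.
move=> m.
have -> : \prod_(k < m) (1 + `|x| * `|p| ^+ k) = (\prod_(k < m) (1 + a * r ^+ k))%:C.
  by rewrite rmorph_prod; apply: eq_bigr => k _; rewrite rmorphD rmorphM rmorphXn ea er.
rewrite lecR; apply: geometric_prod_le.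
- by rewrite -lecR -ea; exact: normr_ge0.
- by rewrite -lecR -er; exact: normr_ge0.
- by rewrite -ltcR -er; exact: p_lt1.
Qed.

Lemma p_root k : p ^+ k.+1 != 1.
Proof.
apply/eqP => h; have : `|p| ^+ k.+1 < 1 by rewrite exprn_ilt1.
by rewrite -normrX h normr1 ltxx.
Qed.

Lemma poch_norm_le m (x : R[i]) : `|poch p m x| <= \prod_(k < m) (1 + `|x| * `|p| ^+ k).
Proof.
rewrite /poch normr_prod; apply: ler_prod => k _; rewrite normr_ge0 /=.
by apply: le_trans (ler_normB _ _) _; rewrite normr1 normrM normrX.
Qed.

Lemma qpoch_cvg (x : R[i]) : (poch p ^~ x : nat -> R[i]^o) @ \oo --> (qpoch x p : R[i]^o).
Proof.
suff [l hl] : exists l : R[i], (poch p ^~ x : nat -> R[i]^o) @ \oo --> (l : R[i]^o).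
  have e : qpoch x p = l by rewrite /qpoch; exact: norm_cvg_lim hl.
  by rewrite e.
have [E E0 hE] := prod_bound x.
pose r := complex.Re `|p|; pose d := complex.Re (E * `|x|).
have er : `|p| = r%:C by rewrite /r normc_def.
have ed : E * `|x| = d%:C.
  by rewrite /d; case: (pos_complex E0) => e _ ->; rewrite normc_def -rmorphM.
apply: (complex_geometric_cvg (E := d) (r := r)).
- by rewrite -lecR -er; exact: normr_ge0.
- by rewrite -ltcR -er; exact: p_lt1.
- move=> m; have -> : (d * r ^+ m)%:C = E * `|x| * `|p| ^+ m.
    by rewrite [LHS]rmorphM rmorphXn /= ed er.
  rewrite pochS.
  have -> : poch p m x * (1 - x * p ^+ m) - poch p m x = - (poch p m x * (x * p ^+ m)) by ring.
  rewrite normrN !normrM normrX mulrA; apply: ler_wpM2r; first exact: exprn_ge0.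
  by apply: ler_wpM2r => //; apply: le_trans (hE m); exact: poch_norm_le.
Qed.

(** 1 / (1 - s) = 1 + s / (1 - s) turns the inverse of the product into one to
    which [prod_bound] applies. The bound keeps the limit of the products away
    from 0 and dominates the q-binomial coefficients. *)
Lemma inv_poch_bound : exists2 E : R[i], 0 < E & forall m, `|(poch p m p)^-1| <= E.
Proof.
have [E E0 hE] := prod_bound (`|p| / (1 - `|p|)).
exists E => // m; apply: le_trans (hE m).
rewrite /poch normfV normr_prod -prodfV; apply: ler_prod => k _.
rewrite invr_ge0 normr_ge0 /=.
have p1 : 0 < 1 - `|p| by rewrite subr_gt0.
have pk : `|p| ^+ k.+1 <= `|p|.
  by rewrite exprS ler_piMr // exprn_ile1 // ltW.
have pk1 : 0 < 1 - `|p| ^+ k.+1 by rewrite subr_gt0 (le_lt_trans pk).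
apply: le_trans (_ : (1 - `|p| ^+ k.+1)^-1 <= _).
  rewrite lef_pV2 ?posrE //.
    by have := lerB_dist 1 (p ^+ k.+1); rewrite normr1 normrX !exprS.
  by rewrite normr_gt0 -exprS subr_eq0 eq_sym p_root.
have -> : `|(`|p| / (1 - `|p|))| = `|p| / (1 - `|p|) by rewrite ger0_norm // divr_ge0 // ltW.
have -> : (1 - `|p| ^+ k.+1)^-1 = 1 + `|p| ^+ k.+1 / (1 - `|p| ^+ k.+1).
  by field; rewrite gt_eqF.
rewrite lerD2l mulrAC -exprS ler_wpM2l ?exprn_ge0 //.
by rewrite lef_pV2 ?posrE // lerD2l lerN2.
Qed.

Lemma poch_bound : exists2 E : R[i], 0 < E & forall m, `|poch p m p| <= E.
Proof.
have [E E0 hE] := prod_bound p; exists E => // m.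
exact: le_trans (poch_norm_le _ _) (hE m).
Qed.

Lemma qpoch_neq0 : qpoch p p != 0.
Proof.
apply/eqP => e; have := @qpoch_cvg p; rewrite e => /complex_cvgP h.
have [E E0 hE] := inv_poch_bound.
have [|M0 /(_ M0 (leqnn _))] := h ((2 * E)^-1); first by rewrite invr_gt0 mulr_gt0.
rewrite subr0 => le.
have nz := poch_neq0 p_root M0.
have := hE M0; rewrite normfV => le'.
have : `|poch p M0 p| * `|poch p M0 p|^-1 <= (2 * E)^-1 * E.
  by apply: ler_pM => //; rewrite invr_ge0.
rewrite divff ?normr_eq0 // invfM mulrAC -mulrA divff ?gt_eqF // mulr1.
by rewrite lt_geF // invf_lt1 // ltr1n.
Qed.

(** With the factor (p;p)_M, which becomes the factor (p;p)_oo of Theta, the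
    coefficients tend to 1 for every k. *)
Definition normalized_qbinom (M : nat) (k : int) : R[i] := central_qbinom p M k * poch p M p.

Lemma normalized_qbinom_bound : exists2 E : R[i], 0 < E & forall M k, `|normalized_qbinom M k| <= E.
Proof.
have [E1 E10 hE1] := poch_bound; have [E2 E20 hE2] := inv_poch_bound.
exists (E1 * (E2 * E2) * E1); first by rewrite !mulr_gt0.
move=> M k; rewrite /normalized_qbinom /central_qbinom invfM !normrM.
by do !apply: ler_pM => //; rewrite ?mulr_ge0.
Qed.

Lemma normalized_qbinom_cvg k : (normalized_qbinom ^~ k : nat -> R[i]^o) @ \oo --> (1 : R[i]^o).
Proof.
have e0 := qpoch_neq0.
have -> : 1 = qpoch p p / (qpoch p p * qpoch p p) * qpoch p p :> R[i].
  by field.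
have lim kappa : (forall M0, exists M1, forall M, (M1 <= M)%N -> (M0 <= kappa M)%N) ->
    ((fun M => poch p (kappa M) p) : nat -> R[i]^o) @ \oo --> (qpoch p p : R[i]^o).
  by move=> hk; apply: (cvg_subsequence (@qpoch_cvg p) hk).
rewrite /normalized_qbinom /central_qbinom.
apply: cvgM; last by apply: (lim id) => M0; exists M0.
apply: cvgM; first by apply: (lim (fun M => M + M)%N) => M0; exists M0 => M; lia.
apply: cvgV; first by rewrite mulf_neq0.
apply: cvgM; apply: lim => M0; exists (M0 + absz k)%N => M; lia.
Qed.

End ThetaLimits.

(** * The addition law of the bracket *)

(** The relation between the 2 x 2 minors of four vectors (g, h). *)
Lemma plucker_identity (K : comRingType) (gx hx ga ha gb hb gc hc : K) :
  (hx * ga - gx * ha) * (hb * gc - gb * hc)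
  + (hx * gb - gx * hb) * (hc * ga - gc * ha)
  + (hx * gc - gx * hc) * (ha * gb - ga * hb) = 0.
Proof. by ring. Qed.

Section ThetaDeterminant.
Variables (R : realType) (p : R[i]).
Hypotheses (p_neq0 : p != 0) (p_lt1 : `|p| < 1).

Lemma norm_exprz (z : R[i]) (k : int) : `|z ^ k| = `|z| ^ k.
Proof.
case: k => m; first by rewrite -!exprnP normrX.
by rewrite NegzE -!exprnN normfV normrX.
Qed.

(** So a q-binomial coefficient with 0 <= r < 1 is at least 1. *)
Lemma poch_mul_le (r : R[i]) a b : 0 <= r -> r <= 1 ->
  poch r a r * poch r b r <= poch r (a + b) r.
Proof.
move=> r0 r1; rewrite [in leRHS]/poch big_split_ord /=.
have nn k : 0 <= 1 - r * r ^+ k by rewrite -exprS subr_ge0 exprn_ile1.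
apply: ler_wpM2l; first by apply: prodr_ge0 => k _; exact: nn.
apply: ler_prod => k _; rewrite nn /= lerD2l lerN2 ler_wpM2l //.
by rewrite exprD ler_piMl ?exprn_ge0 // exprn_ile1.
Qed.

Lemma symrange_absz (M : nat) (k : int) : `|k| <= Posz M ->
  (M + M = absz (Posz M + k)%R + absz (Posz M - k)%R)%N.
Proof. by clear; lia. Qed.

(** The finite triple product for |p| and - |z| has nonnegative terms whose
    q-binomial coefficients are at least 1, by [poch_mul_le], so it bounds the
    sum of the absolute values. *)
Lemma theta_term_bound (z : R[i]) : z != 0 ->
  exists C : R[i], forall M, \sum_(k <- symrange M) `|theta_term p z k| <= C.
Proof.
move=> z0; move: (p_neq0) (p_lt1); rewrite -normr_eq0.
have : 0 <= `|p| by [].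
set r := `|p| => r_ge0 r0 r_lt1.
have r_root k : r ^+ k.+1 != 1 by rewrite lt_eqF // exprn_ilt1.
have [E1 E10 hE1] := prod_bound p_lt1 z.
have [E2 E20 hE2] := prod_bound p_lt1 (r / `|z|).
exists (E1 * E2) => M.
have mz0 : - `|z| != 0 by rewrite oppr_eq0 normr_eq0.
have := finite_triple_product r0 r_root M mz0.
have -> : poch r M (- `|z|) = \prod_(k < M) (1 + `|z| * r ^+ k).
  by apply: eq_bigr => k _; rewrite mulNr opprK.
have -> : poch r M (r / - `|z|) = \prod_(k < M) (1 + `|(r / `|z|)| * r ^+ k).
  apply: eq_bigr => k _.
  by rewrite invrN mulrN mulNr opprK [`|(_ / _)|]ger0_norm // divr_ge0.
rewrite opprK => h.
apply: le_trans (_ : \prod_(k < M) (1 + `|z| * r ^+ k)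
   * \prod_(k < M) (1 + `|(r / `|z|)| * r ^+ k) <= _); last first.
  by apply: ler_pM => //; apply: prodr_ge0 => k _;
    rewrite addr_ge0 // mulr_ge0 // exprn_ge0.
rewrite h big_seq [leRHS]big_seq; apply: ler_sum => k; rewrite mem_symrange => kM.
rewrite /theta_term normrM normrX norm_exprz normrN -/r.
rewrite ler_peMr //; first by rewrite mulr_ge0 // ?exprn_ge0 // exprz_ge0.
rewrite /central_qbinom.
have pos m : 0 < poch r m r.
  apply: prodr_gt0 => i _; rewrite -exprS subr_gt0 exprn_ilt1 //.
rewrite ler_pdivlMr ?mulr_gt0 // mul1r.
rewrite (symrange_absz kM).
by apply: poch_mul_le => //; exact: ltW.
Qed.

Definition theta_partial M (z : R[i]) := poch p M z * poch p M (p / z) * poch p M p.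

Lemma theta_partial_cvg z :
  (theta_partial ^~ z : nat -> R[i]^o) @ \oo --> (Theta p z : R[i]^o).
Proof. by apply: cvgM; [apply: cvgM|]; exact: qpoch_cvg. Qed.

Lemma theta_partialE M z : z != 0 ->
  theta_partial M z = \sum_(k <- symrange M) normalized_qbinom p M k * theta_term p z k.
Proof.
move=> z0; rewrite /theta_partial (finite_triple_product p_neq0 (p_root p_lt1)) // mulr_suml.
by apply: eq_bigr => k _; rewrite /normalized_qbinom /theta_term; ring.
Qed.

(** The coefficients of the difference between the product of two truncated theta
    functions, a weighted sum over a square, and the plain sum over the
    rotated square. *)
Definition defect M (t : int * int) : R[i] :=
  (if t \in square M then normalized_qbinom p M t.1 * normalized_qbinom p M t.2 else 0)
  - (t \in rotated_square M)%:R.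

Lemma defect_cvg t : (defect ^~ t : nat -> R[i]^o) @ \oo --> (0 : R[i]^o).
Proof.
have /complex_cvgP h : ((fun M => normalized_qbinom p M t.1 * normalized_qbinom p M t.2) : nat -> R[i]^o) @ \oo
    --> (1 : R[i]^o).
  by rewrite -[X in _ --> X]mulr1; apply: cvgM; exact: normalized_qbinom_cvg.
apply/complex_cvgP => e e0.
have [M0 hM0] := h e e0.
exists (maxn M0 (absz t.1 + absz t.2).+1) => M; rewrite geq_max => /andP[le0 le1].
have tM : t \in square M.-1 by rewrite mem_square; lia.
rewrite subr0 /defect (square_mono (leq_pred _) tM).
have := rotated_square_sup tM; rewrite prednK; last by lia.
by move=> ->; exact: hM0.
Qed.

Lemma sum_in_square (s : seq (int * int)) k (f : int * int -> R[i]) :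
  uniq s -> {subset s <= square k} ->
  \sum_(t <- s) f t = \sum_(t <- square k) (t \in s)%:R * f t.
Proof.
move=> us sub; rewrite [RHS](sum_subset _ us (square_uniq k) sub).
rewrite [X in _ + X]big1 ?addr0 => [|t /negPf ->]; last by rewrite mul0r.
by rewrite big_seq [RHS]big_seq; apply: eq_bigr => t ->; rewrite mul1r.
Qed.

Definition determinant M (X Z : R[i]) :=
  odd_sum p M X * even_sum p M Z - even_sum p M X * odd_sum p M Z.

(** X times the determinant is the sum of the double series over a rotated square,
    and it differs from the product of the truncated theta functions by bounded
    coefficients that tend to 0 at each pair of indices. *)
Lemma determinant_cvg X Z : X != 0 -> Z != 0 ->
  (determinant ^~ X ^~ Z : nat -> R[i]^o) @ \oo
    --> (X^-1 * (Theta p (X * Z) * Theta p (X / Z)) : R[i]^o).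
Proof.
move=> X0 Z0.
have XZ0 : X * Z != 0 by rewrite mulf_neq0.
have XdZ0 : X / Z != 0 by rewrite mulf_neq0 ?invr_neq0.
have [C1 hC1] := theta_term_bound XZ0; have [C2 hC2] := theta_term_bound XdZ0.
have [D D0 hD] := normalized_qbinom_bound p_lt1.
have sum_le k : \sum_(t <- square k) `|plane_term p X Z t| <= C1 * C2.
  rewrite big_allpairs (eq_bigr (fun m => `|theta_term p (X * Z) m|
     * \sum_(j <- symrange k) `|theta_term p (X / Z) j|)); last first.
    by move=> m _; rewrite mulr_sumr; apply: eq_bigr => j _; rewrite normrM.
  rewrite -mulr_suml; apply: ler_pM; [exact: sumr_ge0|exact: sumr_ge0|exact: hC1|exact: hC2].
have defect_le M t : `|defect M t| <= D * D + 1.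
  apply: le_trans (ler_normB _ _) _; apply: lerD; last by case: (_ \in _); rewrite ?normr1 ?normr0.
  case: ifP => _; last by rewrite normr0 mulr_ge0 // ltW.
  by rewrite normrM ler_pM.
have DD0 : 0 < D * D + 1 by rewrite addr_gt0 ?mulr_gt0.
have lim0 := dominated_square_sum (fun M => (M + M).+1) sum_le DD0 defect_le defect_cvg.
have eqn M : X^-1 * (theta_partial M (X * Z) * theta_partial M (X / Z))
    - X^-1 * \sum_(t <- square (M + M).+1) defect M t * plane_term p X Z t = determinant M X Z.
  have -> : \sum_(t <- square (M + M).+1) defect M t * plane_term p X Z t
      = theta_partial M (X * Z) * theta_partial M (X / Z) - X * determinant M X Z.
    under eq_bigr do rewrite mulrBl.
    rewrite sumrB; congr (_ - _).
      transitivity (\sum_(t <- square M) normalized_qbinom p M t.1 * theta_term p (X * Z) t.1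
        * (normalized_qbinom p M t.2 * theta_term p (X / Z) t.2)); last first.
        by rewrite [LHS]big_allpairs !theta_partialE // big_distrlr.
      rewrite [RHS](@sum_in_square _ (M + M).+1) ?square_uniq //; last first.
        by apply: square_mono; rewrite leqW // leq_addr.
      by apply: eq_bigr => t _; case: ifP => _; rewrite ?mul0r // mul1r mulrACA.
    rewrite /determinant -rotated_square_sum //.
    rewrite [RHS](@sum_in_square _ (M + M).+1) ?rotated_square_uniq //.
    by move=> t; exact: rotated_square_sub.
  by rewrite mulrBr opprB addrCA subrr addr0 mulKf.
rewrite -[X in _ --> X]subr0 -[X in _ - X](mulr0 X^-1).
rewrite (_ : determinant ^~ X ^~ Z = (fun M => X^-1 * (theta_partial M (X * Z) * theta_partial M (X / Z))
    - X^-1 * \sum_(t <- square (M + M).+1) defect M t * plane_term p X Z t)); last first.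
  by apply/funext => M; rewrite eqn.
apply: cvgB; apply: cvgM; try exact: cvg_cst; last exact: lim0.
by apply: cvgM; exact: theta_partial_cvg.
Qed.

Lemma theta_plucker (f := fun X Z : R[i] => X^-1 * (Theta p (X * Z) * Theta p (X / Z))) X A B C :
  X != 0 -> A != 0 -> B != 0 -> C != 0 ->
  f X A * f B C + f X B * f C A + f X C * f A B = 0.
Proof.
move=> X0 A0 B0 C0.
have pair_cvg x a b c : x != 0 -> a != 0 -> b != 0 -> c != 0 ->
    ((fun M => determinant M x a * determinant M b c) : nat -> R[i]^o) @ \oo
      --> (f x a * f b c : R[i]^o).
  by move=> *; apply: cvgM; exact: determinant_cvg.
have zero M : 0 = determinant M X A * determinant M B C
    + determinant M X B * determinant M C A + determinant M X C * determinant M A B.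
  exact: esym (plucker_identity _ _ _ _ _ _ _ _).
have lim : ((fun=> 0) : nat -> R[i]^o) @ \oo
    --> (f X A * f B C + f X B * f C A + f X C * f A B : R[i]^o).
  have -> : (fun=> 0) = (fun M => determinant M X A * determinant M B C
      + determinant M X B * determinant M C A + determinant M X C * determinant M A B).
    by apply/funext => M; exact: zero.
  by apply: cvgD; [apply: cvgD|]; exact: pair_cvg.
have lim0 : ((fun=> 0) : nat -> R[i]^o) @ \oo --> (0 : R[i]^o) by exact: cvg_cst.
exact: (norm_cvg_unique lim lim0).
Qed.

Lemma poch_shift M x : poch p M.+1 x = (1 - x) * poch p M (x * p).
Proof.
rewrite /poch big_ord_recl expr0 mulr1; congr (_ * _); apply: eq_bigr => k _.
by rewrite /= exprS mulrA.
Qed.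

Lemma qpoch_shift x : qpoch x p = (1 - x) * qpoch (x * p) p.
Proof.
apply: (@norm_cvg_unique _ R[i]^o (((fun M => poch p M.+1 x) : nat -> R[i]^o) @ \oo)).
- apply: (@cvg_subsequence _ (poch p ^~ x) _ S); first exact: qpoch_cvg.
  by move=> M0; exists M0 => M; exact: leqW.
- rewrite (_ : (fun M => poch p M.+1 x) = (fun M => (1 - x) * poch p M (x * p))).
    by apply: cvgM; [exact: cvg_cst|exact: qpoch_cvg].
  by apply/funext => M; exact: poch_shift.
Qed.

(** Inversion of z moves one factor from one of the infinite products to the
    other, which is [qpoch_shift]. *)
Lemma Theta_inv z : z != 0 -> Theta p z^-1 = - z^-1 * Theta p z.
Proof.
move=> z0; rewrite /Theta invrK (qpoch_shift z) (qpoch_shift z^-1) [p * z]mulrC [p / z]mulrC.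
by field.
Qed.

End ThetaDeterminant.

Section Bracket.
Variable R : realType.

Lemma cexpD (z w : R[i]) : cexp (z + w) = cexp z * cexp w.
Proof.
rewrite /cexp; case: z w => [a b] [c d] /=; rewrite expRD rmorphM /= mulrACA; congr (_ * _).
by rewrite cosD sinD; apply/eqP; rewrite eq_complex /= eqxx [sin b * _ + _]addrC eqxx.
Qed.

Lemma cexp0 : cexp 0 = 1 :> R[i].
Proof. by rewrite /cexp /= expR0 cos0 sin0 mul1r. Qed.

Lemma cexp_norm (z : R[i]) : `|cexp z| = (expR (complex.Re z))%:C.
Proof.
rewrite /cexp normrM [X in _ * X]normc_def /= cos2Dsin2 sqrtr1 mulr1.
by rewrite normc_def /= expr0n addr0 sqrtr_sqr ger0_norm // expR_ge0.
Qed.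

Lemma cexp_neq0 (z : R[i]) : cexp z != 0.
Proof. by rewrite -normr_eq0 cexp_norm gt_eqF // ltcR expR_gt0. Qed.

Variables (q logq : R[i]) (r : R).
Hypotheses (q_lt1 : `|q| < 1) (logqE : cexp logq = q) (r_gt0 : 0 < r).

Local Notation "q^ x" := (qpow logq x) (at level 35).
Let p := qpow logq (2 * r%:C).

Lemma qpowD x y : q^ (x + y) = q^ x * q^ y.
Proof. by rewrite /qpow mulrDl cexpD. Qed.

Lemma qpow_neq0 x : q^ x != 0.
Proof. exact: cexp_neq0. Qed.

Lemma qpowN x : q^ (- x) = (q^ x)^-1.
Proof.
apply: (mulfI (qpow_neq0 x)); rewrite -qpowD subrr divff ?qpow_neq0 //.
by rewrite /qpow mul0r cexp0.
Qed.

Lemma nome_lt1 : `|p| < 1.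
Proof.
have re : complex.Re logq < 0.
  by move: q_lt1; rewrite -logqE cexp_norm -[X in _ < X]/(1%:C) ltcR -expR0 ltr_expR.
rewrite /p /qpow cexp_norm -[X in _ < X]/(1%:C) ltcR -expR0 ltr_expR.
have -> : complex.Re (2 * r%:C * logq) = 2 * r * complex.Re logq.
  have -> : 2 * r%:C = (2 * r)%:C :> R[i] by rewrite rmorphM rmorph_nat.
  by case: logq => a b /=; rewrite mul0r subr0.
by rewrite pmulr_rlt0 // mulr_gt0.
Qed.

Lemma bracket_odd : {morph bracket logq r : z / - z}.
Proof.
move=> z.
rewrite /bracket sqrrN mulrN qpowN Theta_inv ?qpow_neq0 //; last exact: nome_lt1.
have -> : z ^+ 2 / r%:C - - z = z ^+ 2 / r%:C - z + 2 * z by ring.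
rewrite qpowD; have := qpow_neq0 (2 * z); move: (q^ (2 * z)) => w w0.
by field.
Qed.

Definition theta_pair X Y : R[i] := X^-1 * (Theta p (X * Y) * Theta p (X / Y)).

(** The exponents - (x + y) and - (x - y) of the prefactors add up to - 2 x, which
    gives the factor X^-1 of [theta_pair]; the quadratic ones have no mixed term. *)
Lemma bracket_pair x y : bracket logq r (x + y) * bracket logq r (x - y)
  = q^ (2 * (x ^+ 2 + y ^+ 2) / r%:C) * theta_pair (q^ (2 * x)) (q^ (2 * y)).
Proof.
rewrite /theta_pair /bracket -/p.
have -> : 2 * (x + y) = 2 * x + 2 * y by ring.
have -> : 2 * (x - y) = 2 * x + - (2 * y) by ring.
rewrite !(qpowD (2 * x)) (qpowN (2 * y)) -(qpowN (2 * x)).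
move: (Theta p (q^ (2 * x) * q^ (2 * y))) (Theta p (q^ (2 * x) / q^ (2 * y))) => T1 T2.
rewrite [LHS]mulrACA [RHS]mulrA -!qpowD; congr (qpow _ _ * _); field.
by rewrite eq_complex /= gt_eqF.
Qed.

Lemma bracket_pairs x a b d :
  bracket logq r (x + a) * bracket logq r (x - a)
  * (bracket logq r (b + d) * bracket logq r (b - d))
  = q^ (2 * (x ^+ 2 + (a ^+ 2 + b ^+ 2 + d ^+ 2)) / r%:C)
    * (theta_pair (q^ (2 * x)) (q^ (2 * a)) * theta_pair (q^ (2 * b)) (q^ (2 * d))).
Proof.
rewrite (bracket_pair x) (bracket_pair b).
move: (theta_pair (q^ (2 * x)) _) (theta_pair (q^ (2 * b)) _) => T1 T2.
by rewrite [LHS]mulrACA -qpowD; congr (qpow _ _ * _); ring.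
Qed.

(** In the coordinates h and s of the addition law, [bracket_pairs] gives the same
    power of q in the three terms, and [theta_plucker] remains. *)
Lemma bracket_three_term : three_term (bracket logq r).
Proof.
move=> x y a b d; pose h := (x + y) / 2; pose s := (x - y) / 2.
have term c e f : bracket logq r (x + c) * bracket logq r (y - c)
    * (bracket logq r (e - f) * bracket logq r (x - y + e + f))
    = q^ (2 * (h ^+ 2 + ((c + s) ^+ 2 + (e + s) ^+ 2 + (f + s) ^+ 2)) / r%:C)
      * (theta_pair (q^ (2 * h)) (q^ (2 * (c + s)))
         * theta_pair (q^ (2 * (e + s))) (q^ (2 * (f + s)))).
  rewrite -bracket_pairs [bracket _ _ (e - f) * _]mulrC.
  by congr (bracket _ _ _ * bracket _ _ _ * (bracket _ _ _ * bracket _ _ _));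
    rewrite /h /s; field.
have rot2 u v w : v + w + u = u + v + w :> R[i] by ring.
have rot3 u v w : w + u + v = u + v + w :> R[i] by ring.
rewrite (term a b d) (term b d a) (term d a b).
rewrite (rot2 ((a + s) ^+ 2)) (rot3 ((a + s) ^+ 2)) -!mulrDr.
have pl := theta_plucker (qpow_neq0 (2 * r%:C)) nome_lt1 (qpow_neq0 (2 * h))
  (qpow_neq0 (2 * (a + s))) (qpow_neq0 (2 * (b + s))) (qpow_neq0 (2 * (d + s))).
by rewrite [X in _ * X]pl mulr0.
Qed.

End Bracket.

(** * Orthogonality for the elliptic bracket *)

Theorem proposition5p4 (R : realType) (q logq : R[i]) (r : R)
    (q_gt0 : 0 < `|q|) (q_lt1 : `|q| < 1) (logqE : cexp logq = q) (r_gt0 : 0 < r)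
    (N n : nat) (lam : 'I_N -> nat) (lam_sum : (\sum_(l < N) lam l)%N = n)
    (u : 'I_n -> R[i]) (P : 'I_N -> 'I_N -> R[i])
    (P_add : forall j k l : 'I_N, P j k + P k l = P j l)
    (u_generic : forall i j : 'I_n, i != j -> bracket logq r (u i - u j) != 0)
    (u_generic1 : forall i j : 'I_n, bracket logq r (u i - u j + 1) != 0)
    (P_generic : forall (j k : 'I_N) (m : int), j != k -> (`|m|%N <= n)%N ->
       bracket logq r (P j k + m%:~R) != 0)
    (J K : word n N)
    (hJ : J \in partitions n lam) (hK : K \in partitions n lam) :
  \sum_(I in partitions n lam)
     W (bracket logq r) J (spec I u) u (dual_param lam P)
     * W (bracket logq r) (sigma0_word K) (spec I u) (sigma0 u) P
     / (Qfactor (bracket logq r) I u * Rfactor (bracket logq r) I u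
        * Sfactor (bracket logq r) I u ^+ 2)
  = (J == K)%:R.
Proof.
have [pot potE] := additive_potential P_add.
exact: (orthogonality (bracket_odd q_lt1 logqE r_gt0) (bracket_three_term q_lt1 logqE r_gt0)
  u_generic u_generic1 P_generic potE hJ hK).
Qed.
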